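(* Fix an integer $m\ge 1$ (the number of registers; in the paper $m=2^b$ with $b\in\mathbb{N}$). For $n$ distinct elements processed by the ExtendedHyperLogLog sketch with $m$ registers (in the idealized random model described in the context), let $Y$ be the associated indicator and $\mathbb{E}_n[Y]$ its expectation. Then, as $n\to\infty$, $$\mathbb{E}_n[Y]=\frac{n}{m}\left(\int_0^\infty f(u)^m\,du+\frac{\epsilon}{m}+o(1)\right),$$ where $$f(u)=\log_2\frac{2+u}{1+u}+\log_2\frac{4+3u}{3+3u}-\log_2\frac{4+u}{3+u},$$ and $\epsilon$ is a quantity (possibly depending on $n$ and $m$) satisfying $|\epsilon|\le 8.4\cdot 10^{-5}$.
   Context: Idealized random model of the ExtendedHyperLogLog (EHLL) sketch: each of the $n$ distinct elements of the stream is independently assigned a cell $j\in\{1,\dots,m\}$ uniformly at random and an independent value $\rho\ge 1$ with $P(\rho=k)=2^{-k}$ for $k\ge1$ (a $\mathrm{Geo}(1/2)$ variable, modeling the position of the least significant 1-bit of a uniformly random hash). For each cell $j$, let $C_1[j]$ be the maximum of the $\rho$-values of the elements assigned to cell $j$ ($C_1[j]=0$ if there are none), and let $C_2[j]\in\{0,1\}$ equal $1$ if $C_1[j]\le 1$ or some element assigned to cell $j$ has $\rho$-value exactly $C_1[j]-1$, and $C_2[j]=0$ otherwise. (Equivalently: start with $C_1\equiv0$, $C_2\equiv1$; on an element with cell $j$ and value $\rho$: if $\rho=C_1[j]+1$ set $C_1[j]\gets\rho$, $C_2[j]\gets1$; if $\rho>C_1[j]+1$ set $C_1[j]\gets\rho$,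 $C_2[j]\gets 0$; if $\rho=C_1[j]-1$ and $C_2[j]=0$ set $C_2[j]\gets1$.) Define $$Y=\left(\sum_{j=1}^m\left(2^{-C_1[j]}+(1-C_2[j])\,2^{-C_1[j]+1}\right)\right)^{-1}.$$ $\mathbb{E}_n$ denotes expectation when exactly $n$ distinct elements have been processed. *)

(* Defs.v *)
From mathcomp Require Import all_boot all_order all_algebra finmap.
From mathcomp Require Import all_classical all_reals all_analysis.

Set Implicit Arguments.
Unset Strict Implicit.
Unset Printing Implicit Defensive.

Import Order.TTheory GRing.Theory Num.Theory.

Local Open Scope classical_set_scope.
Local Open Scope ring_scope.

Definition sigma_rv d d' (Omega : measurableType d) (T : measurableType d')
    (X : Omega -> T) : set (set Omega) :=
  preimage_set_system [set: Omega] X measurable.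

Definition mutually_independent d (Omega : measurableType d) (R : realType)
    (P : probability Omega R) (I : choiceType) (G : I -> set (set Omega)) :=
  forall (J : {fset I}) (A : I -> set Omega),
    (forall i, i \in J -> G i (A i)) ->
    P (\bigcap_(i in [set` J]) A i) = (\prod_(i <- J) P (A i))%E.

(* [cell i] and [rho i] are the cell, numbered from 0, and the value of the i-th
   distinct element of the stream; the sketch of n elements reads elements 0 to
   n - 1. The laws below force [cell i < m] and [rho i >= 1] almost surely. *)
Definition ehll_model d (Omega : measurableType d) (R : realType)
    (P : probability Omega R) (m : nat) (cell rho : nat -> {RV P >-> nat}) :=
  [/\ forall i j, (j < m)%N -> P (cell i @^-1` [set j]) = (m%:R^-1)%:E,
      forall i k, (1 <= k)%N -> P (rho i @^-1` [set k]) = (2 ^- k)%:E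
    & mutually_independent P (fun s : nat + nat =>
        match s with
        | inl i => sigma_rv (cell i)
        | inr i => sigma_rv (rho i)
        end)].

Section sketch.
Context {Omega : Type}.
Variables (cell rho : nat -> Omega -> nat).

Definition ehll_C1 (n j : nat) (w : Omega) : nat :=
  \max_(i < n | cell i w == j) rho i w.

Definition ehll_C2 (n j : nat) (w : Omega) : bool :=
  (ehll_C1 n j w <= 1)%N ||
  [exists i : 'I_n, (cell i w == j) && (rho i w == (ehll_C1 n j w - 1)%N)].

Definition ehll_Y (R : realType) (m n : nat) (w : Omega) : R :=
  (\sum_(j < m)
     (2 ^ (- (ehll_C1 n j w)%:Z) +
      (1 - (ehll_C2 n j w)%:R) * 2 ^ (- (ehll_C1 n j w)%:Z + 1)))^-1.

End sketch.

Definition log2 (R : realType) (x : R) : R := ln x / ln 2.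

Definition ehll_f (R : realType) (u : R) : R :=
  log2 ((2 + u) / (1 + u)) + log2 ((4 + 3 * u) / (3 + 3 * u))
  - log2 ((4 + u) / (3 + u)).

(* Main.v *)
(** When the number of elements is Poisson of mean [m x], the cells become
    independent. Writing [1 / z = x * \int_0^oo exp (- x z u) du] with [z] the sum
    defining [1 / Y], the mean of [Y] is then [x * \int_0^oo T(u) ^ m du], where [T(u)]
    is the Laplace transform of the contribution of one cell. Up to exponentially
    small terms [T(u)] is a sum over [k] of [h(x / 2 ^ k)] for a combination [h] of
    exponentials; such dyadic sums are almost constant in [x], their oscillation being
    governed by that of [\sum_k y / 2 ^ k * exp (- y / 2 ^ k)] around [1 / ln 2], which
    is at most [1.5e-5] by a verified interval computation over one octave. This gives
    [|T - f| <= eta * w] with [f + eta * w <= 1 / (1 + 9 u / 10)], whence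
    [|\int T ^ m - \int f ^ m| <= 8.4e-5 / m] for [m >= 2]. Since [Y] increases with
    the number of elements, the Poisson law can be replaced by a fixed number of
    elements at the cost of a factor [1 + o(1)]. For [m = 1] both sides are infinite.

    The mean of [Y] at fixed [n] is computed on the event that all [C1] are at most [K],
    where [Y] is a finite combination of indicators of events constraining every element
    separately (inclusion-exclusion in each cell). *)

Require Import Defs.
From Stdlib Require Import ZArith.
From mathcomp Require Import all_boot all_order all_algebra finmap.
From mathcomp Require Import all_classical all_reals all_analysis measurable_realfun.
From mathcomp Require Import ring lra zify ssrZ.

Set Implicit Arguments.
Unset Strict Implicit.
Unset Printing Implicit Defensive.

Import Order.TTheory GRing.Theory Num.Theory.
Import numFieldNormedType.Exports.

Local Open Scope classical_set_scope.
Local Open Scope ring_scope.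

(** The error term [eps / m] dictates the form of the bound on [T - f]. As [f 0 = 1] and [f]
    decreases with a nonzero slope there, [\int f ^ m.-1] is of order [1 / m]: an error on [T] that
    did not vanish at [u = 0] would move [\int T ^ m] by a quantity of order 1. A bound linear in
    [u] near 0 gains a further factor [1 / m]; a decrease like [1 / u] at infinity is what makes its
    product with [f] integrable when [m = 2].

    Logarithms come out of exponentials because [v] times the derivative of
    [\sum_k exp (- v / 2 ^ k)] is minus the sum over [k] of [y * exp (- y)] at [y = v / 2 ^ k].
    Integrated against [dv / v], a nearly constant sum [1 / ln 2] gives [(ln b - ln a) / ln 2], with
    an error [eta * (ln b - ln a)]. The error on [T] is thus [eta] times the total length of three
    logarithmic intervals, and depends on how the six exponentials of [hker] are paired.

    The truncation at [K] keeps the signed inclusion-exclusion sums finite; limits are taken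
    afterwards, on monotone nonnegative quantities. *)

Section monotonicity.
Context {R : realType}.
Implicit Types (F dF : R -> R) (a b x y z : R).

Lemma nondecreasing_of_derive F dF a b : a <= b ->
  (forall x, a <= x <= b -> is_derive x 1 F (dF x)) ->
  (forall x, a <= x <= b -> 0 <= dF x) -> F a <= F b.
Proof.
move=> ab der dF0.
have ccF : {within `[a, b], continuous F}.
  apply: derivable_within_continuous => x; rewrite in_itv /= => /der h.
  exact: (@ex_derive _ _ _ _ _ _ _ h).
have [|c] := @MVT_segment R F dF a b ab _ ccF.
  by move=> x; rewrite in_itv /= => /andP[ax xb]; apply: der; rewrite !ltW.
rewrite in_itv /= => cab e; rewrite -subr_ge0 e mulr_ge0 ?dF0 ?subr_ge0 //.
Qed.

Lemma le_of_derive F dF z : 0 <= z -> F 0 = 0 ->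
  (forall x, 0 <= x -> is_derive x 1 F (dF x)) ->
  (forall x, 0 <= x -> 0 <= dF x) -> 0 <= F z.
Proof.
move=> z0 F0 der dF0; rewrite -F0; apply: (@nondecreasing_of_derive F dF) => //.
- by move=> x /andP[x0 _]; apply: der.
- by move=> x /andP[x0 _]; apply: dF0.
Qed.

(** The derivative of each Taylor gap is the gap of the preceding order, so this bound and the next
    two follow in turn from [1 + x <= exp x]. *)
Lemma expRN_le2 z : 0 <= z -> expR (- z) <= 1 - z + z ^+ 2 / 2.
Proof.
move=> z0; rewrite -subr_ge0.
apply: (@le_of_derive (fun z => 1 - z + z ^+ 2 / 2 - expR (- z))
  (fun z => - 1 + z + expR (- z))) => //.
- by rewrite oppr0 expR0; field.
- by move=> x _; apply: is_derive_eq; rewrite /GRing.scale/=; field.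
- by move=> x _; have := expR_ge1Dx (- x); lra.
Qed.

Lemma expRN_ge3 z : 0 <= z -> 1 - z + z ^+ 2 / 2 - z ^+ 3 / 6 <= expR (- z).
Proof.
move=> z0; rewrite -subr_ge0.
apply: (@le_of_derive (fun z => expR (- z) - (1 - z + z ^+ 2 / 2 - z ^+ 3 / 6))
  (fun z => - expR (- z) + 1 - z + z ^+ 2 / 2)) => //.
- by rewrite oppr0 expR0; field.
- by move=> x _; apply: is_derive_eq; rewrite /GRing.scale/=; field.
- by move=> x x0; have := expRN_le2 x0; lra.
Qed.

Lemma expRN_le4 z : 0 <= z ->
  expR (- z) <= 1 - z + z ^+ 2 / 2 - z ^+ 3 / 6 + z ^+ 4 / 24.
Proof.
move=> z0; rewrite -subr_ge0.
apply: (@le_of_derive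
  (fun z => 1 - z + z ^+ 2 / 2 - z ^+ 3 / 6 + z ^+ 4 / 24 - expR (- z))
  (fun z => expR (- z) - (1 - z + z ^+ 2 / 2 - z ^+ 3 / 6))) => //.
- by rewrite oppr0 expR0; field.
- by move=> x _; apply: is_derive_eq; rewrite /GRing.scale/=; field.
- by move=> x x0; have := expRN_ge3 x0; lra.
Qed.

End monotonicity.

(** * Enclosures of dyadic sums of exponentials *)

Section fixed_point.
Local Open Scope Z_scope.

(* A pair of integers [(l, h)] encloses [x] when [l <= 2 ^ 64 * x <= h]. From an
   enclosure of [exp (- w)], squaring produces those of [exp (- w * 2 ^ i)]. *)
Definition fx : Z := 18446744073709551616.

Definition box_sqr (b : Z * Z) : Z * Z :=
  (Z.shiftr (b.1 * b.1) 64, Z.shiftr (b.2 * b.2) 64 + 1).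

(** The bounds [1 - y <= exp (- y) <= 1 - y + y ^ 2 / 2] in units of [2 ^ -64]: the shift by 65
    divides by [2 * 2 ^ 64], and the final 1 makes up for its rounding down. *)
Definition box_init (Y : Z) : Z * Z :=
  (fx - Y, fx - Y + Z.shiftr (Y * Y) 65 + 1).

Definition boxes (Y : Z) (n : nat) := traject box_sqr (box_init Y) n.

Definition moment (j : Z) (l : seq Z) : Z :=
  foldr (fun e a => e + Z.shiftl a (j + 1)) 0 l.

(* With [w = (n + t) / 2 ^ 30] and [0 <= t <= 1], bounds the sum
   [w * \sum_(i < 30) 2 ^ i * exp (- w * 2 ^ i)] between 1.4426802 and 1.4427095:
   [l0 .. h4] enclose the Taylor coefficients in [t] at [n / 2 ^ 30], and the
   expansion is stopped at order 3 from below and at order 4 from above. *)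
Definition cell_check (n : Z) : bool :=
  let b := boxes (n * 17179869184) 30 in
  let bl := map fst b in let bh := map snd b in
  let l0 := moment 0 bl in
  let h0 := moment 0 bh in
  let l1 := Z.shiftr (moment 1 bl) 30 in
  let h1 := Z.shiftr (moment 1 bh) 30 + 1 in
  let l2 := Z.shiftr (moment 2 bl) 60 / 2 in
  let h2 := Z.shiftr (moment 2 bh) 60 / 2 + 1 in
  let l3 := Z.shiftr (moment 3 bl) 90 / 6 in
  let h3 := Z.shiftr (moment 3 bh) 90 / 6 + 1 in
  let h4 := Z.shiftr (moment 4 bh) 120 / 24 + 1 in
  let lo := n * l0 + Z.min 0 (l0 - n * h1) + Z.min 0 (n * l2 - h1)
    + Z.min 0 (l2 - n * h3) - h3 in
  let hi := n * h0 + Z.max 0 (h0 - n * l1) + Z.max 0 (n * h2 - l1)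
    + Z.max 0 (h2 - n * l3) + Z.max 0 (n * h4 - l3) + h4 in
  (64 * 14426802 * Z.shiftl 1 88 <=? 10000000 * lo) &&
  (10000000 * hi <=? 64 * 14427095 * Z.shiftl 1 88).

(** The intervals [[n, n + 1]] for [n] from 64 to 127 cover one octave, which suffices because
    halving the argument shifts the dyadic sum. *)
Lemma cells_check : all (fun i : nat => cell_check (Z.of_nat i)) (iota 64 64).
Proof. by vm_compute. Qed.

End fixed_point.

(** * Soundness of the fixed-point enclosures *)

Section fixed_point_sound.
Context {R : realType}.
Implicit Types (x y : R) (a b : Z).

(* Locked: unification would otherwise unfold [zr] of large literals. *)
Definition zr : Z -> R := locked (fun a => (int_of_Z a)%:~R).

Lemma zrE a : zr a = (int_of_Z a)%:~R.
Proof. by rewrite /zr -lock. Qed.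

Lemma zr0 : zr Z0 = 0. Proof. by rewrite zrE. Qed.

Lemma zr1 : zr 1 = 1. Proof. by rewrite zrE. Qed.

Lemma zrD a b : zr (Z.add a b) = zr a + zr b.
Proof. by rewrite !zrE -rmorphD -rmorphD. Qed.

Lemma zrM a b : zr (Z.mul a b) = zr a * zr b.
Proof. by rewrite !zrE -rmorphM -rmorphM. Qed.

Lemma zrB a b : zr (Z.sub a b) = zr a - zr b.
Proof. by rewrite !zrE -rmorphB -rmorphB. Qed.

Lemma zr_le a b : Z.leb a b -> zr a <= zr b.
Proof. by move=> ab; rewrite !zrE ler_int; lia. Qed.

Lemma zr_nat (n : nat) : zr (Z.of_nat n) = n%:R.
Proof. by rewrite !zrE (_ : int_of_Z _ = n%:Z) //; lia. Qed.

Lemma zr_nat_pow2 (n : nat) : zr (Z.pow 2 (Z.of_nat n)) = 2 ^+ n.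
Proof.
rewrite (_ : Z.pow _ _ = Z.of_nat (2 ^ n)); last by lia.
by rewrite zr_nat natrX.
Qed.

Lemma zr_div a b : Z.ltb 0 b ->
  zr (Z.div a b) <= zr a / zr b <= zr (Z.div a b) + 1.
Proof.
move=> b0; have rb0 : 0 < zr b.
  by rewrite !zrE ltr0z; lia.
have := Z.mul_div_le a b; have := Z.mul_succ_div_gt a b => h1 h2.
rewrite ler_pdivlMr // ler_pdivrMr //; apply/andP; split.
  by rewrite -zrM; apply: zr_le; lia.
by rewrite -zr1 -zrD -zrM; apply: zr_le; lia.
Qed.

Lemma zr_shiftl a (n : nat) : zr (Z.shiftl a (Z.of_nat n)) = zr a * 2 ^+ n.
Proof. by rewrite Z.shiftl_mul_pow2 ?zrM ?zr_nat_pow2 //; lia. Qed.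

Lemma zr_shiftr64 a :
  zr (Z.shiftr a 64) <= zr a / zr fx <= zr (Z.shiftr a 64) + 1.
Proof. by rewrite Z.shiftr_div_pow2 //; exact: zr_div. Qed.

Lemma zr_fx_gt0 : 0 < zr fx.
Proof. by rewrite !zrE ltr0z. Qed.

Definition in_box (p : Z * Z) x :=
  0 <= zr p.1 <= zr fx * x /\ zr fx * x <= zr p.2.

Lemma box_sqr_sound p x : in_box p x -> in_box (box_sqr p) (x ^+ 2).
Proof.
case: p => l h [/= /andP[l0 lx] xh].
have l20 : 0 <= zr (Z.shiftr (Z.mul l l) 64).
  rewrite -zr0; apply: zr_le.
  have : (0 <= int_of_Z l)%R by rewrite -(ler_int R) -zrE.
  move=> l0'; have : Z.leb 0 (Z.mul l l) by lia.
  by have := Z.shiftr_nonneg (Z.mul l l) 64; lia.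
have /andP[+ _] := zr_shiftr64 (Z.mul l l).
have /andP[_ +] := zr_shiftr64 (Z.mul h h).
rewrite /in_box /box_sqr; cbn [fst snd]; rewrite zrD zr1 !zrM l20 /=.
move: (zr fx) zr_fx_gt0 l0 lx xh => F F0 l0 lx xh h1 h2.
have e : F * x ^+ 2 = (F * x) * (F * x) / F by field; rewrite gt_eqF.
have Fi : 0 < F^-1 by rewrite invr_gt0.
rewrite e; split.
  by apply: (le_trans h2); rewrite ler_pM2r // ler_pM.
by apply: le_trans h1; rewrite ler_pM2r // ler_pM // (le_trans l0).
Qed.

Lemma box_init_sound Y : Z.leb 0 Y -> Z.leb Y fx ->
  in_box (box_init Y) (expR (- (zr Y / zr fx))).
Proof.
move=> /zr_le Y0 /zr_le Yf.
have : zr (Z.mul Y Y) / (2 * zr fx) <= zr (Z.shiftr (Z.mul Y Y) 65) + 1.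
  have e65 : Z.pow 2 65 = Z.mul 2 fx by vm_compute.
  have /andP[_ +] := @zr_div (Z.mul Y Y) (Z.mul 2 fx) isT.
  by rewrite (zrM 2 fx) (_ : zr 2 = 2) ?zrE // -!zrE Z.shiftr_div_pow2 // e65.
rewrite /in_box /box_init; cbn [fst snd]; rewrite !(zrD, zrB, zrM).
move: Yf; rewrite zr0 in Y0 *.
move: (zr fx) zr_fx_gt0 => F F0 YF h1.
rewrite subr_ge0 YF /= zr1; split.
  have := expR_ge1Dx (- (zr Y / F)); rewrite -(ler_pM2l F0); apply: le_trans.
  by rewrite mulrDr mulrN mulrCA divff ?mulr1 // gt_eqF.
have := @expRN_le2 R (zr Y / F) (divr_ge0 Y0 (ltW F0)).
rewrite -(ler_pM2l F0) => h; apply: (le_trans h).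
have -> : F * (1 - zr Y / F + (zr Y / F) ^+ 2 / 2) =
    F - zr Y + zr Y * zr Y / (2 * F) by field; rewrite gt_eqF.
by move: h1; move: (zr Y * zr Y / (2 * F)) (zr (Z.shiftr _ _)) => p q; lra.
Qed.

End fixed_point_sound.

(** * Soundness of the check on one subinterval of the octave *)

Section cell_sound.
Context {R : realType}.
Implicit Types (x y t w h : R) (a b : Z) (l : seq Z) (i j n k : nat).
Local Notation zr := (@zr R).

Lemma zr_moment j l : zr (moment (Z.of_nat j) l) =
  \sum_(i < size l) (2 ^+ i) ^+ j.+1 * zr (nth Z0 l i).
Proof.
elim: l => [|a l IH]; first by rewrite big_ord0 /= zr0.
rewrite /= zrD (_ : Z.add _ 1 = Z.of_nat j.+1); last by lia.
rewrite zr_shiftl IH big_ord_recl expr0 expr1n mul1r; congr (_ + _).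
by rewrite mulr_suml; apply: eq_bigr => i _; rewrite lift0 [2 ^+ i.+1]exprS exprMn /=; ring.
Qed.

(** Up to the sign [(-1) ^ j], the [j]-th derivative in [w] of the moment of order 0, hence the
    source of its Taylor coefficients. *)
Definition window_moment j w k : R :=
  \sum_(i < k) (2 ^+ i) ^+ j.+1 * expR (- (w * 2 ^+ i)).

Lemma box_iter_sound p w k : in_box p (expR (- w)) ->
  in_box (iter k box_sqr p) (expR (- (w * 2 ^+ k))).
Proof.
elim: k => [|k IH] /= h; first by rewrite mulr1.
rewrite (_ : expR (- (w * 2 ^+ k.+1)) = expR (- (w * 2 ^+ k)) ^+ 2).
  exact: box_sqr_sound (IH h).
by rewrite -expRM_natl; congr expR; rewrite exprSr; ring.
Qed.

Lemma boxes_moment_sound (Y : Z) j k w : Z.leb 0 Y -> Z.leb Y fx ->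
  w = zr Y / zr fx ->
  zr (moment (Z.of_nat j) (map fst (boxes Y k))) <= zr fx * window_moment j w k
    <= zr (moment (Z.of_nat j) (map snd (boxes Y k))).
Proof.
move=> Y0 Yf ->.
have bs (i : 'I_k) : in_box (nth (Z0, Z0) (boxes Y k) i)
    (expR (- (zr Y / zr fx * 2 ^+ i))).
  rewrite /boxes (set_nth_default (box_init Y)) ?size_traject // nth_traject //.
  by apply: box_iter_sound; exact: box_init_sound.
rewrite !zr_moment !size_map size_traject /window_moment mulr_sumr.
apply/andP; split; apply: ler_sum => i _; have [/andP[_ h1] h2] := bs i;
  rewrite mulrCA ler_wpM2l ?exprn_ge0 //.
  by rewrite (nth_map (Z0, Z0)) // size_traject.
by rewrite (nth_map (Z0, Z0)) // size_traject.
Qed.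

(** Used with [t ^+ j] for [t]: it bounds a monomial in an unknown [t] of [[0, 1]] by an integer
    that depends only on its coefficient. *)
Lemma zr_min_le a x t : zr a <= x -> 0 <= t <= 1 -> zr (Z.min 0 a) <= t * x.
Proof.
move=> ax /andP[t0 t1].
have m0 : zr (Z.min 0 a) <= 0 by rewrite -zr0; apply: zr_le; lia.
have ma : zr (Z.min 0 a) <= zr a by apply: zr_le; lia.
have [x0|x0] := leP 0 x; first by apply: (le_trans m0); rewrite mulr_ge0.
apply: (le_trans ma); apply: (le_trans ax).
by rewrite -[leLHS]mul1r ler_wnM2r // ltW.
Qed.

Lemma zr_max_ge a x t : x <= zr a -> 0 <= t <= 1 -> t * x <= zr (Z.max 0 a).
Proof.
move=> ax /andP[t0 t1].
have m0 : 0 <= zr (Z.max 0 a) by rewrite -zr0; apply: zr_le; lia.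
have ma : zr a <= zr (Z.max 0 a) by apply: zr_le; lia.
have [x0|x0] := leP x 0; first by apply: le_trans m0; rewrite mulr_ge0_le0.
by apply: le_trans ma; apply: le_trans ax; rewrite -[leRHS]mul1r ler_wpM2r // ltW.
Qed.

Lemma window_moment_shift w h k : 0 <= h ->
  window_moment 0 w k - h * window_moment 1 w k + h ^+ 2 / 2 * window_moment 2 w k
    - h ^+ 3 / 6 * window_moment 3 w k <= window_moment 0 (w + h) k
  <= window_moment 0 w k - h * window_moment 1 w k + h ^+ 2 / 2 * window_moment 2 w k
    - h ^+ 3 / 6 * window_moment 3 w k + h ^+ 4 / 24 * window_moment 4 w k.
Proof.
move=> h0; rewrite /window_moment !mulr_sumr -!(sumrB, big_split) /=.
apply/andP; split; apply: ler_sum => i _; rewrite mulrDl opprD expRD;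
  have z0 : 0 <= h * 2 ^+ i by rewrite mulr_ge0 // exprn_ge0.
- have := ler_wpM2l (mulr_ge0 (exprn_ge0 i (ler0n R 2)) (expR_ge0 (- (w * 2 ^+ i)))) (expRN_ge3 z0).
  by set e := expR (- (w * _)); set e' := expR (- (h * _)); move: (2 ^+ i) e e' => b e e'; lra.
- have := ler_wpM2l (mulr_ge0 (exprn_ge0 i (ler0n R 2)) (expR_ge0 (- (w * 2 ^+ i)))) (expRN_le4 z0).
  by set e := expR (- (w * _)); set e' := expR (- (h * _)); move: (2 ^+ i) e e' => b e e'; lra.
Qed.

Lemma zr_shiftr_div a (k d : Z) : Z.leb 0 k -> Z.ltb 0 d ->
  zr (Z.div (Z.shiftr a k) d) <= zr a / (zr (Z.pow 2 k) * zr d)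
    <= zr (Z.div (Z.shiftr a k) d) + 1.
Proof.
move=> k0 d0; rewrite Z.shiftr_div_pow2; last by lia.
have ? : Z.lt 0 (Z.pow 2 k) by apply: Z.pow_pos_nonneg; lia.
rewrite Z.div_div; [|lia..].
by rewrite -zrM; apply: zr_div; nia.
Qed.

(** The product of [n + t] with the Taylor polynomial at [n / P] is expanded in powers of [t]. Its
    coefficients are the differences that [cell_check] compares with 0, each power of [t] being then
    replaced by its worst value. *)
Lemma cell_check_sound (P : R) (n : nat) t w : P = zr (Z.shiftl 1 30) ->
  (n <= 128)%N -> cell_check (Z.of_nat n) ->
  0 <= t <= 1 -> w = (n%:R + t) / P ->
  zr 14426802 / zr 10000000 <= w * window_moment 0 w 30 <= zr 14427095 / zr 10000000.
Proof.
move=> PE n128 chk t01 wE.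
have Y0 : Z.leb 0 (Z.mul (Z.of_nat n) 17179869184) by lia.
have YF : Z.leb (Z.mul (Z.of_nat n) 17179869184) fx by rewrite /fx; lia.
have P0 : 0 < P by rewrite PE zrE ltr0z.
have F0 := @zr_fx_gt0 R.
have eF : zr fx = P * zr 17179869184.
  have e : fx = Z.mul (Z.shiftl 1 30) 17179869184 by vm_compute.
  by rewrite [in LHS]e zrM -PE.
have q0 : 0 < zr 17179869184 by rewrite !zrE ltr0z.
set c := n%:R / P.
have cE : c = zr (Z.mul (Z.of_nat n) 17179869184) / zr fx.
  rewrite zrM zr_nat eF /c; move: (zr 17179869184) q0 => q q0.
  by rewrite invfM mulrACA divff ?mulr1 // gt_eqF.
have bm j := @boxes_moment_sound _ j 30 c Y0 YF cE.
have e1 : Z.pow 2 30 = Z.shiftl 1 30 by vm_compute.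
have e2 : Z.pow 2 60 = Z.mul (Z.shiftl 1 30) (Z.shiftl 1 30) by vm_compute.
have e3 : Z.pow 2 90 = Z.mul (Z.shiftl 1 30) (Z.mul (Z.shiftl 1 30) (Z.shiftl 1 30)).
  by vm_compute.
have e4 : Z.pow 2 120 = Z.mul (Z.mul (Z.shiftl 1 30) (Z.shiftl 1 30))
    (Z.mul (Z.shiftl 1 30) (Z.shiftl 1 30)) by vm_compute.
(* The integers of [cell_check] carry the scale [2 ^ 64] of the boxes and the factor [2 ^ 30] of
   [w = (n + t) / 2 ^ 30]; this is the [64 * 2 ^ 88] of its two comparisons. *)
have e5 : Z.mul (Z.shiftl 1 88) 64 = Z.mul fx (Z.shiftl 1 30) by vm_compute.
have P1 : zr (Z.pow 2 30) = P by rewrite e1 PE.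
have zz : zr (Z.mul (Z.shiftl 1 30) (Z.shiftl 1 30)) = P * P.
  by rewrite (zrM (Z.shiftl 1 30)) -PE.
have P2 : zr (Z.pow 2 60) = P * P by rewrite e2 zz.
have P3 : zr (Z.pow 2 90) = P * (P * P).
  by rewrite e3 (zrM (Z.shiftl 1 30)) zz -PE.
have P4 : zr (Z.pow 2 120) = P * P * (P * P).
  by rewrite e4 (zrM (Z.mul (Z.shiftl 1 30) (Z.shiftl 1 30))) zz.
have S94 : zr (Z.shiftl 1 88) * zr 64 = zr fx * P.
  by rewrite -zrM e5 (zrM fx) -PE.
have z2 : zr 2 = 2 by rewrite zrE.
have z6 : zr 6 = 6 by rewrite zrE.
have z24 : zr 24 = 24 by rewrite zrE.
have s1 a : zr (Z.shiftr a 30) <= zr a / P <= zr (Z.shiftr a 30) + 1.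
  by have := @zr_shiftr_div a 30 1 isT isT; rewrite P1 zr1 mulr1 Z.div_1_r.
have s2 a : zr (Z.div (Z.shiftr a 60) 2) <= zr a / (P * P * 2)
    <= zr (Z.div (Z.shiftr a 60) 2) + 1.
  by have := @zr_shiftr_div a 60 2 isT isT; rewrite P2 z2.
have s3 a : zr (Z.div (Z.shiftr a 90) 6) <= zr a / (P * (P * P) * 6)
    <= zr (Z.div (Z.shiftr a 90) 6) + 1.
  by have := @zr_shiftr_div a 90 6 isT isT; rewrite P3 z6.
have s4 a : zr (Z.div (Z.shiftr a 120) 24) <= zr a / (P * P * (P * P) * 24)
    <= zr (Z.div (Z.shiftr a 120) 24) + 1.
  by have := @zr_shiftr_div a 120 24 isT isT; rewrite P4 z24.
move: chk; rewrite /cell_check => /andP[/zr_le + /zr_le].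
set bl := map fst _; set bh := map snd _.
set D := fun j => zr fx * window_moment j c 30.
have [/andP[l0 h0] /andP[l1 h1] /andP[l2 h2] /andP[l3 h3] /andP[_ h4]] :
  [/\ zr (moment 0 bl) <= D 0%N <= zr (moment 0 bh),
    zr (moment 1 bl) <= D 1%N <= zr (moment 1 bh),
    zr (moment 2 bl) <= D 2%N <= zr (moment 2 bh),
    zr (moment 3 bl) <= D 3%N <= zr (moment 3 bh) &
    zr (moment 4 bl) <= D 4%N <= zr (moment 4 bh)].
  by split; [exact: (bm 0%N)|exact: (bm 1%N)|exact: (bm 2%N)|exact: (bm 3%N)|exact: (bm 4%N)].
pose a1 := D 1%N / P; pose a2 := D 2%N / (P * P * 2).
pose a3 := D 3%N / (P * (P * P) * 6); pose a4 := D 4%N / (P * P * (P * P) * 24).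
have PP : 0 < P * P by rewrite mulr_gt0.
have PPP : 0 < P * (P * P) by rewrite mulr_gt0.
have PPPP : 0 < P * P * (P * P) by rewrite mulr_gt0.
have lo1 : zr (Z.shiftr (moment 1 bl) 30) <= a1.
  have /andP[h _] := s1 (moment 1 bl); apply: (le_trans h).
  by rewrite ler_wpM2r // invr_ge0 ltW.
have up1 : a1 <= zr (Z.add (Z.shiftr (moment 1 bh) 30) 1).
  have /andP[_ h] := s1 (moment 1 bh); rewrite zrD zr1; apply: le_trans h.
  by rewrite ler_wpM2r // invr_ge0 ltW.
have lo2 : zr (Z.div (Z.shiftr (moment 2 bl) 60) 2) <= a2.
  have /andP[h _] := s2 (moment 2 bl); apply: (le_trans h).
  by rewrite ler_wpM2r // invr_ge0 mulr_ge0 // ltW.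
have up2 : a2 <= zr (Z.add (Z.div (Z.shiftr (moment 2 bh) 60) 2) 1).
  have /andP[_ h] := s2 (moment 2 bh); rewrite zrD zr1; apply: le_trans h.
  by rewrite ler_wpM2r // invr_ge0 mulr_ge0 // ltW.
have lo3 : zr (Z.div (Z.shiftr (moment 3 bl) 90) 6) <= a3.
  have /andP[h _] := s3 (moment 3 bl); apply: (le_trans h).
  by rewrite ler_wpM2r // invr_ge0 mulr_ge0 // ltW.
have up3 : a3 <= zr (Z.add (Z.div (Z.shiftr (moment 3 bh) 90) 6) 1).
  have /andP[_ h] := s3 (moment 3 bh); rewrite zrD zr1; apply: le_trans h.
  by rewrite ler_wpM2r // invr_ge0 mulr_ge0 // ltW.
have up4 : a4 <= zr (Z.add (Z.div (Z.shiftr (moment 4 bh) 120) 24) 1).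
  have /andP[_ h] := s4 (moment 4 bh); rewrite zrD zr1; apply: le_trans h.
  by rewrite ler_wpM2r // invr_ge0 mulr_ge0 // ltW.
have D0 j : 0 <= D j.
  apply: mulr_ge0; [exact: ltW|apply: sumr_ge0 => i _].
  by apply: mulr_ge0; rewrite ?expR_ge0 ?exprn_ge0.
have a3_0 : 0 <= a3 by rewrite /a3 divr_ge0 // mulr_ge0 // ltW.
have a4_0 : 0 <= a4 by rewrite /a4 divr_ge0 // mulr_ge0 // ltW.
move: lo1 up1 lo2 up2 lo3 up3 up4.
move: (moment 0 bl) (moment 0 bh) (Z.shiftr (moment 1 bl) 30)
  (Z.add (Z.shiftr (moment 1 bh) 30) 1) (Z.div (Z.shiftr (moment 2 bl) 60) 2)
  (Z.add (Z.div (Z.shiftr (moment 2 bh) 60) 2) 1) (Z.div (Z.shiftr (moment 3 bl) 90) 6)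
  (Z.add (Z.div (Z.shiftr (moment 3 bh) 90) 6) 1)
  (Z.add (Z.div (Z.shiftr (moment 4 bh) 120) 24) 1) l0 h0.
move=> L0 H0 L1 H1 L2 H2 L3 H3 H4 l0 h0 lo1 up1 lo2 up2 lo3 up3 up4 /(_ R) Lo /(_ R) Up.
clear s1 s2 s3 s4 l1 h1 l2 h2 l3 h3 h4 bm bl bh.
have /andP[t0 t1] := t01.
have tt j : 0 <= t ^+ j <= 1 by rewrite exprn_ge0 // exprn_ile1.
have wE' : w = c + t / P by rewrite wE mulrDl.
have h0' : 0 <= t / P by rewrite divr_ge0 // ltW.
have Pn0 : P != 0 by rewrite gt_eqF.
have /andP[Sl Su] := @window_moment_shift c (t / P) 30 h0'.
rewrite -wE' in Sl Su.
have SlF : D 0%N - t * a1 + t ^+ 2 * a2 - t ^+ 3 * a3 <= zr fx * window_moment 0 w 30.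
  apply: le_trans (ler_wpM2l (ltW F0) Sl); rewrite le_eqVlt; apply/orP; left; apply/eqP.
  by rewrite /a1 /a2 /a3 /D; field.
have SuF : zr fx * window_moment 0 w 30 <=
    D 0%N - t * a1 + t ^+ 2 * a2 - t ^+ 3 * a3 + t ^+ 4 * a4.
  apply: (le_trans (ler_wpM2l (ltW F0) Su)); rewrite le_eqVlt; apply/orP; left; apply/eqP.
  by rewrite /a1 /a2 /a3 /a4 /D; field.
have nt0 : 0 <= n%:R + t by rewrite addr_ge0.
have VE : w * window_moment 0 w 30 =
    (n%:R + t) * (zr fx * window_moment 0 w 30) / (zr fx * P).
  rewrite wE; move: (zr fx) F0 (window_moment _ _ _) => F F0 T.
  by field; rewrite Pn0 gt_eqF.
have q7 : 0 < zr 10000000 by rewrite zrE ltr0z.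
have FP0 : 0 < zr fx * P by rewrite mulr_gt0.
rewrite VE -S94; rewrite -S94 in FP0.
have n0 : (0 : R) <= n%:R by [].
rewrite -zr_nat in n0 nt0 *.
have nl x y a b : zr a <= x -> y <= zr b ->
    zr (Z.sub a (Z.mul (Z.of_nat n) b)) <= x - zr (Z.of_nat n) * y.
  by move=> ax yb; rewrite zrB zrM lerB // ler_wpM2l.
have nl' x y a b : zr a <= x -> y <= zr b ->
    zr (Z.sub (Z.mul (Z.of_nat n) a) b) <= zr (Z.of_nat n) * x - y.
  by move=> ax yb; rewrite zrB zrM lerB // ler_wpM2l.
have nu x y a b : x <= zr a -> zr b <= y ->
    x - zr (Z.of_nat n) * y <= zr (Z.sub a (Z.mul (Z.of_nat n) b)).
  by move=> ax yb; rewrite zrB zrM lerB // ler_wpM2l.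
have nu' x y a b : x <= zr a -> zr b <= y ->
    zr (Z.of_nat n) * x - y <= zr (Z.sub (Z.mul (Z.of_nat n) a) b).
  by move=> ax yb; rewrite zrB zrM lerB // ler_wpM2l.
have lD := ler_wpM2l nt0 SlF; have uD := ler_wpM2l nt0 SuF.
apply/andP; split.
  rewrite ler_pdivrMr // mulrAC ler_pdivlMr //.
  move: Lo; rewrite (zrM 10000000) (zrM (Z.mul 64 14426802)) (zrM 64) => Lo.
  have core : zr (Z.sub (Z.add (Z.add (Z.add (Z.mul (Z.of_nat n) L0)
      (Z.min 0 (Z.sub L0 (Z.mul (Z.of_nat n) H1))))
      (Z.min 0 (Z.sub (Z.mul (Z.of_nat n) L2) H1)))
      (Z.min 0 (Z.sub L2 (Z.mul (Z.of_nat n) H3)))) H3) <=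
      (zr (Z.of_nat n) + t) * (zr fx * window_moment 0 w 30).
    apply: le_trans lD.
    have := zr_min_le (nl _ _ _ _ l0 up1) (tt 1%N).
    have := zr_min_le (nl' _ _ _ _ lo2 up1) (tt 2%N).
    have := zr_min_le (nl _ _ _ _ lo2 up3) (tt 3%N).
    have := ler_wpM2r a3_0 (proj2 (andP (tt 4%N))); rewrite mul1r.
    have := ler_wpM2l n0 l0; move: up3.
    rewrite !(zrD, zrB (Z.add _ _)) (zrM _ L0).
    move: (zr (Z.min 0 _)) (zr (Z.min 0 _)) (zr (Z.min 0 _)) => m1 m2 m3; lra.
  have := ler_wpM2l (ltW q7) core; lra.
rewrite ler_pdivlMr // mulrAC ler_pdivrMr //.
move: Up; rewrite (zrM 10000000) (zrM (Z.mul 64 14427095)) (zrM 64) => Up.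
have core : (zr (Z.of_nat n) + t) * (zr fx * window_moment 0 w 30) <=
    zr (Z.add (Z.add (Z.add (Z.add (Z.add (Z.mul (Z.of_nat n) H0)
    (Z.max 0 (Z.sub H0 (Z.mul (Z.of_nat n) L1))))
    (Z.max 0 (Z.sub (Z.mul (Z.of_nat n) H2) L1)))
    (Z.max 0 (Z.sub H2 (Z.mul (Z.of_nat n) L3))))
    (Z.max 0 (Z.sub (Z.mul (Z.of_nat n) H4) L3))) H4).
  apply: (le_trans uD).
  have := zr_max_ge (nu _ _ _ _ h0 lo1) (tt 1%N).
  have := zr_max_ge (nu' _ _ _ _ up2 lo1) (tt 2%N).
  have := zr_max_ge (nu _ _ _ _ up2 lo3) (tt 3%N).
  have := zr_max_ge (nu' _ _ _ _ up4 lo3) (tt 4%N).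
  have := ler_wpM2r a4_0 (proj2 (andP (tt 5%N))); rewrite mul1r.
  have := ler_wpM2l n0 h0; move: up4.
  rewrite !zrD (zrM _ H0).
  move: (zr (Z.max 0 _)) (zr (Z.max 0 _)) (zr (Z.max 0 _)) (zr (Z.max 0 _)) => m1 m2 m3 m4; lra.
have := ler_wpM2l (ltW q7) core; lra.
Qed.

End cell_sound.

(** * Contribution of the scales outside the checked window *)

Section wsum.
Context {R : realType}.
Implicit Types (x y t v w h : R) (g : R -> R) (i j n k p q : nat).
Local Notation zr := (@zr R).

Definition wsum g y n : R := \sum_(i < n) g (y / 2 ^+ i).

Definition peak y : R := y * expR (- y).

Lemma wsumD g y p q : wsum g y (p + q) = wsum g y p + wsum g (y / 2 ^+ p) q.
Proof.
rewrite /wsum big_split_ord /=; congr (_ + _); apply: eq_bigr => i _.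
by rewrite exprD invfM mulrA.
Qed.

Lemma wsum_ge0 g y n : 0 <= y -> (forall x, 0 <= x -> 0 <= g x) -> 0 <= wsum g y n.
Proof. by move=> y0 g0; apply: sumr_ge0 => i _; rewrite g0 // divr_ge0 // exprn_ge0. Qed.

Lemma peak_ge0 y : 0 <= y -> 0 <= peak y.
Proof. by move=> y0; rewrite mulr_ge0 // expR_ge0. Qed.

Lemma geometric_half_sum n : \sum_(i < n) (2 ^+ i)^-1 <= 2 :> R.
Proof.
suff -> : \sum_(i < n) (2 ^+ i)^-1 = 2 - 2 / 2 ^+ n :> R.
  by rewrite lerBlDr lerDl divr_ge0 // exprn_ge0.
elim: n => [|n IH]; first by rewrite big_ord0 expr0; lra.
rewrite big_ord_recr /= IH exprS.
by field; rewrite expf_neq0.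
Qed.

Lemma geometric_two_sum n : \sum_(i < n) 2 ^+ i <= 2 ^+ n :> R.
Proof.
elim: n => [|n IH]; first by rewrite big_ord0 expr0; lra.
by rewrite big_ord_recr /= exprS mulr_natl mulr2n lerD2r.
Qed.

Lemma wsum_peak_bottom y n : 0 <= y -> wsum peak y n <= 2 * y.
Proof.
move=> y0; apply: (@le_trans _ _ (\sum_(i < n) y * (2 ^+ i)^-1)).
  apply: ler_sum => i _; rewrite /peak ler_piMr ?divr_ge0 ?exprn_ge0 //.
  by rewrite expR_le1 oppr_le0 divr_ge0 ?exprn_ge0.
by rewrite -mulr_sumr mulrC ler_wpM2r // geometric_half_sum.
Qed.

Lemma expRN_natl_le n : expR (- n%:R) <= (2 ^+ n)^-1 :> R.
Proof.
rewrite expRN lef_pV2 ?posrE ?expR_gt0 ?exprn_gt0 //.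
rewrite -[n%:R]mulr1 expRM_natl lerXn2r ?nnegrE ?expR_ge0 //.
by have := @expR_ge1Dx R 1; lra.
Qed.

(** Of the factors [exp (- y / 2)] and [exp (- y / 4) ^ 2], the first is at most [2 ^ -32] and the
    second at most [(4 / y) ^ 2]. The remaining [1 / y] makes the sum over dyadic scales
    geometric. *)
Lemma peak_top y : 64 <= y -> peak y <= (2 ^+ 28)^-1 / y.
Proof.
move=> y64; have y0 : 0 < y by lra.
have yE : - y = - (y / 2) + (- (y / 4) + - (y / 4)) by lra.
rewrite /peak yE !expRD.
have h32 : expR (- (y / 2)) <= (2 ^+ 32)^-1 :> R.
  by apply: le_trans (expRN_natl_le 32); rewrite ler_expR; lra.
have h4 : expR (- (y / 4)) <= 4 / y.
  rewrite expRN -[leRHS]invf_div lef_pV2 ?posrE ?expR_gt0 //; last by rewrite divr_gt0.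
  by have := expR_ge1Dx (y / 4); lra.
have -> : (2 ^+ 28)^-1 / y = y * ((2 ^+ 32)^-1 * (4 / y * (4 / y))).
  have -> : (2 ^+ 32 : R) = 2 ^+ 28 * 16 by rewrite (exprD _ 28 4); congr (_ * _); lra.
  by move: (2 ^+ 28) (@exprn_gt0 R 28 2 ltac:(lra)) => b b0; field; rewrite !gt_eqF.
by rewrite ler_pM2l // ler_pM ?mulr_ge0 ?expR_ge0 // ler_pM ?expR_ge0.
Qed.

Lemma wsum_peak_top y n : 32 <= y / 2 ^+ n -> wsum peak y n <= (2 ^+ 33)^-1.
Proof.
have p0 k : 0 < 2 ^+ k :> R by rewrite exprn_gt0.
rewrite ler_pdivlMr // => h.
have y0 : 0 < y by apply: lt_le_trans h; rewrite mulr_gt0.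
apply: (@le_trans _ _ (\sum_(i < n) (2 ^+ 28)^-1 / y * 2 ^+ i)).
  apply: ler_sum => i _.
  have := @peak_top (y / 2 ^+ i); rewrite invf_div mulrA => hp.
  rewrite [_ / y * _]mulrAC.
  apply: hp; rewrite ler_pdivlMr //; apply: le_trans h.
  have -> : 64 = 32 * 2 :> R by lra.
  by rewrite -mulrA -exprS ler_pM2l ?ler_weXn2l //; lra.
rewrite -mulr_sumr; apply: (le_trans (ler_wpM2l _ (geometric_two_sum n))).
  by rewrite mulr_ge0 ?invr_ge0 ?ltW.
have -> : (2 ^+ 33)^-1 = (2 ^+ 28)^-1 * (2 ^+ 5)^-1 :> R by rewrite -invfM -exprD.
rewrite -[leLHS]mulrA.
apply: ler_wpM2l; first by rewrite invr_ge0 ltW.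
rewrite mulrC ler_pdivrMr // -[leRHS]mulrC -ler_pdivrMr ?invr_gt0 //.
by rewrite invrK mulrC; apply: le_trans h; rewrite ler_pM2r //; lra.
Qed.

End wsum.

(** * Bounds on the sum of [peak] at every scale *)

Section peak_bounds.
Context {R : realType}.
Implicit Types (x y t v w h : R) (g : R -> R) (i j n k p q : nat).
Local Notation zr := (@zr R).

(** After 24 squarings the box encloses [exp (- Y / 2 ^ 40)], and [2 ^ 63] stands for [1 / 2]: the
    comparison places [Y / 2 ^ 40] below [ln 2]. *)
Lemma ln2_lower_check : Z.leb (Z.shiftl 1 63) (iter 24 box_sqr (box_init 762123360000)).1.
Proof. by vm_compute. Qed.

Lemma ln2_upper_check : Z.leb (iter 24 box_sqr (box_init 762123386000)).2 (Z.shiftl 1 63).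
Proof. by vm_compute. Qed.

Lemma ln2_bounds :
  zr 762123360000 / zr (Z.shiftl 1 40) <= ln 2 <= zr 762123386000 / zr (Z.shiftl 1 40).
Proof.
have F0 := @zr_fx_gt0 R.
have e63 : zr fx = zr (Z.shiftl 1 63) * 2.
  have e : fx = Z.mul (Z.shiftl 1 63) 2 by vm_compute.
  by rewrite [in LHS]e zrM (_ : zr 2 = 2) // zrE.
have e40 : zr fx = zr (Z.shiftl 1 40) * 2 ^+ 24.
  have e : fx = Z.mul (Z.shiftl 1 40) (Z.pow 2 (Z.of_nat 24)) by vm_compute.
  by rewrite [in LHS]e zrM zr_nat_pow2.
have p40 : 0 < zr (Z.shiftl 1 40) by rewrite zrE ltr0z.
have p24 : 0 < 2 ^+ 24 :> R by rewrite exprn_gt0.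
have argE Y : zr Y / zr fx * 2 ^+ 24 = zr Y / zr (Z.shiftl 1 40).
  by rewrite e40; move: p24 p40; move: (2 ^+ 24) (zr (Z.shiftl 1 40)) => a b a0 b0;
     field; rewrite !gt_eqF.
have half x : zr fx * expR (- x) <= zr (Z.shiftl 1 63) -> ln 2 <= x.
  move=> h; rewrite -ler_expR lnK ?posrE //.
  move: h; rewrite e63 expRN -mulrA ger_pMr; last by rewrite zrE ltr0z.
  by rewrite ler_pdivrMr ?expR_gt0 // mul1r.
have half' x : zr (Z.shiftl 1 63) <= zr fx * expR (- x) -> x <= ln 2.
  move=> h; rewrite -ler_expR lnK ?posrE //.
  move: h; rewrite e63 expRN -mulrA ler_pMr; last by rewrite zrE ltr0z.
  by rewrite ler_pdivlMr ?expR_gt0 // mul1r.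
have [/andP[_ h1] _] := box_iter_sound 24 (@box_init_sound R 762123360000 isT isT).
have [_ h2] := box_iter_sound 24 (@box_init_sound R 762123386000 isT isT).
rewrite argE in h1; rewrite argE in h2.
apply/andP; split; [apply: half'|apply: half].
  exact: le_trans (zr_le ln2_lower_check) h1.
exact: le_trans h2 (zr_le ln2_upper_check).
Qed.

(* Bounds the oscillation of [wsum peak] around [1 / ln 2], whose true amplitude
   is about 1.43e-5. *)
Definition eta : R := 15 / 10 ^+ 6.

Lemma zr_frac_le (a b c d : Z) : Z.ltb 0 b -> Z.ltb 0 d ->
  Z.leb (Z.mul a d) (Z.mul c b) -> zr a / zr b <= zr c / zr d.
Proof.
move=> b0 d0 /(@zr_le R); rewrite !zrM.
have rb0 : 0 < zr b by rewrite zrE ltr0z; lia.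
have rd0 : 0 < zr d by rewrite zrE ltr0z; lia.
by move=> h; rewrite ler_pdivrMr // mulrAC ler_pdivlMr.
Qed.

Lemma etaE : eta = zr 150 / zr 10000000.
Proof.
have z10 : zr 10 = 10 by rewrite zrE.
have z3 : zr 1000 = 10 * (10 * 10).
  by rewrite -z10 -!zrM.
have -> : zr 10000000 = 10 * 10 ^+ 6.
  rewrite (_ : zr 10000000 = zr (Z.mul 10 (Z.mul 1000 1000))); last by [].
  rewrite (zrM 10) (zrM 1000) z3 z10.
  by move: (10 : R) => u; ring.
rewrite (_ : zr 150 = 10 * 15) /eta; last by rewrite zrE; lra.
have : (10 ^+ 6 : R) != 0 by rewrite expf_neq0.
by move: (10 ^+ 6) => b b0; field.
Qed.

Lemma eta_ge0 : 0 <= eta.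
Proof. by rewrite /eta divr_ge0 // exprn_ge0. Qed.

(** The 3 units above the 14427095 of [cell_check] pay for the scales outside the window. The lower
    bound needs no such allowance, those terms being nonnegative. *)
Lemma inv_ln2_upper : zr 14427098 / zr 10000000 <= (ln 2)^-1 + eta.
Proof.
have /andP[_ h] := ln2_bounds; have l0 : 0 < ln 2 :> R by rewrite ln_gt0 // ltr1n.
rewrite etaE -lerBlDr -mulrBl -zrB.
apply: (@le_trans _ _ (zr (Z.shiftl 1 40) / zr 762123386000)).
  exact: zr_frac_le.
by rewrite -[leLHS]invf_div lef_pV2 ?posrE // (lt_le_trans l0).
Qed.

Lemma inv_ln2_lower : (ln 2)^-1 - eta <= zr 14426802 / zr 10000000.
Proof.
have /andP[h _] := ln2_bounds; have l0 : 0 < ln 2 :> R by rewrite ln_gt0 // ltr1n.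
rewrite etaE lerBlDr -mulrDl -zrD.
apply: (@le_trans _ _ (zr (Z.shiftl 1 40) / zr 762123360000)); last exact: zr_frac_le.
rewrite -[leRHS]invf_div lef_pV2 ?posrE // divr_gt0 // zrE ltr0z //.
Qed.

Lemma wsum_peak_octave v : 1 <= v <= 2 ->
  zr 14426802 / zr 10000000 <= wsum peak (v * 32) 30 <= zr 14427095 / zr 10000000.
Proof.
move=> /andP[v1 v2].
have [n [n64 n128 nv]] : exists n : nat, [/\ (64 <= n)%N, (n < 128)%N & 0 <= 64 * v - n%:R <= 1].
  have v0 : 0 <= 64 * v by lra.
  have /andP[t1 t2] := truncn_itv v0.
  have [v2'|v2'] := ltP v 2.
    exists (Num.truncn (64 * v)); split.
    - by rewrite truncn_ge_nat //; lra.
    - by rewrite -(ltr_nat R); apply: le_lt_trans t1 _; lra.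
    - by move: t1 t2; rewrite -natr1; lra.
  (* At [v = 2] truncation would give 128, outside the checked range; the last interval is used with
     [t = 1]. *)
  by exists 127%N; split => //; lra.
have chk : cell_check (Z.of_nat n).
  by apply: (allP cells_check); rewrite mem_iota n64.
set P := zr (Z.shiftl 1 30).
have P0 : 0 < P by rewrite /P zrE ltr0z.
have PE : P = 64 * 2 ^+ 24.
  rewrite /P (_ : Z.shiftl 1 30 = Z.mul 64 (Z.pow 2 (Z.of_nat 24))) //.
  by rewrite zrM zr_nat_pow2 (_ : zr 64 = 64) // zrE.
have := @cell_check_sound _ P n (64 * v - n%:R) (v / 2 ^+ 24) erefl (ltnW n128) chk nv.
have p24 : 2 ^+ 24 != 0 :> R by rewrite expf_neq0.
have -> : v / 2 ^+ 24 = (n%:R + (64 * v - n%:R)) / P.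
  by rewrite PE; move: (2 ^+ 24) p24 => b b0; field.
move=> /(_ erefl); rewrite -[X in _ -> is_true X]/(_ <= _ <= _).
have <- : v / 2 ^+ 24 = (n%:R + (64 * v - n%:R)) / P.
  by rewrite PE; move: (2 ^+ 24) p24 => b b0; field.
suff -> : wsum peak (v * 32) 30 = v / 2 ^+ 24 * window_moment 0 (v / 2 ^+ 24) 30 by [].
(* Read backwards, the 30 halvings starting from [v * 32] are doublings starting from
   [v * 32 / 2 ^ 29 = v / 2 ^ 24]. *)
rewrite /wsum /window_moment mulr_sumr (reindex_inj rev_ord_inj) /=.
apply: eq_bigr => i _; rewrite /peak expr1 mulrA.
suff -> : v * 32 / 2 ^+ (30 - i.+1) = v / 2 ^+ 24 * 2 ^+ i by [].
have i30 : (i <= 29)%N by have := ltn_ord i; lia.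
have e : 2 ^+ 24 * 32 = 2 ^+ i * 2 ^+ (29 - i) :> R.
  by rewrite -exprD subnKC // (exprD _ 24 5); congr (_ * _); rewrite !exprS expr0; lra.
rewrite subSS.
have a0 : 2 ^+ (29 - i) != 0 :> R by rewrite expf_neq0.
have e32 : 32 = 2 ^+ i * 2 ^+ (29 - i) / 2 ^+ 24 :> R by rewrite -e [RHS]mulrC mulKf.
rewrite [X in v * X]e32.
by move: (2 ^+ i) (2 ^+ (29 - i)) a0 (2 ^+ 24) p24 => x y y0 z z0; field; rewrite y0 z0.
Qed.

Lemma wsum_peak_split v i n : wsum peak (v * 2 ^+ (i + 5)) (i + (30 + n)) =
  wsum peak (v * 2 ^+ (i + 5)) i + wsum peak (v * 32) 30 + wsum peak (v * 32 / 2 ^+ 30) n.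
Proof.
have e : v * 2 ^+ (i + 5) / 2 ^+ i = v * 32.
  have -> : 32 = 2 ^+ 5 :> R by rewrite !exprS expr0; lra.
  by rewrite exprD mulrA mulrAC mulfK // expf_neq0.
by rewrite wsumD wsumD e addrA.
Qed.

Lemma dyadic_scale y : 32 <= y -> exists v i, [/\ 1 <= v, v < 2 & y = v * 2 ^+ (i + 5)].
Proof.
move=> y32; have y0 : 0 <= y by lra.
have p0 k : 0 < 2 ^+ k :> R by rewrite exprn_gt0.
set N := Num.truncn y; set j := trunc_log 2 N.
have /andP[t1 t2] := truncn_itv y0.
have N32 : (32 <= N)%N by rewrite truncn_ge_nat.
have [j1 j2] : (2 ^ j <= N)%N /\ (N < 2 ^ j.+1)%N.
  by apply/andP; apply: trunc_log_bounds => //; lia.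
have j5 : (5 <= j)%N.
  rewrite leqNgt; apply/negP => j5.
  have : (2 ^ j.+1 <= 2 ^ 5)%N by rewrite leq_exp2l.
  by rewrite leqNgt (leq_ltn_trans _ j2) // (_ : (2 ^ 5)%N = 32%N).
exists (y / 2 ^+ j), (j - 5)%N; split.
- by rewrite ler_pdivlMr // mul1r; apply: le_trans t1; rewrite -natrX ler_nat.
- rewrite ltr_pdivrMr // -exprS; apply: (lt_le_trans t2).
  by rewrite -natrX ler_nat.
- by rewrite subnK // divfK // gt_eqF.
Qed.

(** Replacing [y] by [y * 2 ^ M] adds nonnegative terms in front, and lengthening the sum adds some
    at the end, so the sum may be assumed to contain a full checked window. *)
Lemma wsum_peak_upper y n : 0 <= y -> wsum peak y n <= (ln 2)^-1 + eta.
Proof.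
rewrite le_eqVlt => /predU1P[<-|y0].
  rewrite /wsum big1 ?addr_ge0 ?eta_ge0 ?invr_ge0 ?ln_ge0 ?ler1n // => i _.
  by rewrite mul0r /peak mul0r.
have p0 k : 0 < 2 ^+ k :> R by rewrite exprn_gt0.
pose M := (Num.truncn (32 / y)).+1.
have yM : 32 <= y * 2 ^+ M.
  have y32 : 0 <= 32 / y by rewrite divr_ge0 // ltW.
  have /andP[_ h] := truncn_itv y32.
  rewrite mulrC -ler_pdivrMr //; apply: (le_trans (ltW h)).
  by rewrite -natrX ler_nat ltnW // ltn_expl.
have g0 x : 0 <= x -> 0 <= peak x by exact: peak_ge0.
apply: (@le_trans _ _ (wsum peak (y * 2 ^+ M) (M + n))).
  by rewrite wsumD mulfK ?gt_eqF // lerDr wsum_ge0 // mulr_ge0 ?ltW.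
move: (M + n)%N => {}n; move: (y * 2 ^+ M) yM => {y0 M}y y32.
have [v [i [v1 v2 yE]]] := dyadic_scale y32.
apply: (@le_trans _ _ (wsum peak y (i + (30 + n)))).
  rewrite addnA addnC wsumD lerDl wsum_ge0 // divr_ge0 ?ltW //; lra.
rewrite yE wsum_peak_split.
have /andP[_ h1] := @wsum_peak_octave v (introT andP (conj v1 (ltW v2))).
have h2 : wsum peak (v * 2 ^+ (i + 5)) i <= (2 ^+ 33)^-1.
  apply: wsum_peak_top; rewrite exprD mulrA mulrAC mulfK ?gt_eqF //.
  by have -> : 2 ^+ 5 = 32 :> R; [rewrite !exprS expr0; lra|lra].
have h3 := @wsum_peak_bottom R (v * 32 / 2 ^+ 30) n ltac:(rewrite divr_ge0 ?mulr_ge0 //; lra).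
apply: le_trans inv_ln2_upper.
have h4 : 2 * (v * 32 / 2 ^+ 30) <= (2 ^+ 23)^-1.
  have -> : 2 ^+ 30 = 2 ^+ 23 * 128 :> R.
    by rewrite (exprD _ 23 7); congr (_ * _); rewrite !exprS expr0; lra.
  have -> : 2 * (v * 32 / (2 ^+ 23 * 128)) = (v / 2) / 2 ^+ 23.
    by move: (2 ^+ 23) (p0 23) => b b0; field; rewrite gt_eqF.
  by rewrite -[leRHS]mul1r ler_wpM2r ?invr_ge0 ?ltW //; lra.
have h5 : (2 ^+ 33)^-1 + (2 ^+ 23)^-1 <= zr 3 / zr 10000000.
  have p23 : (2 ^+ 23 : R) = zr (Z.pow 2 (Z.of_nat 23)) by rewrite zr_nat_pow2.
  have -> : (2 ^+ 33)^-1 + (2 ^+ 23)^-1 = zr 1025 / (zr (Z.pow 2 (Z.of_nat 33))) :> R.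
    rewrite zr_nat_pow2 (_ : zr 1025 = 1 + 2 ^+ 10); last first.
      by rewrite zrE !exprS expr0; lra.
    rewrite (exprD _ 23 10); move: (2 ^+ 23) (p0 23) (2 ^+ 10) (p0 10) => b b0 c c0.
    by field; rewrite !gt_eqF.
  exact: zr_frac_le.
have e3 : zr 14427098 = zr 14427095 + zr 3.
  by rewrite -zrD.
rewrite e3 mulrDl; lra.
Qed.

(** The conditions on [y] and [n] ensure that a whole checked window lies among the [n] terms: with
    [y = v * 2 ^ (i + 5)] it ends at index [i + 30], and [i + 5 < j]. *)
Lemma wsum_peak_lower y j n : 32 <= y -> y < 2 ^+ j -> (j + 25 <= n)%N ->
  (ln 2)^-1 - eta <= wsum peak y n.
Proof.
move=> y32 yj jn; have [v [i [v1 v2 yE]]] := dyadic_scale y32.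
have p0 k : 0 < 2 ^+ k :> R by rewrite exprn_gt0.
have ij : (i + 5 < j)%N.
  rewrite -(ltr_eXn2l (_ : 1 < 2 :> R)) ?ltr1n //; apply: le_lt_trans yj.
  by rewrite yE ler_peMl // ltW.
have -> : n = (i + (30 + (n - (i + 30))))%N by lia.
have /andP[h1 _] := @wsum_peak_octave v (introT andP (conj v1 (ltW v2))).
rewrite yE wsum_peak_split; apply: (le_trans inv_ln2_lower).
have g0 x : 0 <= x -> 0 <= peak x by exact: peak_ge0.
apply: (le_trans h1); rewrite -addrA addrCA lerDl addr_ge0 // wsum_ge0 //.
  by rewrite mulr_ge0 ?ltW //; lra.
by rewrite divr_ge0 ?mulr_ge0 // ?ltW //; lra.
Qed.

End peak_bounds.

(** * Oscillation of the dyadic sums around the limit *)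

Section oscillation.
Context {R : realType}.
Implicit Types (a b c u v x y : R) (i j n k : nat).

Definition wexp v n : R := wsum (fun x => expR (- x)) v n.

Lemma is_derive_wexp n v : v != 0 ->
  is_derive v 1 (wexp^~ n) (- (wsum peak v n / v)).
Proof.
move=> v0; elim: n => [|n IH].
  rewrite (_ : wexp^~ 0%N = cst 0); last by apply/funext => x; rewrite /wexp /wsum big_ord0.
  by apply: is_derive_eq; rewrite /wsum big_ord0 mul0r oppr0.
rewrite (_ : wexp^~ n.+1 = (fun x => wexp x n + expR (- (x * (2 ^+ n)^-1)))); last first.
  by apply/funext => x; rewrite /wexp /wsum big_ord_recr.
apply: is_derive_eq; rewrite /wsum big_ord_recr /= /peak /GRing.scale /=.
have : (2 ^+ n : R) != 0 by rewrite expf_neq0.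
by move: (2 ^+ n) => b b0; field; rewrite v0 b0.
Qed.

(** The right side is the trapezoid rule for the convex function [1 / x]. With [s = ln (b / a)] it
    equals [sinh s], and the claim is [s <= sinh s]. *)
Lemma ln_le_trapezoid a b : 0 < a -> a <= b ->
  ln b - ln a <= (b - a) * (a + b) / (2 * a * b).
Proof.
move=> a0 ab; have b0 : 0 < b by apply: lt_le_trans ab.
have ba : 0 < b / a by rewrite divr_gt0.
rewrite -ln_div ?posrE //; set s := ln (b / a).
have es : expR s = b / a by rewrite lnK.
have s0 : 0 <= s by rewrite ln_ge0 // ler_pdivlMr // mul1r.
have : 0 <= (expR s - expR (- s)) / 2 - s.
  apply: (@le_of_derive _ (fun s => (expR s - expR (- s)) / 2 - s)
    (fun s => (expR s + expR (- s)) / 2 - 1)) => //.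
  - by rewrite oppr0 expR0; lra.
  - by move=> x _; apply: is_derive_eq; rewrite /GRing.scale /=; ring.
  - by move=> x _; rewrite expRN; have := expR_gt0 x; move: (expR x) => e e0;
      have -> : (e + e^-1) / 2 - 1 = (e - 1) ^+ 2 / (2 * e);
      [field; rewrite gt_eqF|rewrite divr_ge0 ?sqr_ge0 // mulr_ge0 // ltW].
rewrite expRN es subr_ge0 => /le_trans; apply; rewrite le_eqVlt; apply/orP; left; apply/eqP.
by field; rewrite !gt_eqF.
Qed.

(** The two bounds on [wsum peak] say that [wexp] plus [(1 / ln 2 - eta) * ln] decreases and that
    [wexp] plus [(1 / ln 2 + eta) * ln] increases. *)
Lemma wexp_ln_lipschitz a b j n : 32 <= a -> a <= b -> b < 2 ^+ j -> (j + 25 <= n)%N ->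
  `|wexp a n - wexp b n - (ln b - ln a) / ln 2| <= eta * (ln b - ln a).
Proof.
move=> a32 ab bj jn.
have lo x : a <= x <= b -> (ln 2)^-1 - eta <= wsum peak x n.
  by move=> /andP[ax xb]; apply: (@wsum_peak_lower R x j n) => //; lra.
have up x : a <= x <= b -> wsum peak x n <= (ln 2)^-1 + eta.
  by move=> /andP[ax xb]; apply: wsum_peak_upper; lra.
have key1 : - wexp a n - ((ln 2)^-1 - eta) * ln a <= - wexp b n - ((ln 2)^-1 - eta) * ln b.
  apply: (@nondecreasing_of_derive _ (fun x => - wexp x n - ((ln 2)^-1 - eta) * ln x)
    (fun x => (wsum peak x n - ((ln 2)^-1 - eta)) / x)) => // x xab.
    have x0 : 0 < x by lra.
    have ? := @is_derive_wexp n x (lt0r_neq0 x0); have ? := is_derive1_ln x0.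
    apply: is_derive_eq; rewrite /GRing.scale /=; ring.
  by rewrite divr_ge0 ?subr_ge0 ?lo //; lra.
have key2 : wexp a n + ((ln 2)^-1 + eta) * ln a <= wexp b n + ((ln 2)^-1 + eta) * ln b.
  apply: (@nondecreasing_of_derive _ (fun x => wexp x n + ((ln 2)^-1 + eta) * ln x)
    (fun x => ((ln 2)^-1 + eta - wsum peak x n) / x)) => // x xab.
    have x0 : 0 < x by lra.
    have ? := @is_derive_wexp n x (lt0r_neq0 x0); have ? := is_derive1_ln x0.
    apply: is_derive_eq; rewrite /GRing.scale /=; ring.
  by rewrite divr_ge0 ?subr_ge0 ?up //; lra.
by rewrite ler_norml; apply/andP; split; lra.
Qed.

(** Doubling the argument shifts the dyadic sum by one index, so only its two end terms differ. *)
Lemma wexp_double v n : wexp (2 * v) n =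
  wexp v n + expR (- (2 * v)) - expR (- (2 * v / 2 ^+ n)).
Proof.
have h1 : wexp (2 * v) n.+1 = expR (- (2 * v)) + wexp v n.
  rewrite /wexp -(add1n n) wsumD expr1 [X in wsum _ X n](_ : 2 * v / 2 = v); last by field.
  by rewrite {1}/wsum big_ord_recl big_ord0 expr0 invr1 mulr1 addr0.
move: h1; rewrite {1}/wexp /wsum big_ord_recr /= => h1.
by rewrite {1}/wexp /wsum; lra.
Qed.

(* [hker u (x / 2 ^ k)] is, for a cell holding a Poisson number of mean [x] of
   elements, the part of [E (exp (- u * x * z))] where [C1 = k], [z] being the
   contribution of the cell to [1 / Y]. *)
Definition hker u y : R := expR (- ((1 + u) * y)) - expR (- ((2 + u) * y))
  - expR (- ((3 + u) * y)) + expR (- ((4 + u) * y))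
  + expR (- ((3 + 3 * u) * y)) - expR (- ((4 + 3 * u) * y)).

Lemma wsum_hker u y n : wsum (hker u) y n =
  wexp ((1 + u) * y) n - wexp ((2 + u) * y) n - wexp ((3 + u) * y) n
  + wexp ((4 + u) * y) n + wexp ((3 + 3 * u) * y) n - wexp ((4 + 3 * u) * y) n.
Proof.
rewrite /wexp /wsum -!(sumrB, big_split) /=; apply: eq_bigr => i _.
by rewrite /hker -!mulrA.
Qed.

(** Fitted at both ends: it behaves like [7 / 6 * u] at 0, as the left side of [wbound_small] does,
    and like [7 / 3 / u] at infinity, as that of [wbound_large] does. *)
Definition wbound u : R := 7 / 6 * u / (1 + 3 / 100 * u + u ^+ 2 / 2).

Lemma wbound_ge0 u : 0 <= u -> 0 <= wbound u.
Proof. by move=> u0; rewrite divr_ge0 //; nra. Qed.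

Lemma expRN_1 x : 0 <= x -> 0 <= 1 - expR (- x) <= x.
Proof.
move=> x0; rewrite subr_ge0 -expR0 ler_expR oppr_le0 x0 /=.
by have := expR_ge1Dx (- x); rewrite expR0; lra.
Qed.

Lemma ehll_fE u : 0 <= u -> ehll_f u =
  (ln (2 + u) - ln (1 + u) + ln (4 + 3 * u) - ln (3 + 3 * u) - ln (4 + u) + ln (3 + u))
  / ln 2.
Proof.
move=> u0; rewrite /ehll_f /log2 !ln_div ?posrE; [|lra..].
by ring.
Qed.

Lemma wexp_scaled_lipschitz c d y j n : 32 <= y -> 1 <= c -> c <= d ->
  d * y < 2 ^+ j -> (j + 25 <= n)%N ->
  `|wexp (c * y) n - wexp (d * y) n - (ln d - ln c) / ln 2| <=
  eta * ((d - c) * (c + d) / (2 * c * d)).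
Proof.
move=> y32 c1 cd dj jn; have c0 : 0 < c by lra.
have d0 : 0 < d by lra.
have y0 : 0 < y by lra.
have := @wexp_ln_lipschitz (c * y) (d * y) j n.
rewrite !lnM ?posrE // ler_pM2r // => /(_ _ cd dj jn) h.
have e : ln d + ln y - (ln c + ln y) = ln d - ln c by ring.
rewrite e in h; apply: le_trans (h _) _; first by nra.
by rewrite ler_wpM2l ?eta_ge0 // ln_le_trapezoid.
Qed.

(* Two pairings of the six terms of [wsum_hker] into logarithmic differences: the
   one of [wbound_large] is immediate but does not vanish at [u = 0]; the one of
   [wbound_small] does, at the cost of halving some arguments by [wexp_double]. *)
Lemma wbound_small u : 0 <= u <= 27 / 25 ->
  (1 + u - (1 + 3 / 4 * u)) * (1 + 3 / 4 * u + (1 + u)) / (2 * (1 + 3 / 4 * u) * (1 + u))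
  + (1 + u / 2 - (1 + u / 4)) * (1 + u / 4 + (1 + u / 2)) / (2 * (1 + u / 4) * (1 + u / 2))
  + (3 + 3 * u - (3 + u)) * (3 + u + (3 + 3 * u)) / (2 * (3 + u) * (3 + 3 * u))
  <= wbound u.
Proof.
move=> /andP[u0 u1]; rewrite -subr_ge0 /wbound.
have u2 := sqr_ge0 u.
have [? ? ? ?] : [/\ 0 < 1 + 3 / 4 * u, 0 < 1 + u / 2, 0 < 1 + u / 4 & 0 < 1 + u].
  by split; lra.
have [? ? ?] : [/\ 0 < 3 + u, 0 < 3 + 3 * u & 0 < 1 + 3 / 100 * u + u ^+ 2 / 2].
  by split; lra.
set D := 8 * (1 + 3 / 4 * u) * (1 + u / 2) * (1 + u / 4) * (3 + u) * (3 + 3 * u)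
  * (1 + 3 / 100 * u + u ^+ 2 / 2).
(* Both sides agree to first order at 0, hence the factor [u ^+ 2] taken out of the numerator. *)
set q := 2599 / 50 + 6337 / 100 * u - 6327 / 400 * u ^+ 2 - (154 * 1000 + 979) / 3200 * u ^+ 3
  - (66 * 1000 + 763) / 3200 * u ^+ 4 - 171 / 64 * u ^+ 5.
rewrite [leRHS](_ : _ = u ^+ 2 * q / D).
  have D0 : 0 < D by rewrite /D !mulr_gt0.
  clearbody D.
  rewrite divr_ge0 ?(ltW D0) // mulr_ge0 ?sqr_ge0 // /q.
  have h2 : u ^+ 2 <= 27 / 25 * u by rewrite expr2 ler_wpM2r.
  have h3 : u ^+ 3 <= 27 / 25 * u ^+ 2 by rewrite exprS ler_wpM2r ?exprn_ge0.
  have h4 : u ^+ 4 <= 27 / 25 * u ^+ 3 by rewrite exprS ler_wpM2r ?exprn_ge0.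
  have h5 : u ^+ 5 <= 27 / 25 * u ^+ 4 by rewrite exprS ler_wpM2r ?exprn_ge0.
  by lra.
rewrite /D /q; clear D q; field.
by do !(apply/andP; split); apply: lt0r_neq0; lra.
Qed.

Lemma wbound_large u : 27 / 25 <= u ->
  (2 + u - (1 + u)) * (1 + u + (2 + u)) / (2 * (1 + u) * (2 + u))
  + (4 + u - (3 + u)) * (3 + u + (4 + u)) / (2 * (3 + u) * (4 + u))
  + (4 + 3 * u - (3 + 3 * u)) * (3 + 3 * u + (4 + 3 * u)) / (2 * (3 + 3 * u) * (4 + 3 * u))
  <= wbound u.
Proof.
move=> u1; rewrite -subr_ge0 /wbound.
have u2 := sqr_ge0 u; have u0 : 0 <= u by lra.
have [? ? ?] : [/\ 0 < 2 + u, 0 < 3 + u & 0 < 4 + u] by split; lra.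
have [? ? ?] : [/\ 0 < 3 + 3 * u, 0 < 4 + 3 * u & 0 < 1 + 3 / 100 * u + u ^+ 2 / 2].
  by split; lra.
set D := 8 * (2 + u) * (3 + u) * (4 + u) * (3 + 3 * u) * (4 + 3 * u)
  * (1 + 3 / 100 * u + u ^+ 2 / 2).
(* This numerator changes sign slightly below [27 / 25], which explains where the pairing is
   switched. *)
set q := - 3072 - (96 * 1000 + 704) / 25 * u + (26 * 1000 + 252) / 25 * u ^+ 2
  + (80 * 1000 + 673) / 25 * u ^+ 3 + (35 * 1000 + 713) / 25 * u ^+ 4 + 4724 / 25 * u ^+ 5.
rewrite [leRHS](_ : _ = q / D).
  have D0 : 0 < D by rewrite /D !mulr_gt0.
  clearbody D.
  rewrite divr_ge0 ?(ltW D0) // /q.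
  have h2 : 27 / 25 * u <= u ^+ 2 by rewrite expr2 ler_wpM2r.
  have h3 : 27 / 25 * u ^+ 2 <= u ^+ 3 by rewrite [leRHS]exprS ler_wpM2r ?exprn_ge0.
  have h4 : 27 / 25 * u ^+ 3 <= u ^+ 4 by rewrite [leRHS]exprS ler_wpM2r ?exprn_ge0.
  have h5 : 27 / 25 * u ^+ 4 <= u ^+ 5 by rewrite [leRHS]exprS ler_wpM2r ?exprn_ge0.
  by lra.
rewrite /D /q; clear D q; field.
by do !(apply/andP; split); apply: lt0r_neq0; lra.
Qed.

(** The last two terms of the bound come from the ends of the dyadic sums exposed by [wexp_double]:
    large arguments at the top, exponentials close to 1 at the bottom. *)
Lemma wsum_hker_approx u y j n : 32 <= y -> 0 <= u -> (4 + 3 * u) * y < 2 ^+ j ->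
  (j + 25 <= n)%N ->
  `|wsum (hker u) y n - ehll_f u| <= eta * wbound u
    + 3 * expR (- (2 * ((1 + u / 4) * y))) + 3 * ((4 + 3 * u) * y / 2 ^+ n).
Proof.
move=> y32 u0 uj jn; have y0 : 0 < y by lra.
have e0 : 0 <= expR (- (2 * ((1 + u / 4) * y))) by exact: expR_ge0.
have p0 : 0 < 2 ^+ n :> R by rewrite exprn_gt0.
have l2 : 0 < ln 2 :> R by rewrite ln_gt0 // ltr1n.
have lip c d : 1 <= c -> c <= d -> d <= 4 + 3 * u ->
    `|wexp (c * y) n - wexp (d * y) n - (ln d - ln c) / ln 2| <=
    eta * ((d - c) * (c + d) / (2 * c * d)).
  move=> c1 cd du; apply: (@wexp_scaled_lipschitz c d y j n) => //.
  by apply: le_lt_trans uj; rewrite ler_pM2r.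
rewrite ehll_fE // wsum_hker.
have [u1|u1] := leP u (27 / 25); last first.
  have := @wbound_large u (ltW u1) => /(ler_wpM2l eta_ge0).
  have z0 : 0 <= (4 + 3 * u) * y / 2 ^+ n by rewrite divr_ge0 ?mulr_ge0 ?ltW //; lra.
  have := lip (1 + u) (2 + u) ltac:(lra) ltac:(lra) ltac:(lra).
  have := lip (3 + u) (4 + u) ltac:(lra) ltac:(lra) ltac:(lra).
  have := lip (3 + 3 * u) (4 + 3 * u) ltac:(lra) ltac:(lra) ltac:(lra).
  set q1 := (_ / (2 * (1 + u) * (2 + u))); set q2 := (_ / (2 * (3 + u) * (4 + u))).
  set q3 := (_ / (2 * (3 + 3 * u) * (4 + 3 * u))).
  move: (ln 2)^-1 => i2.
  rewrite !ler_norml => /andP[? ?] /andP[? ?] /andP[? ?] ?.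
  by apply/andP; split; lra.
have dbl c : wexp (2 * c * y) n = wexp (c * y) n
    + expR (- (2 * (c * y))) - expR (- (2 * (c * y) / 2 ^+ n)).
  by rewrite -mulrA wexp_double.
have lnd c : 0 < c -> ln (2 * c) = ln 2 + ln c by move=> c0; rewrite lnM ?posrE.
(* After these halvings the three pairs are [1 + 3 / 4 * u] with [1 + u], [1 + u / 4] with
   [1 + u / 2], and [3 + u] with [3 + 3 * u]; their logarithmic lengths all vanish at [u = 0]. *)
have -> : 2 + u = 2 * (1 + u / 2) by field.
have -> : 4 + u = 2 * (2 * (1 + u / 4)) by field.
have -> : 4 + 3 * u = 2 * (2 * (1 + 3 / 4 * u)) by field.
rewrite !dbl !lnd; [|lra..].
have := @wbound_small u ltac:(lra) => /(ler_wpM2l eta_ge0).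
have := lip (1 + 3 / 4 * u) (1 + u) ltac:(lra) ltac:(lra) ltac:(lra).
have := lip (1 + u / 4) (1 + u / 2) ltac:(lra) ltac:(lra) ltac:(lra).
have := lip (3 + u) (3 + 3 * u) ltac:(lra) ltac:(lra) ltac:(lra).
set q1 := (_ / (2 * (1 + 3 / 4 * u) * (1 + u))).
set q2 := (_ / (2 * (1 + u / 4) * (1 + u / 2))).
set q3 := (_ / (2 * (3 + u) * (3 + 3 * u))).
have top c : 1 + u / 4 <= c ->
    0 <= expR (- (2 * (c * y))) <= expR (- (2 * ((1 + u / 4) * y))).
  by move=> cu; rewrite expR_ge0 ler_expR; nra.
set z := 2 * (2 * (1 + 3 / 4 * u)) * y / 2 ^+ n.
have bot c : 0 <= c -> c <= 2 * (1 + 3 / 4 * u) ->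
    0 <= 1 - expR (- (2 * (c * y) / 2 ^+ n)) <= z.
  move=> c0 cu.
  have z0 : 0 <= 2 * (c * y) / 2 ^+ n by rewrite divr_ge0 ?mulr_ge0 //; lra.
  have /andP[-> /=] := expRN_1 z0.
  by move=> /le_trans; apply; rewrite ler_pM2r ?invr_gt0 // mulrA ler_pM2r // ler_pM2l.
have /andP[? ?] := top (1 + u / 2) ltac:(lra).
have /andP[? ?] := top (1 + u / 4) ltac:(lra).
have /andP[? ?] := top (2 * (1 + u / 4)) ltac:(lra).
have /andP[? ?] := top (1 + 3 / 4 * u) ltac:(lra).
have /andP[? ?] := top (2 * (1 + 3 / 4 * u)) ltac:(lra).
have /andP[? ?] := bot (1 + u / 2) ltac:(lra) ltac:(lra).
have /andP[? ?] := bot (1 + u / 4) ltac:(lra) ltac:(lra).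
have /andP[? ?] := bot (2 * (1 + u / 4)) ltac:(lra) ltac:(lra).
have /andP[? ?] := bot (1 + 3 / 4 * u) ltac:(lra) ltac:(lra).
have /andP[? ?] := bot (2 * (1 + 3 / 4 * u)) ltac:(lra) ltac:(lra).
have l2i : ln 2 * (ln 2)^-1 = 1 :> R by rewrite divff // gt_eqF.
rewrite !ler_norml => /andP[? ?] /andP[? ?] /andP[? ?] ?.
set L := (X in _ <= _ - X <= _).
(* The halvings leave exactly one [ln 2], which is the value 1 of [ehll_f] at 0. *)
have -> : L = ln 2 / ln 2 + (ln (1 + u / 2) - ln (1 + u / 4)) / ln 2
    - (ln (1 + u) - ln (1 + 3 / 4 * u)) / ln 2 - (ln (3 + 3 * u) - ln (3 + u)) / ln 2.
  by rewrite /L; ring.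
rewrite l2i; clear top bot lip dbl lnd; clearbody q1 q2 q3 z.
by apply/andP; split; lra.
Qed.

End oscillation.

(** * Rational bounds on the limit function *)

Section ehll_f_bounds.
Context {R : realType}.
Implicit Types (a b c e u v x y t : R) (i j n k : nat).

Lemma ln2_ge : 69 / 100 <= ln 2 :> R.
Proof.
have /andP[h _] := @ln2_bounds R; apply: le_trans h.
rewrite (_ : 69 / 100 = @zr R 69 / @zr R 100); last by rewrite !zrE.
exact: zr_frac_le.
Qed.

(** A homographic majorant of [log2 (1 + t)], exact at 0 and at 1; its slope [29 / 20] at 0 slightly
    exceeds [1 / ln 2]. *)
Lemma ln_1D_le t : 0 <= t <= 1 ->
  ln (1 + t) <= ln 2 * (29 / 20 * t / (1 + 9 / 20 * t)).
Proof.
move=> /andP[t0 t1]; have l2 : 69 / 100 <= ln 2 :> R := ln2_ge.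
pose K : R := ln 2 * (29 / 9).
pose F x : R := K - K * (1 + 9 / 20 * x)^-1 - ln (1 + x).
pose q x : R := 29 / 20 * ln 2 * (1 + x) - (1 + 9 / 20 * x) ^+ 2.
pose dF x : R := q x / ((1 + 9 / 20 * x) ^+ 2 * (1 + x)).
have derF x : 0 <= x -> is_derive x 1 F (dF x).
  move=> x0; have h1 : 1 + 9 / 20 * x != 0 by rewrite gt_eqF //; lra.
  have h2 : 0 < 1 + x by lra.
  have d1 : is_derive x 1 (fun x : R => 1 + 9 / 20 * x) (9 / 20).
    by apply: is_derive_eq; rewrite /GRing.scale /=; ring.
  have d2 := @is_deriveV R _ x _ _ h1 d1.
  have d3 : is_derive x 1 (fun x : R => 1 + x) 1.
    by apply: is_derive_eq; rewrite /GRing.scale /=; ring.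
  have d4 := @is_derive1_comp R (@ln R) (fun x : R => 1 + x) x _ _ (is_derive1_ln h2) d3.
  have d5 : is_derive x 1 (fun x => ln (1 + x)) ((1 + x)^-1 * 1) by exact: d4.
  apply: is_derive_eq; rewrite /dF /q /K /GRing.scale /=.
  by field; do ?[apply/andP; split]; rewrite gt_eqF //; lra.
have F0 : F 0 = 0 by rewrite /F mulr0 !addr0 invr1 mulr1 subrr ln1 subrr.
have F1 : F 1 = 0 by rewrite /F /K (_ : 1 + 1 = 2 :> R) //; field.
suff : 0 <= F t.
  rewrite subr_ge0 => /le_trans; apply; rewrite le_eqVlt; apply/orP; left; apply/eqP.
  by rewrite /K; field; rewrite gt_eqF //; lra.
have den0 x : 0 <= x -> 0 <= (1 + 9 / 20 * x) ^+ 2 * (1 + x).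
  by move=> x0; rewrite mulr_ge0 ?sqr_ge0 //; lra.
have q0 : 0 <= q 0 by rewrite /q; lra.
(* [q s / s] is nonincreasing, so [F] increases, then decreases; it vanishes at
   both ends of [0, 1]. *)
have qE s r : r * q s - s * q r = (r - s) * q 0 + 81 / 400 * (s * r * (r - s)).
  by rewrite /q; field.
have [qt|qt] := leP 0 (q t).
  rewrite -[leLHS]F0; apply: (@nondecreasing_of_derive _ F dF 0 t t0).
    by move=> s /andP[s0 _]; exact: derF.
  move=> s /andP[s0 st].
  rewrite divr_ge0 ?den0 //.
  have [t00|tp] := leP t 0; first by have -> : s = 0 by lra.
  rewrite -(pmulr_rge0 _ tp) -[t * _](subrK (s * q t)) qE.
  have st0 : 0 <= t - s by lra.
  have h1 := mulr_ge0 st0 q0; have h2 := mulr_ge0 (mulr_ge0 s0 t0) st0.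
  by have h3 := mulr_ge0 s0 qt; clearbody q; lra.
rewrite -oppr_le0 -[leRHS]oppr0 -F1.
apply: (@nondecreasing_of_derive _ (fun x => - F x) (fun x => - dF x) t 1 t1).
  by move=> s /andP[ts _]; have ? := derF s (le_trans t0 ts); exact: is_deriveN.
move=> s /andP[ts s1].
rewrite oppr_ge0 /dF mulr_le0_ge0 ?invr_ge0 ?den0 ?(le_trans t0) //.
rewrite leNgt; apply/negP => qs.
have s0 : 0 < s.
  rewrite lt_neqAle (le_trans t0 ts) andbT; apply/eqP => s0; have t00 : t = 0 by lra.
  by move: qt; rewrite t00 ltNge q0.
have : 0 <= s * q t.
  rewrite -[s * _](subrK (t * q s)) qE.
  have st0 : 0 <= s - t by lra.
  have h1 := mulr_ge0 st0 q0; have h2 := mulr_ge0 (mulr_ge0 t0 (ltW s0)) st0.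
  by have h3 := mulr_ge0 t0 (ltW qs); clearbody q; lra.
by rewrite pmulr_rge0 // leNgt qt.
Qed.

(** The three logarithms merge into [log2 (1 + t)] with [t] in [[0, 1]], the form that [ln_1D_le]
    bounds. *)
Lemma ehll_f_log u : 0 <= u -> ehll_f u =
  ln (1 + (12 + 11 * u + u ^+ 2) / (12 + 27 * u + 18 * u ^+ 2 + 3 * u ^+ 3)) / ln 2.
Proof.
move=> u0; rewrite /ehll_f /log2 -!mulrDl -mulrBl; congr (_ / _).
have D0 : 0 < 12 + 27 * u + 18 * u ^+ 2 + 3 * u ^+ 3.
  by have := exprn_ge0 2 u0; have := exprn_ge0 3 u0; lra.
have -> : 1 + (12 + 11 * u + u ^+ 2) / (12 + 27 * u + 18 * u ^+ 2 + 3 * u ^+ 3) =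
    (2 + u) / (1 + u) * ((4 + 3 * u) / (3 + 3 * u)) / ((4 + u) / (3 + u)).
  by field; rewrite !gt_eqF //; lra.
have p1 : 0 < (2 + u) / (1 + u) by rewrite divr_gt0 //; lra.
have p2 : 0 < (4 + 3 * u) / (3 + 3 * u) by rewrite divr_gt0 //; lra.
have p3 : 0 < (4 + u) / (3 + u) by rewrite divr_gt0 //; lra.
have p12 := mulr_gt0 p1 p2.
rewrite [in RHS]ln_div ?posrE // [in RHS]lnM ?posrE //.
Qed.

(* [ehll_f_log] combined with [ln_1D_le]. *)
Definition fmaj u : R :=
  29 / 20 * (12 + 11 * u + u ^+ 2) / (87 / 5 + 639 / 20 * u + 369 / 20 * u ^+ 2 + 3 * u ^+ 3).

Lemma ehll_f_ge0_le u : 0 <= u -> 0 <= ehll_f u <= fmaj u.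
Proof.
move=> u0; have l2 : 0 < ln 2 :> R by rewrite ln_gt0 // ltr1n.
have u2 := exprn_ge0 2 u0; have u3 := exprn_ge0 3 u0.
have D0 : 0 < 12 + 27 * u + 18 * u ^+ 2 + 3 * u ^+ 3 by lra.
set t := (12 + 11 * u + u ^+ 2) / (12 + 27 * u + 18 * u ^+ 2 + 3 * u ^+ 3).
have t01 : 0 <= t <= 1.
  by rewrite /t divr_ge0 ?(ltW D0) /= ?ler_pdivrMr //; lra.
have t0 : 1 <= 1 + t by case/andP: t01; lra.
rewrite ehll_f_log // -/t; apply/andP; split.
  by apply: divr_ge0; [exact: ln_ge0|exact: ltW].
rewrite ler_pdivrMr //; apply: (le_trans (ln_1D_le t01)).
rewrite mulrC ler_pM2r // le_eqVlt; apply/orP; left; apply/eqP.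
rewrite /t /fmaj; have N0 : 0 < 12 + 11 * u + u ^+ 2 by lra.
have -> : 87 / 5 + 639 / 20 * u + 369 / 20 * u ^+ 2 + 3 * u ^+ 3 =
    12 + 27 * u + 18 * u ^+ 2 + 3 * u ^+ 3 + 9 / 20 * (12 + 11 * u + u ^+ 2) by field.
clear t t01 t0; move: D0 N0.
move: (12 + 27 * u + 18 * u ^+ 2 + 3 * u ^+ 3) (12 + 11 * u + u ^+ 2) => D N D0 N0.
by field; do ?[apply/andP; split]; apply: lt0r_neq0; lra.
Qed.

(** The majorant has powers with explicit integrals. Its rate [9 / 10] must stay below
    [2 / (3 * ln 2)], about 0.96, which is minus the slope of [ehll_f] at 0. *)
Lemma ehll_f_wbound_le u : 0 <= u ->
  ehll_f u + eta * wbound u <= (1 + 9 / 10 * u)^-1.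
Proof.
move=> u0; have /andP[_ h] := ehll_f_ge0_le u0.
have u2 := exprn_ge0 2 u0; have u3 := exprn_ge0 3 u0.
have u4 := exprn_ge0 4 u0; have u5 := exprn_ge0 5 u0.
have e : eta <= 1 / 1000 :> R by rewrite /eta !exprS expr0; lra.
have D0 : 0 < 1 + 3 / 100 * u + u ^+ 2 / 2 by lra.
have E0 : 0 < 87 / 5 + 639 / 20 * u + 369 / 20 * u ^+ 2 + 3 * u ^+ 3 by lra.
have G0 : 0 < 1 + 9 / 10 * u by lra.
apply: (@le_trans _ _ (fmaj u + 1 / 1000 * wbound u)).
  by rewrite lerD // ler_wpM2r ?wbound_ge0.
rewrite -subr_ge0.
rewrite [leRHS](_ : _ = ((1 + 3 / 100 * u + u ^+ 2 / 2)
   * (87 / 5 + 639 / 20 * u + 369 / 20 * u ^+ 2 + 3 * u ^+ 3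
      - 29 / 20 * (12 + 11 * u + u ^+ 2) * (1 + 9 / 10 * u))
   - 7 / 6000 * u * (87 / 5 + 639 / 20 * u + 369 / 20 * u ^+ 2 + 3 * u ^+ 3) * (1 + 9 / 10 * u))
   / ((1 + 9 / 10 * u) * (1 + 3 / 100 * u + u ^+ 2 / 2)
   * (87 / 5 + 639 / 20 * u + 369 / 20 * u ^+ 2 + 3 * u ^+ 3))); last first.
  by rewrite /fmaj /wbound; field; do ?[apply/andP; split]; apply: lt0r_neq0; lra.
apply: divr_ge0; last by apply: ltW; do !apply: mulr_gt0.
by clear h e D0 E0 G0; nra.
Qed.

End ehll_f_bounds.

(** * Dyadic sums of [hker] with arbitrarily many terms *)

Section window_limit.
Context {R : realType}.
Implicit Types (a b c e u v x y t : R) (i j n k : nat).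

(** The two summands are the states [C2 = 1] and [C2 = 0] with [C1 = k] and [y = x / 2 ^ k]. In the
    first no value exceeds [k] while [k] and [k - 1] both occur; in the second [k] occurs and
    nothing else from [k - 1] on. *)
Lemma hkerE u y : hker u y =
  expR (- ((1 + u) * y)) * ((1 - expR (- y)) * (1 - expR (- (2 * y))))
  + expR (- ((3 + 3 * u) * y)) * (1 - expR (- y)).
Proof.
rewrite /hker.
have -> : - ((2 + u) * y) = - ((1 + u) * y) + - y by ring.
have -> : - ((3 + u) * y) = - ((1 + u) * y) + - (2 * y) by ring.
have -> : - ((4 + u) * y) = - ((1 + u) * y) + (- y + - (2 * y)) by ring.
have -> : - ((4 + 3 * u) * y) = - ((3 + 3 * u) * y) + - y by ring.
by rewrite !expRD; ring.
Qed.

Lemma hker_ge0 u y : 0 <= y -> 0 <= hker u y.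
Proof.
move=> y0; have h x : 0 <= x -> 0 <= 1 - expR (- x) by move=> /expRN_1/andP[].
by rewrite hkerE addr_ge0 ?mulr_ge0 ?expR_ge0 ?h // mulr_ge0.
Qed.

Lemma wsum_hker_nondecreasing u y n k : 0 <= y -> (n <= k)%N ->
  wsum (hker u) y n <= wsum (hker u) y k.
Proof.
move=> y0 nk; rewrite -(subnKC nk) wsumD lerDl wsum_ge0 ?divr_ge0 ?exprn_ge0 //.
by move=> x; exact: hker_ge0.
Qed.

Lemma exists_pow2_ge c y : 0 < y -> exists k, c <= y * 2 ^+ k.
Proof.
move=> y0; exists (Num.truncn (Num.max 0 (c / y))).+1.
have m0 : 0 <= Num.max 0 (c / y) by rewrite le_max lexx.
have /andP[_ h] := truncn_itv m0.
rewrite mulrC -ler_pdivrMr //; apply: (@le_trans _ _ (Num.max 0 (c / y))).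
  by rewrite le_max lexx orbT.
by apply: (le_trans (ltW h)); rewrite -natrX ler_nat ltnW // ltn_expl.
Qed.

Lemma wsum_hker_lower u y e : 32 <= y -> 0 <= u -> 0 < e ->
  exists n0, forall n, (n0 <= n)%N ->
  `|wsum (hker u) y n - ehll_f u| <=
     eta * wbound u + 3 * expR (- (2 * ((1 + u / 4) * y))) + e.
Proof.
move=> y32 u0 e0; have z0 : 0 < (4 + 3 * u) * y by rewrite mulr_gt0 //; lra.
have [j hj] := @exists_pow2_ge ((4 + 3 * u) * y + 1) 1 ltr01.
have [k hk] := @exists_pow2_ge (3 * ((4 + 3 * u) * y)) e e0.
exists (j + 25 + k)%N => n jn.
have jn1 : (j + 25 <= n)%N by lia.
have uj : (4 + 3 * u) * y < 2 ^+ j by rewrite mul1r in hj; lra.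
apply: (le_trans (@wsum_hker_approx R u y j n y32 u0 uj jn1)).
rewrite lerD2l mulrA ler_pdivrMr ?exprn_gt0 //.
apply: (le_trans hk); rewrite ler_pM2l // ler_weXn2l //; first lra.
by lia.
Qed.

(** As the terms are nonnegative, [y] may be multiplied by powers of 2; this sends the top boundary
    error of [wsum_hker_lower] to 0 and frees [y] from any lower bound. *)
Lemma wsum_hker_upper u y n : 0 < y -> 0 <= u ->
  wsum (hker u) y n <= ehll_f u + eta * wbound u.
Proof.
move=> y0 u0; apply/ler_addgt0Pr => e e0.
have e2 : 0 < e / 2 by lra.
(* With [z = y * 2 ^ k], the second requirement gives [3 * exp (- z) <= 3 / z <= e / 2]. *)
have [k hk] := @exists_pow2_ge (Num.max 32 (3 / (e / 2))) y y0.
move: hk; rewrite ge_max => /andP[k32 ke].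
have [n0 hn] := wsum_hker_lower k32 u0 e2.
apply: (@le_trans _ _ (wsum (hker u) (y * 2 ^+ k) (k + n + n0))).
  apply: (@le_trans _ _ (wsum (hker u) (y * 2 ^+ k) (k + n))).
    rewrite wsumD mulfK ?expf_neq0 // lerDr wsum_ge0 ?mulr_ge0 ?(ltW y0) ?exprn_ge0 //.
    by move=> x; exact: hker_ge0.
  by apply: wsum_hker_nondecreasing; [lra|exact: leq_addr].
have := hn (k + n + n0)%N (leq_addl _ _); rewrite ler_norml => /andP[_].
suff : 3 * expR (- (2 * ((1 + u / 4) * (y * 2 ^+ k)))) <= e / 2 by lra.
move: ke; move: (y * 2 ^+ k) k32 => z k32; rewrite ler_pdivrMr // => ke.
have h1 : expR (- (2 * ((1 + u / 4) * z))) <= expR (- z) by rewrite ler_expR; nra.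
have h2 : expR (- z) * z <= 1.
  have := expR_ge1Dx z; rewrite expRN mulrC ler_pdivrMr ?expR_gt0 //; lra.
have y0' : 0 < z by lra.
rewrite -(ler_pM2r y0').
have := ler_wpM2r (ltW y0') h1; lra.
Qed.

End window_limit.

(** * Integrals of powers of the transform *)

Section integrals.
Context {R : realType}.
Implicit Types (a b c e u v x y t : R) (i j n k m : nat) (f F : R -> R).
Local Notation mu := (@lebesgue_measure R).

Lemma integral_0y_FTC F f (l C : R) : (forall x, 0 <= x -> 0 <= f x) ->
  (forall x, 0 <= x -> derivable f x 1) ->
  (forall x, 0 <= x -> is_derive x 1 F (f x)) ->
  (forall x, 0 < x -> `|F x - l| <= C / x) ->
  (\int[mu]_(x in `[0%R, +oo[) (f x)%:E = (l - F 0)%:E)%E.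
Proof.
move=> f0 df dF Fl.
have contf g x : derivable g x 1 -> {for x, continuous g}.
  by move=> /derivable1_diffP/differentiable_continuous.
rewrite EFinB; apply: ge0_continuous_FTC2y => //.
- apply: continuous_in_subspaceT => x; rewrite inE /= in_itv /= andbT => x0.
  by apply: contf; exact: df.
- apply/cvgrPdist_le => e e0.
  apply: filterS (nbhs_pinfty_ge (num_real (Num.max 1 (C / e)))) => x.
  rewrite ge_max => /andP[x1 xe]; have x0 : 0 < x by lra.
  rewrite distrC; apply: (le_trans (Fl _ x0)); rewrite ler_pdivrMr // mulrC.
  by rewrite -ler_pdivrMr.
- by move=> x x0; exact: (@ex_derive _ _ _ _ _ _ _ (dF x (ltW x0))).
- apply: cvg_at_right_filter; apply: contf.
  exact: (@ex_derive _ _ _ _ _ _ _ (dF 0 (lexx _))).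
- move=> x; rewrite in_itv /= andbT => x0; rewrite derive1E.
  exact: (@derive_val _ _ _ _ _ _ _ (dF x (ltW x0))).
Qed.

Lemma measurable_fun_derivable f : (forall x, 0 <= x -> derivable f x 1) ->
  measurable_fun (`[0, +oo[ : set R) f.
Proof.
move=> df; apply: subspace_continuous_measurable_fun => //.
apply: continuous_in_subspaceT => x; rewrite inE /= in_itv /= andbT => x0.
by move: (df x x0) => /derivable1_diffP/differentiable_continuous.
Qed.

Lemma integral_expRN c : 0 < c ->
  (\int[mu]_(x in `[0%R, +oo[) (expR (- (c * x)))%:E = (c^-1)%:E)%E.
Proof.
move=> c0; pose F x := - c^-1 * expR (- (c * x)).
have -> : c^-1 = 0 - F 0 by rewrite /F mulr0 oppr0 expR0 mulr1 sub0r opprK.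
apply: (@integral_0y_FTC F _ 0 (c^-1 / c)).
- by move=> x _; exact: expR_ge0.
- by move=> x _; exact: ex_derive.
- by move=> x _; apply: is_derive_eq; rewrite /GRing.scale /=; field; rewrite gt_eqF.
- move=> x x0; rewrite /F subr0 normrM normrN !ger0_norm ?expR_ge0 ?invr_ge0 ?(ltW c0) //.
  rewrite -mulrA ler_wpM2l ?invr_ge0 ?(ltW c0) // -invfM expRN.
  rewrite lef_pV2 ?posrE ?expR_gt0 ?mulr_gt0 //.
  by have := expR_ge1Dx (c * x); lra.
Qed.

Lemma ler_subX m x y : 0 <= x -> x <= y -> y ^+ m.+1 - x ^+ m.+1 <= m.+1%:R * (y - x) * y ^+ m.
Proof.
move=> x0 xy; have y0 := le_trans x0 xy.
elim: m => [|m IH]; first by rewrite !expr1 expr0; lra.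
rewrite exprS [x ^+ m.+2]exprS.
have h1 : x ^+ m.+1 <= y ^+ m.+1 by rewrite lerXn2r.
have h2 : 0 <= (y - x) * y ^+ m.+1 by rewrite mulr_ge0 ?subr_ge0 ?exprn_ge0.
have h3 := ler_wpM2l y0 IH.
have h4 : (y - x) * x ^+ m.+1 <= (y - x) * y ^+ m.+1 by rewrite ler_wpM2l ?subr_ge0.
have h5 : y * (m.+1%:R * (y - x) * y ^+ m) = m.+1%:R * ((y - x) * y ^+ m.+1).
  by rewrite exprS; ring.
rewrite -natr1 -mulrA; move: h2 h3 h4; rewrite h5.
move: (y ^+ m.+1) (x ^+ m.+1) h1 => p q h1; lra.
Qed.

End integrals.

(** * An integrable majorant of the error on [f ^ m] *)

Section majorant.
Context {R : realType}.
Implicit Types (a b c e u v x y t : R) (i j n k m : nat) (f F : R -> R).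
Local Notation mu := (@lebesgue_measure R).

Definition decay u : R := (1 + 9 / 10 * u)^-1.

Lemma decay_itv u : 0 <= u -> 0 < decay u <= 1.
Proof.
move=> u0; have h : 1 <= 1 + 9 / 10 * u by lra.
by rewrite /decay invr_gt0 (lt_le_trans _ h) //= invf_le1 // (lt_le_trans _ h).
Qed.

Lemma is_derive_decay u : 0 <= u -> is_derive u 1 decay (- (9 / 10 * decay u ^+ 2)).
Proof.
move=> u0; have h1 : 1 + 9 / 10 * u != 0 by rewrite gt_eqF //; lra.
have d1 : is_derive u 1 (fun x : R => 1 + 9 / 10 * x) (9 / 10).
  by apply: is_derive_eq; rewrite /GRing.scale /=; ring.
have d2 := @is_deriveV R _ u _ _ h1 d1.
apply: (is_derive_eq d2).
by rewrite /decay /GRing.scale /= exprVn; ring.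
Qed.

Lemma decay_le_inv u : 0 < u -> decay u <= 10 / 9 / u.
Proof.
move=> u0; rewrite /decay -[leRHS]invrK lef_pV2 ?posrE ?invr_gt0 ?divr_gt0 //; last by lra.
by rewrite invf_div invf_div; lra.
Qed.

Lemma is_derive_decayX u k : 0 <= u ->
  is_derive u 1 (fun x => decay x ^+ k.+1) (- (9 / 10 * k.+1%:R * decay u ^+ k.+2)).
Proof.
move=> u0; have d := is_derive_decay u0.
rewrite (_ : (fun x => decay x ^+ k.+1) = decay ^+ k.+1); last first.
  by apply/funext => x; rewrite fctE.
apply: is_derive_eq.
by rewrite /GRing.scale /= !exprS; ring.
Qed.

Lemma decayX_le_inv u k : 0 < u -> decay u ^+ k.+1 <= 10 / 9 / u.
Proof.
move=> u0; apply: le_trans (decay_le_inv u0).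
have /andP[h0 h1] := decay_itv (ltW u0).
by rewrite exprS ler_piMr ?(ltW h0) // exprn_ile1 // ltW.
Qed.

Lemma decay_compl u : 0 <= u -> 9 / 10 * u * decay u = 1 - decay u.
Proof. by move=> u0; rewrite /decay; field; rewrite gt_eqF //; lra. Qed.

Lemma integral_decayX k :
  (\int[mu]_(x in `[0%R, +oo[) (decay x ^+ k.+2)%:E = (10 / 9 / k.+1%:R)%:E)%E.
Proof.
pose F x := - (10 / 9 / k.+1%:R) * decay x ^+ k.+1.
have -> : 10 / 9 / k.+1%:R = 0 - F 0.
  by rewrite /F /decay mulr0 addr0 invr1 expr1n mulr1 sub0r opprK.
apply: (@integral_0y_FTC R F (fun x => decay x ^+ k.+2) 0 (10 / 9 / k.+1%:R * (10 / 9))).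
- by move=> x x0; rewrite exprn_ge0 // ltW //; case/andP: (decay_itv x0).
- by move=> x x0; exact: (@ex_derive _ _ _ _ _ _ _ (is_derive_decayX k.+1 x0)).
- move=> x x0; have d := is_derive_decayX k x0; rewrite /F; apply: is_derive_eq.
  have k0 : 0 <= k%:R :> R by [].
  by rewrite /GRing.scale /=; field; apply: lt0r_neq0; lra.
- move=> x x0; have d0 := ltW (proj1 (andP (decay_itv (ltW x0)))).
  rewrite /F subr0 normrM normrN (ger0_norm (exprn_ge0 k.+1 d0)) ger0_norm ?divr_ge0 //.
  by rewrite -[leRHS]mulrA ler_wpM2l ?divr_ge0 // decayX_le_inv.
Qed.

(* [majorant m] dominates the error made on [ehll_f ^+ m] by an oscillation [eta]
   and must integrate to at most 8.4e-5 / m; [m = 2] is the tight case. *)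
Definition majorant m u : R :=
  if m is 2 then 2 * eta * (33 / 25 * u * (1 + 11 / 40 * u) / (1 + 11 / 20 * u + u ^+ 2 / 2) ^+ 2)
  else 3 * m%:R * eta * u * decay u ^+ m.+1.

Lemma majorant_ge0 m u : 0 <= u -> 0 <= majorant m u.
Proof.
move=> u0; have e0 := @eta_ge0 R; have /andP[d0 _] := decay_itv u0.
have h k : 0 <= 3 * k%:R * eta * u * decay u ^+ k.+1.
  by rewrite !mulr_ge0 // exprn_ge0 // ltW.
case: m => [|[|[|m]]]; [exact: h|exact: h| |exact: h].
by rewrite /majorant !mulr_ge0 ?invr_ge0 ?sqr_ge0 //; lra.
Qed.

(** By [ler_subX], the left side bounds [(f + eta * w) ^ m - f ^ m]. For [m = 2] it is compared
    through [fmaj]; for [m >= 3] the cruder [w <= 3 * u * decay u ^ 2] and [f + eta * w <= decay u]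
    are enough. *)
Lemma eta_wbound_le_majorant m u : (2 <= m)%N -> 0 <= u ->
  m%:R * (eta * wbound u) * (ehll_f u + eta * wbound u) ^+ m.-1 <= majorant m u.
Proof.
move=> m2 u0; have e0 := @eta_ge0 R; have w0 := wbound_ge0 u0.
have /andP[d0 d1] := decay_itv u0.
have /andP[f0 ff] := ehll_f_ge0_le u0.
have g0 : 0 <= ehll_f u + eta * wbound u by rewrite addr_ge0 // mulr_ge0.
have u2 := sqr_ge0 u.
have Q0 : 0 < 1 + 3 / 100 * u + u ^+ 2 / 2 by lra.
case: m m2 => [|[|[|m]]] // _.
  have e1 : eta <= 1 / 1000 :> R by rewrite /eta !exprS expr0; lra.
  have E0 : 0 < 87 / 5 + 639 / 20 * u + 369 / 20 * u ^+ 2 + 3 * u ^+ 3.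
    by have u3 := exprn_ge0 3 u0; lra.
  have P0 : 0 < 1 + 11 / 20 * u + u ^+ 2 / 2 by lra.
  rewrite /majorant expr1 [2%:R * _]mulrA -[leLHS]mulrA ler_wpM2l ?mulr_ge0 //.
  have h : ehll_f u + eta * wbound u <= fmaj u + 1 / 1000 * wbound u.
    by rewrite lerD // ler_wpM2r.
  apply: (le_trans (ler_wpM2l w0 h)); rewrite -subr_ge0.
  rewrite [leRHS](_ : _ = u * (33 / 25 * (1 + 11 / 40 * u)
      * (87 / 5 + 639 / 20 * u + 369 / 20 * u ^+ 2 + 3 * u ^+ 3)
      * (1 + 3 / 100 * u + u ^+ 2 / 2) ^+ 2
    - 7 / 6 * (29 / 20 * (12 + 11 * u + u ^+ 2) * (1 + 3 / 100 * u + u ^+ 2 / 2)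
      + 7 / 6000 * u * (87 / 5 + 639 / 20 * u + 369 / 20 * u ^+ 2 + 3 * u ^+ 3))
      * (1 + 11 / 20 * u + u ^+ 2 / 2) ^+ 2)
    / ((87 / 5 + 639 / 20 * u + 369 / 20 * u ^+ 2 + 3 * u ^+ 3)
      * (1 + 3 / 100 * u + u ^+ 2 / 2) ^+ 2 * (1 + 11 / 20 * u + u ^+ 2 / 2) ^+ 2)).
    apply: divr_ge0; last by apply: ltW; do !apply: mulr_gt0; rewrite ?exprn_gt0.
    apply: (mulr_ge0 u0).
    have q1 := mulr_ge0 (exprn_ge0 4 u0) (sqr_ge0 (1 - u)).
    have q2 := mulr_ge0 (exprn_ge0 6 u0) (sqr_ge0 (1 - u)).
    have ui k := exprn_ge0 k u0.
    have := ui 3; have := ui 4; have := ui 5; have := ui 6; have := ui 7; have := ui 8.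
    by move: q1 q2; clear -u0 u2; lra.
  move: E0 P0 Q0; clear; rewrite /fmaj /wbound => E0 P0 Q0.
  by field; rewrite ?(gt_eqF P0); do ?[apply/andP; split]; apply: lt0r_neq0; lra.
rewrite /majorant [m.+3.-1]/=.
have gd : (ehll_f u + eta * wbound u) ^+ m.+2 <= decay u ^+ m.+2.
  by rewrite lerXn2r ?nnegrE ?(ltW d0) //; exact: ehll_f_wbound_le.
apply: (le_trans (ler_wpM2l (mulr_ge0 (ler0n R _) (mulr_ge0 e0 w0)) gd)).
have -> : 3 * m.+3%:R * eta * u * decay u ^+ m.+4 =
    m.+3%:R * (eta * (3 * u * decay u ^+ 2)) * decay u ^+ m.+2 by rewrite !exprS; ring.
rewrite ler_wpM2r ?exprn_ge0 ?(ltW d0) // ler_wpM2l // ler_wpM2l //.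
rewrite /wbound /decay exprVn ler_pdivrMr // [leRHS]mulrAC ler_pdivlMr ?exprn_gt0 //; last lra.
(* The difference is [u] times a quadratic whose minimum, positive by a small margin, is at
   [67 / 37]. *)
by have := mulr_ge0 u0 (sqr_ge0 (u - 67 / 37)); clear -u0; lra.
Qed.

Lemma derivable_majorant m u : 0 <= u -> derivable (majorant m) u 1.
Proof.
move=> u0.
have h k : derivable (fun x => 3 * k%:R * eta * x * decay x ^+ k.+1) u 1.
  by have d := is_derive_decayX k u0; exact: ex_derive.
case: m => [|[|[|m]]]; [exact: h|exact: h| |exact: h].
pose P x : R := 1 + 11 / 20 * x + x ^+ 2 / 2.
have P0 : P u != 0 by rewrite gt_eqF // /P; have := sqr_ge0 u; lra.
have dP : is_derive u 1 P (11 / 20 + u).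
  by apply: is_derive_eq; rewrite /GRing.scale /=; field.
have d := @is_deriveV R P u _ 1 P0 dP.
rewrite (_ : majorant 2 =
    (fun x => 2 * eta * (33 / 25 * x * (1 + 11 / 40 * x)) * (P x)^-1 ^+ 2)).
  exact: ex_derive.
by apply/funext => y; rewrite /majorant -/(P y) exprVn; ring.
Qed.

(** The general formula integrates to [300 / 81 * eta / (m - 1)], which just fits the budget at
    [m = 3] but exceeds it at [m = 2]; hence the separate rational function there, with integral
    [66 / 25 * eta]. *)
Lemma integral_majorant m : (2 <= m)%N ->
  exists2 I : R, I <= 84 / 10 ^+ 6 / m%:R &
  (\int[mu]_(x in `[0%R, +oo[) (majorant m x)%:E = I%:E)%E.
Proof.
move=> m2; have e0 := @eta_ge0 R.
case: m m2 => [|[|[|m]]] // _.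
  pose P x : R := 1 + 11 / 20 * x + x ^+ 2 / 2.
  have P0 x : 0 <= x -> 0 < P x by move=> x0; rewrite /P; have := sqr_ge0 x; lra.
  (* The shape of [majorant 2] comes from this antiderivative:
     [(1 + a * x) / (1 + a * x + x ^ 2 / 2)] has derivative [- x * (1 + a / 2 * x) / P ^ 2], here
     with [a = 11 / 20]. *)
  pose F x := - (66 / 25 * eta) * ((1 + 11 / 20 * x) * (P x)^-1).
  have dP x : is_derive x 1 P (11 / 20 + x).
    by apply: is_derive_eq; rewrite /GRing.scale /=; field.
  have dPV x : 0 <= x -> is_derive x 1 (fun x => (P x)^-1) (- (P x) ^- 2 * (11 / 20 + x)).
    by move=> x0; exact: (@is_deriveV R P x _ 1 (lt0r_neq0 (P0 x x0)) (dP x)).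
  exists (66 / 25 * eta).
    have : 0 <= (10 ^+ 6)^-1 :> R by rewrite invr_ge0 exprn_ge0.
    by rewrite /eta; move: (10 ^+ 6)^-1 => b b0; lra.
  have -> : 66 / 25 * eta = 0 - F 0.
    by rewrite /F /P mulr0 addr0 expr0n /= mul0r addr0 invr1 !mulr1 sub0r opprK.
  apply: (@integral_0y_FTC R F (majorant 2) 0 (66 / 25 * eta * 2)).
  - by move=> x x0; exact: (@majorant_ge0 2).
  - exact: derivable_majorant.
  - move=> x x0; have d := dPV x x0; rewrite /F; apply: is_derive_eq.
    rewrite /GRing.scale /=.
    have := P0 x x0; rewrite /P => Px.
    by field; apply: lt0r_neq0; lra.
  - move=> x x0; have Px := P0 x (ltW x0).
    have k0 : 0 <= 66 / 25 * eta :> R by rewrite mulr_ge0.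
    have q0 : 0 <= (1 + 11 / 20 * x) / P x.
      by rewrite divr_ge0 ?(ltW Px) //; clear -x0; lra.
    rewrite /F subr0 normrM normrN (ger0_norm k0) (ger0_norm q0) -[leRHS]mulrA.
    rewrite ler_wpM2l // ler_pdivrMr // [leRHS]mulrAC ler_pdivlMr // /P.
    by have := sqr_ge0 x; clear -x0; lra.
pose c : R := 3 * m.+3%:R * eta * (10 / 9).
pose F x := c * (10 / 9 / m.+3%:R * decay x ^+ m.+3 - 10 / 9 / m.+2%:R * decay x ^+ m.+2).
exists (- F 0).
  have m0 : 0 <= m%:R :> R by [].
  have : 0 <= (10 ^+ 6)^-1 :> R by rewrite invr_ge0 exprn_ge0.
  rewrite /F /c /decay mulr0 addr0 invr1 !expr1n !mulr1 /eta.
  have -> : m.+3%:R = m%:R + 3 :> R by rewrite -!natr1; ring.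
  have -> : m.+2%:R = m%:R + 2 :> R by rewrite -!natr1; ring.
  move: (10 ^+ 6)^-1 (m%:R : R) m0 => b x x0 b0.
  rewrite -subr_ge0 [leRHS](_ : _ = b * (4 / 3 + 256 / 9 * x) / ((x + 3) * (x + 2))).
    by rewrite divr_ge0 ?mulr_ge0 //; lra.
  by field; do ?[apply/andP; split]; apply: lt0r_neq0; lra.
have -> : - F 0 = 0 - F 0 by rewrite sub0r.
apply: (@integral_0y_FTC R F (majorant m.+3) 0
  (c * (10 / 9 / m.+3%:R * (10 / 9) + 10 / 9 / m.+2%:R * (10 / 9)))).
- by move=> x x0; exact: (@majorant_ge0 m.+3).
- exact: derivable_majorant.
- move=> x x0; have d1 := is_derive_decayX m.+2 x0; have d2 := is_derive_decayX m.+1 x0.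
  rewrite /F; apply: is_derive_eq; rewrite /GRing.scale /majorant /=.
  have m0 : 0 <= m%:R :> R by [].
  (* By [decay_compl] the factor [x] turns into a difference of two consecutive powers of
     [decay]. *)
  have -> : 3 * m.+3%:R * eta * x * decay x ^+ m.+4 = c * (9 / 10 * x * decay x) * decay x ^+ m.+3.
    by rewrite /c [decay x ^+ m.+4]exprS; field.
  rewrite (decay_compl x0) [decay x ^+ m.+4]exprS.
  have -> : m.+3%:R = m%:R + 3 :> R by rewrite -!natr1; ring.
  have -> : m.+2%:R = m%:R + 2 :> R by rewrite -!natr1; ring.
  by field; do ?[apply/andP; split]; apply: lt0r_neq0; lra.
- move=> x x0; rewrite /F subr0.
  have c0 : 0 <= c by rewrite /c !mulr_ge0.
  have d0 := ltW (proj1 (andP (decay_itv (ltW x0)))).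
  rewrite normrM (ger0_norm c0) -[leRHS]mulrA ler_wpM2l //.
  apply: (le_trans (ler_normB _ _)).
  have kk k : 0 <= 10 / 9 / k%:R :> R by rewrite divr_ge0.
  have kd k j := mulr_ge0 (kk k) (exprn_ge0 j d0).
  rewrite (ger0_norm (kd m.+3 m.+3)) (ger0_norm (kd m.+2 m.+2)) [leRHS]mulrDl.
  by apply: lerD; rewrite -[leRHS]mulrA ler_wpM2l // decayX_le_inv.
Qed.

End majorant.

(** * The Laplace transform of one cell *)

Section transform_bounds.
Context {R : realType}.
Implicit Types (a b c e u v x y t : R) (i j n k m : nat) (f F : R -> R).
Local Notation mu := (@lebesgue_measure R).
Local Notation D := (`[0%R, +oo[%classic : set R).

(* [boundary] collects the states [C1 = 0] and [C1 = 1], and [wsum] those with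
   [2 <= C1 < n + 2]; see [state_prob_transform]. *)
Definition boundary x u : R := expR (- ((1 + u) * x))
  + (expR (- (x / 2)) - expR (- x)) * expR (- (u * (x / 2))).

Definition transform x n u : R := boundary x u + wsum (hker u) (x / 4) n.

Lemma boundary_itv x u : 0 <= x -> 0 <= u ->
  0 <= boundary x u <= 2 * (expR (- (x / 2)) * expR (- (x / 2 * u))).
Proof.
move=> x0 u0; rewrite /boundary (mulrC u).
have h1 : expR (- x) <= expR (- (x / 2)) by rewrite ler_expR; lra.
have h2 : expR (- ((1 + u) * x)) <= expR (- (x / 2)) * expR (- (x / 2 * u)).
  by rewrite -expRD ler_expR; nra.
have h3 := expR_ge0 (- (x / 2 * u)); have h4 := expR_ge0 (- ((1 + u) * x)).
have h5 := expR_ge0 (- x).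
apply/andP; split; first by rewrite addr_ge0 // mulr_ge0 // subr_ge0.
have := mulr_ge0 h5 h3; lra.
Qed.

Lemma transform_ge0 x n u : 0 <= x -> 0 <= u -> 0 <= transform x n u.
Proof.
move=> x0 u0; have /andP[b0 _] := boundary_itv x0 u0.
rewrite addr_ge0 // wsum_ge0 ?divr_ge0 // => y; exact: hker_ge0.
Qed.

Lemma measurable_expR_affine (a b : R) (A : set R) :
  measurable_fun A (fun u => expR (- (a + b * u))).
Proof.
apply: (measurableT_comp (@measurable_expR R)).
apply: measurable_funN; apply: measurable_funD; first exact: measurable_cst.
by apply: measurable_funM; [exact: measurable_cst|exact: measurable_id].
Qed.

Lemma measurable_transform x n (A : set R) : measurable_fun A (transform x n).
Proof.
have aff a b (f : R -> R) : (forall u, f u = a + b * u) ->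
    measurable_fun A (fun u => expR (- (f u))).
  move=> fE; under eq_fun do rewrite fE; exact: measurable_expR_affine.
apply: measurable_funD.
  apply: measurable_funD; first by apply: (aff x x) => u; ring.
  apply: measurable_funM; first exact: measurable_cst.
  by apply: (aff 0 (x / 2)) => u; ring.
apply: measurable_sum => i; set y := _ / _.
apply: measurable_funB; last by apply: (aff (4 * y) (3 * y)) => u; ring.
apply: measurable_funD; last by apply: (aff (3 * y) (3 * y)) => u; ring.
apply: measurable_funD; last by apply: (aff (4 * y) y) => u; ring.
apply: measurable_funB; last by apply: (aff (3 * y) y) => u; ring.
apply: measurable_funB; last by apply: (aff (2 * y) y) => u; ring.
by apply: (aff y y) => u; ring.
Qed.

Lemma measurable_ehll_f : measurable_fun D (@ehll_f R).
Proof.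
pose g u : R :=
  (ln (2 + 1 * u) - ln (1 + 1 * u) + ln (4 + 3 * u) - ln (3 + 3 * u)
    - ln (4 + 1 * u) + ln (3 + 1 * u))
  / ln 2.
have lnaff a b : measurable_fun D (fun u => ln (a + b * u)).
  apply: (measurableT_comp (@measurable_ln R)).
  apply: measurable_funD; first exact: measurable_cst.
  by apply: measurable_funM; [exact: measurable_cst|exact: measurable_id].
apply: (@eq_measurable_fun _ _ _ _ D g).
  by move=> u; rewrite inE /= in_itv /= andbT => u0; rewrite /g ehll_fE // !mul1r.
apply: measurable_funM; last exact: measurable_cst.
do ![apply: measurable_funB|apply: measurable_funD]; exact: lnaff.
Qed.

Lemma measurable_majorant m : measurable_fun D (@majorant R m).
Proof. by apply: measurable_fun_derivable => u; exact: derivable_majorant. Qed.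

End transform_bounds.

Section transform_integral.
Context {R : realType}.
Implicit Types (a b c e u v x y t : R) (i j n k m : nat) (f F : R -> R).
Local Notation mu := (@lebesgue_measure R).
Local Notation D := (`[0%R, +oo[%classic : set R).

Lemma ge0_le_integral_affine (g h B : R -> R) (p q : R) (I : R) : 0 <= p -> 0 < q ->
  measurable_fun D g -> measurable_fun D h -> measurable_fun D B ->
  (forall u, 0 <= u -> [/\ 0 <= g u, 0 <= h u & 0 <= B u]) ->
  (forall u, 0 <= u -> g u <= h u + B u + p * expR (- (q * u))) ->
  (\int[mu]_(u in D) (B u)%:E = I%:E)%E ->
  (\int[mu]_(u in D) (g u)%:E <= \int[mu]_(u in D) (h u)%:E + (I + p / q)%:E)%E.
Proof.
move=> p0 q0 mg mh mB nn le BI.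
have Dge u : D u -> 0 <= u by rewrite /= in_itv /= andbT.
have mE : measurable_fun D (fun u => expR (- (q * u))).
  rewrite (_ : (fun u => _) = (fun u => expR (- (0 + q * u)))); last first.
    by apply/funext => u; rewrite add0r.
  exact: measurable_expR_affine.
have -> : ((I + p / q)%:E = \int[mu]_(u in D) (B u)%:E
    + \int[mu]_(u in D) (p%:E * (expR (- (q * u)))%:E))%E.
  rewrite ge0_integralZl_EFin //.
  - by rewrite integral_expRN // BI -EFinM -EFinD.
  - exact/measurable_EFinP.
rewrite -ge0_integralD //; first last.
- by apply/measurable_EFinP; apply: measurable_funM => //.
- by move=> u _; rewrite lee_fin mulr_ge0 ?expR_ge0.
- exact/measurable_EFinP.
- by move=> u /Dge/nn[].
rewrite -ge0_integralD //; first last.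
- apply/measurable_EFinP; apply: measurable_funD => //.
  by apply: measurable_funM => //.
- move=> u /Dge/nn[_ _ B0]; rewrite -EFinD lee_fin addr_ge0 // mulr_ge0 ?expR_ge0 //.
- exact/measurable_EFinP.
- by move=> u /Dge/nn[].
apply: ge0_le_integral => //.
- by move=> u /Dge/nn[].
- exact/measurable_EFinP.
- apply/measurable_EFinP; apply: measurable_funD => //; apply: measurable_funD => //.
  by apply: measurable_funM => //.
- by move=> u /Dge u0; rewrite lee_fin addrA; exact: le.
Qed.

Lemma ehll_f_le1 u : 0 <= u -> ehll_f u <= 1.
Proof.
move=> u0; have := ehll_f_wbound_le u0; have /andP[_ d1] := decay_itv u0.
have := mulr_ge0 (@eta_ge0 R) (wbound_ge0 u0); rewrite -/(decay u); lra.
Qed.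

Lemma transform_upper m x n : (2 <= m)%N -> 0 < x ->
  (\int[mu]_(u in D) ((transform x n u) ^+ m)%:E <=
   \int[mu]_(u in D) ((ehll_f u) ^+ m)%:E
   + (84 / 10 ^+ 6 / m%:R + 4 * m%:R * 3 ^+ m * expR (- (x / 2)) / x)%:E)%E.
Proof.
move=> m2 x0; have [I IE Imaj] := @integral_majorant R m m2.
have -> : 4 * m%:R * 3 ^+ m * expR (- (x / 2)) / x =
    (2 * m%:R * 3 ^+ m * expR (- (x / 2))) / (x / 2).
  by field; rewrite gt_eqF.
apply: (@le_trans _ _ (\int[mu]_(u in D) ((ehll_f u) ^+ m)%:E + (I +
    (2 * m%:R * 3 ^+ m * expR (- (x / 2))) / (x / 2))%:E)%E); last first.
  by rewrite leeD2l // lee_fin lerD2r.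
have p0 : 0 <= 2 * m%:R * 3 ^+ m * expR (- (x / 2)).
  by rewrite !mulr_ge0 ?exprn_ge0 ?expR_ge0.
have q0 : 0 < x / 2 by rewrite divr_gt0.
apply: (@ge0_le_integral_affine _ _ (majorant m) _ _ _ p0 q0) => //.
- by apply: measurable_funX; exact: measurable_transform.
- by apply: measurable_funX; exact: measurable_ehll_f.
- exact: measurable_majorant.
- move=> u u0; have /andP[f0 _] := ehll_f_ge0_le u0; split.
  + by rewrite exprn_ge0 // transform_ge0 // ltW.
  + by rewrite exprn_ge0.
  + exact: majorant_ge0.
move=> u u0.
have /andP[f0 _] := ehll_f_ge0_le u0.
have w0 := mulr_ge0 (@eta_ge0 R) (wbound_ge0 u0).
have /andP[d0 d1] := decay_itv u0.
have /andP[b0 b1] := boundary_itv (ltW x0) u0.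
set ex := expR (- (x / 2 * u)) in b1 *.
set eh := expR (- (x / 2)) in b1 *.
have ex01 : 0 <= ex <= 1.
  by rewrite /ex expR_ge0 -expR0 ler_expR oppr_le0 mulr_ge0 // ltW // divr_gt0.
have eh01 : 0 <= eh <= 1.
  by rewrite /eh expR_ge0 -expR0 ler_expR oppr_le0 ltW // divr_gt0.
have g1 := ehll_f_wbound_le u0.
have y0 : 0 < x / 4 by rewrite divr_gt0.
have hw := wsum_hker_upper n y0 u0.
have h3 := eta_wbound_le_majorant m2 u0.
move: w0 g1 hw h3; rewrite -/(decay u); set w := eta * wbound u => w0 g1 hw h3.
case: m m2 IE Imaj p0 h3 => [|m] // _ _ _ _ h3.
have s0 := transform_ge0 n (ltW x0) u0.
have sle : transform x n u <= ehll_f u + w + boundary x u by rewrite /transform addrC lerD2r.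
have b2 : boundary x u <= 2.
  apply: (le_trans b1); case/andP: ex01 => ? ?; case/andP: eh01 => ? ?; nra.
have g0 : 0 <= ehll_f u + w by rewrite addr_ge0.
(* The first two terms are at most [decay u <= 1]; this is the base of the factor [3 ^+ m] in the
   error. *)
have t3 : ehll_f u + w + boundary x u <= 3 by lra.
apply: (@le_trans _ _ ((ehll_f u + w + boundary x u) ^+ m.+1)).
  by rewrite lerXn2r // nnegrE // addr_ge0.
have k1 : ehll_f u + w <= ehll_f u + w + boundary x u by rewrite lerDl.
have := ler_subX m g0 k1.
rewrite [ehll_f u + w + boundary x u - (ehll_f u + w)](_ : _ = boundary x u) => [h1|]; last by ring.
have k2 : ehll_f u <= ehll_f u + w by rewrite lerDl.
have := ler_subX m f0 k2.
rewrite [ehll_f u + w - ehll_f u](_ : _ = w) => [h2|]; last by ring.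
have h4 : m.+1%:R * boundary x u * (ehll_f u + w + boundary x u) ^+ m <=
    m.+1%:R * (2 * (eh * ex)) * 3 ^+ m.+1.
  apply: ler_pM.
  - by rewrite mulr_ge0.
  - by rewrite exprn_ge0 // addr_ge0.
  - by rewrite ler_wpM2l.
  apply: (@le_trans _ _ (3 ^+ m)); first by rewrite lerXn2r // nnegrE // addr_ge0.
  by rewrite ler_weXn2l //; lra.
have e3 : 2 * m.+1%:R * 3 ^+ m.+1 * eh * ex = m.+1%:R * (2 * (eh * ex)) * 3 ^+ m.+1 by ring.
rewrite e3; move: h1 h2 h3 h4 => /=; set A := _ * _ * 3 ^+ _.
move: (_ ^+ m.+1) (_ ^+ m.+1) (_ ^+ m.+1) => p1 p2 p3; lra.
Qed.

End transform_integral.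

Section transform_lower_bound.
Context {R : realType}.
Implicit Types (a b c e u v x y t : R) (i j n k m : nat) (f F : R -> R).
Local Notation mu := (@lebesgue_measure R).
Local Notation D := (`[0%R, +oo[%classic : set R).

Lemma transform_nondecreasing x u : 0 <= x -> 0 <= u ->
  nondecreasing_seq (fun n => transform x n u).
Proof.
move=> x0 u0 n k nk; rewrite /transform lerD2l.
by apply: wsum_hker_nondecreasing => //; rewrite divr_ge0.
Qed.

Lemma transform_cvg x u : 0 < x -> 0 <= u -> cvgn (fun n => transform x n u).
Proof.
move=> x0 u0; apply: nondecreasing_is_cvgn.
  by apply: transform_nondecreasing => //; exact: ltW.
exists (ehll_f u + eta * wbound u + boundary x u) => _ [n _ <-].
by rewrite /transform addrC lerD2r wsum_hker_upper // divr_gt0.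
Qed.

Lemma transform_lim_ge x u : 128 <= x -> 0 <= u ->
  ehll_f u - eta * wbound u - 3 * (expR (- (x / 2)) * expR (- (x / 8 * u)))
  <= limn (fun n => transform x n u).
Proof.
move=> x128 u0; have x0 : 0 < x by lra.
rewrite lerBlDr; apply/ler_addgt0Pr => e e0.
have y32 : 32 <= x / 4 by lra.
have [n0 hn] := wsum_hker_lower y32 u0 e0.
have := hn n0 (leqnn _); rewrite ler_norml => /andP[+ _].
have -> : - (2 * ((1 + u / 4) * (x / 4))) = - (x / 2) + - (x / 8 * u) by field.
rewrite expRD => h.
have := nondecreasing_cvgn_le (transform_nondecreasing (ltW x0) u0) (transform_cvg x0 u0) n0.
rewrite {1}/transform => h2.
have /andP[b0 _] := boundary_itv (ltW x0) u0.
by lra.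
Qed.

(** The number of terms required by [wsum_hker_lower] depends on [u]. The comparison is therefore
    made with the increasing limit [s] in [n], whose integral is bounded by [A] through monotone
    convergence; 128 is 32 times the 4 of [x / 4]. *)
Lemma transform_lower m x A : (2 <= m)%N -> 128 <= x ->
  (forall n, (\int[mu]_(u in D) ((transform x n u) ^+ m)%:E <= A)%E) ->
  (\int[mu]_(u in D) ((ehll_f u) ^+ m)%:E <=
    A + (84 / 10 ^+ 6 / m%:R + 24 * m%:R * expR (- (x / 2)) / x)%:E)%E.
Proof.
move=> m2 x128 hA; have x0 : 0 < x by lra.
have Dge u : D u -> 0 <= u by rewrite /= in_itv /= andbT.
have [I IE Imaj] := @integral_majorant R m m2.
pose s u := limn (fun n => transform x n u).
have cvs u : 0 <= u -> (fun n => transform x n u) @ \oo --> s u.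
  by move=> u0; exact: transform_cvg.
have s0 u : 0 <= u -> 0 <= s u.
  move=> u0; apply: limr_ge; first exact: transform_cvg.
  by apply: nearW => n; apply: transform_ge0 => //; exact: ltW.
have ms : measurable_fun D s.
  apply: (@measurable_fun_cvg _ _ _ D (fun n u => transform x n u)).
    by move=> n; exact: measurable_transform.
  by move=> u /Dge; exact: cvs.
have sA : (\int[mu]_(u in D) ((s u) ^+ m)%:E <= A)%E.
  have -> : (\int[mu]_(u in D) ((s u) ^+ m)%:E =
      \int[mu]_(u in D) limn (fun n => ((transform x n u) ^+ m)%:E))%E.
    apply: eq_integral => u; rewrite inE => /Dge u0; apply/esym/cvg_lim => //.
    apply: cvg_EFin; first by apply: nearW.
    rewrite (_ : _ \o _ = (fun n => transform x n u ^+ m)) //.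
    apply: (@continuous_cvg _ _ _ _ _ (fun n => transform x n u) (fun y : R => y ^+ m));
      last exact: cvs.
    exact: exprn_continuous.
  rewrite monotone_convergence //.
  - apply: lime_le; last by apply: nearW.
    apply: ereal_nondecreasing_is_cvgn => n k nk; apply: ge0_le_integral => //.
    + by move=> u /Dge u0; rewrite lee_fin exprn_ge0 // transform_ge0 // ltW.
    + by apply/measurable_EFinP; apply: measurable_funX; exact: measurable_transform.
    + by apply/measurable_EFinP; apply: measurable_funX; exact: measurable_transform.
    + move=> u /Dge u0; rewrite lee_fin lerXn2r ?nnegrE ?transform_ge0 ?(ltW x0) //.
      by apply: transform_nondecreasing => //; exact: ltW.
  - by move=> n; apply/measurable_EFinP; apply: measurable_funX; exact: measurable_transform.
  - by move=> n u /Dge u0; rewrite lee_fin exprn_ge0 // transform_ge0 // ltW.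
  - move=> u /Dge u0 n k nk; rewrite lee_fin lerXn2r ?nnegrE ?transform_ge0 ?(ltW x0) //.
    by apply: transform_nondecreasing => //; exact: ltW.
have -> : 24 * m%:R * expR (- (x / 2)) / x = (3 * m%:R * expR (- (x / 2))) / (x / 8).
  by field; rewrite gt_eqF.
have p0 : 0 <= 3 * m%:R * expR (- (x / 2)) by rewrite !mulr_ge0 ?expR_ge0.
have q0 : 0 < x / 8 by rewrite divr_gt0.
apply: (@le_trans _ _ (\int[mu]_(u in D) ((s u) ^+ m)%:E + (I +
    (3 * m%:R * expR (- (x / 2))) / (x / 8))%:E)%E); last first.
  by apply: leeD => //; rewrite lee_fin lerD2r.
apply: (@ge0_le_integral_affine _ _ _ (majorant m) _ _ _ p0 q0) => //.
- by apply: measurable_funX; exact: measurable_ehll_f.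
- by apply: measurable_funX.
- exact: measurable_majorant.
- move=> u u0; have /andP[f0 _] := ehll_f_ge0_le u0; split.
  + by rewrite exprn_ge0.
  + by rewrite exprn_ge0 // s0.
  + exact: majorant_ge0.
move=> u u0.
have /andP[f0 _] := ehll_f_ge0_le u0.
have f1 := ehll_f_le1 u0.
have w0 := mulr_ge0 (@eta_ge0 R) (wbound_ge0 u0).
have h3 := eta_wbound_le_majorant m2 u0.
have sl := transform_lim_ge x128 u0.
have maj0 := majorant_ge0 m u0.
have ex0 := expR_ge0 (- (x / 8 * u)).
have := s0 u u0; rewrite -/(s u) in sl.
move: w0 h3 sl; set w := eta * wbound u => w0 h3 sl su0.
have E0 := mulr_ge0 p0 ex0.
case: m m2 IE Imaj p0 h3 maj0 E0 {hA sA} => [|m] // _ _ _ _ h3 maj0 E0.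
(* Only the points where the limit falls below [ehll_f] need the error bound. *)
have [fs|sf] := leP (ehll_f u) (s u).
  rewrite -addrA; apply: (@le_trans _ _ (s u ^+ m.+1)); last by rewrite lerDl addr_ge0.
  by rewrite lerXn2r // nnegrE.
have := ler_subX m su0 (ltW sf) => h1.
have fm1 : ehll_f u ^+ m <= 1 by rewrite exprn_ile1.
have fm2 : ehll_f u ^+ m <= (ehll_f u + w) ^+ m.
  have k2 : ehll_f u <= ehll_f u + w by rewrite lerDl.
  by rewrite lerXn2r // nnegrE // addr_ge0.
have fm0 : 0 <= ehll_f u ^+ m by rewrite exprn_ge0.
set ee := expR (- (x / 2)) * expR (- (x / 8 * u)) in sl.
have ee0 : 0 <= ee by rewrite mulr_ge0 ?expR_ge0.
have h4 : m.+1%:R * (ehll_f u - s u) * ehll_f u ^+ m <=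
    m.+1%:R * (w + 3 * ee) * ehll_f u ^+ m.
  by rewrite ler_wpM2r // ler_wpM2l //; lra.
have h5 : m.+1%:R * w * ehll_f u ^+ m <= m.+1%:R * w * (ehll_f u + w) ^+ m.
  by rewrite ler_wpM2l // mulr_ge0.
have h6 : m.+1%:R * (3 * ee) * ehll_f u ^+ m <= m.+1%:R * (3 * ee).
  by rewrite ler_piMr // !mulr_ge0.
have e3 : 3 * m.+1%:R * expR (- (x / 2)) * expR (- (x / 8 * u)) = m.+1%:R * (3 * ee).
  by rewrite /ee; ring.
have h7 : m.+1%:R * (w + 3 * ee) * ehll_f u ^+ m =
  m.+1%:R * w * ehll_f u ^+ m + m.+1%:R * (3 * ee) * ehll_f u ^+ m by ring.
rewrite e3 -subr_le0; move: h1 h3 h4 h5 h6 h7 => /=.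
set a1 := m.+1%:R * (w + 3 * ee) * _; set a2 := _ * (ehll_f u - s u) * _.
set a3 := m.+1%:R * w * ehll_f u ^+ m; set a4 := m.+1%:R * w * _.
set a5 := m.+1%:R * (3 * ee) * _; set a6 := m.+1%:R * (3 * ee).
move: (ehll_f u ^+ m.+1) (s u ^+ m.+1) => p1 p2; lra.
Qed.

End transform_lower_bound.

(** * Cell states and the expectation for a fixed number of elements *)

Section sketch_state.
Context {R : realType} {Omega : Type}.
Variables (cell rho : nat -> Omega -> nat).
Implicit Types (w : Omega) (i j k n m : nat) (b : bool).

Definition cell_all n j (W : pred nat) w : bool :=
  [forall i : 'I_n, (cell i w == j) ==> W (rho i w)].

Lemma cell_allP n j (W : pred nat) w :
  reflect (forall i, (i < n)%N -> cell i w = j -> W (rho i w)) (cell_all n j W w).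
Proof.
apply: (iffP forallP) => [h i ni ci|h i].
  by have := h (Ordinal ni); rewrite /= ci eqxx.
by apply/implyP => /eqP; exact: h.
Qed.

Lemma ehll_C1_leE n j k w : (ehll_C1 cell rho n j w <= k)%N = cell_all n j (leq^~ k) w.
Proof.
apply/idP/cell_allP => [|h].
  by move/bigmax_leqP => h i ni ci; apply: (h (Ordinal ni)); rewrite /= ci eqxx.
by apply/bigmax_leqP => i /eqP; exact: h.
Qed.

Lemma ehll_C1_ge n j w i : (i < n)%N -> cell i w = j ->
  (rho i w <= ehll_C1 cell rho n j w)%N.
Proof.
move=> ni ci; move: (leqnn (ehll_C1 cell rho n j w)).
by rewrite ehll_C1_leE => /cell_allP; apply.
Qed.

Lemma ehll_C1_attained n j w : (0 < ehll_C1 cell rho n j w)%N ->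
  exists i, [/\ (i < n)%N, cell i w = j & rho i w = ehll_C1 cell rho n j w].
Proof.
move=> C0; have : ~~ (ehll_C1 cell rho n j w <= (ehll_C1 cell rho n j w).-1)%N by lia.
rewrite ehll_C1_leE negb_forall => /existsP[i]; rewrite negb_imply => /andP[/eqP ci h].
exists i; split=> //; have := ehll_C1_ge (ltn_ord i) ci; lia.
Qed.

Lemma ehll_C2P n j w : reflect
  (ehll_C1 cell rho n j w <= 1 \/
   exists i, [/\ (i < n)%N, cell i w = j & rho i w = (ehll_C1 cell rho n j w - 1)%N])%N
  (ehll_C2 cell rho n j w).
Proof.
apply: (iffP orP) => -[h|h]; [by left|right|by left|right].
  by move/existsP: h => [i /andP[/eqP ci /eqP ri]]; exists i; split.
by case: h => i [ni ci ri]; apply/existsP; exists (Ordinal ni); rewrite /= ci ri !eqxx.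
Qed.

(* The tests [weight_test k i], [i < 4], are the conditions on the value of an
   element whose conjunction over a cell has inclusion-exclusion coefficients
   [weight_coef (k, b)] in the event [C1 = k /\ C2 = b]; the probability of
   failing test [i] is [(i + 1) / 2 ^ k]. *)
Definition weight_test k i : pred nat := fun r =>
  match i with
  | 0 => (r <= k)%N
  | 1 => (r < k)%N
  | 2 => (r <= k)%N && (r != k.-1)
  | _ => (r.+1 < k)%N
  end.

Definition weight_coef (s : nat * bool) i : R :=
  match s.1, s.2, i with
  | 0, true, 0 => 1
  | 1, true, 0 => 1
  | 1, true, 1 => -1
  | k.+2, false, 2 => 1
  | k.+2, false, 3 => -1
  | k.+2, true, 0 => 1
  | k.+2, true, 1 => -1
  | k.+2, true, 2 => -1
  | k.+2, true, 3 => 1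
  | _, _, _ => 0
  end.

Definition cell_state n j w := (ehll_C1 cell rho n j w, ehll_C2 cell rho n j w).

(** For [k >= 2], [C1 = k] with [C2 = 0] means that test 2 holds and test 3 fails, test 3 implying
    test 2. Removing this from [C1 = k], which is test 0 minus test 1, leaves the case [C2 = 1]. *)
Lemma cell_state_indicator n j w (s : nat * bool) :
  (cell_state n j w == s)%:R =
  \sum_(i < 4) weight_coef s i * (cell_all n j (weight_test s.1 i) w)%:R.
Proof.
rewrite !big_ord_recr big_ord0 /= add0r.
set C1 := ehll_C1 cell rho n j w; set C2 := ehll_C2 cell rho n j w.
case: s => k b; rewrite /cell_state -/C1 -/C2 xpair_eqE /=.
have a0 : cell_all n j (weight_test k 0) w = (C1 <= k)%N by rewrite /C1 ehll_C1_leE.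
have a1 : (0 < k)%N -> cell_all n j (weight_test k 1) w = (C1 < k)%N.
  by case: (k) => // k' _; rewrite ltnS /C1 ehll_C1_leE.
have a3 : (1 < k)%N -> cell_all n j (weight_test k 3) w = (C1.+1 < k)%N.
  by case: (k) => [|[|k']] // _; rewrite !ltnS /C1 ehll_C1_leE.
have a2 : (1 < k)%N -> cell_all n j (weight_test k 2) w =
    (C1.+1 < k)%N || ((C1 == k) && ~~ C2).
  move=> k1; apply/idP/idP.
    move=> /cell_allP h; have Ck : (C1 <= k)%N.
      by rewrite /C1 ehll_C1_leE; apply/cell_allP => i ni ci; case/andP: (h i ni ci).
    case: (ltnP C1.+1 k) => //= kC.
    (* The maximum is then attained by an element that passes test 2, so it is not [k - 1], and only
       [C1 = k] remains. *)
    have C0 : (0 < C1)%N by lia.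
    have [i [ni ci ri]] := ehll_C1_attained C0.
    have := h i ni ci; rewrite /weight_test ri -/C1 => /andP[_ Ck1].
    have e : C1 = k by lia.
    rewrite e eqxx /=; apply/negP => /ehll_C2P[|[i' [ni' ci' ri']]]; first by rewrite -/C1; lia.
    by have := h i' ni' ci'; rewrite /weight_test ri' -/C1 e subn1 eqxx andbF.
  case/orP => [h|/andP[/eqP e nC2]]; apply/cell_allP => i ni ci.
    have := ehll_C1_ge ni ci; rewrite /weight_test -/C1; lia.
  have := ehll_C1_ge ni ci; rewrite /weight_test -/C1 e => -> /=.
  apply/eqP => ri; move/negP: nC2; apply; apply/ehll_C2P; right.
  by exists i; split; rewrite // -/C1 e ri subn1.
have C2le : (C1 <= 1)%N -> C2 by move=> h; apply/ehll_C2P; left.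
case: k a0 a1 a2 a3 => [|[|k]] a0 a1 a2 a3; rewrite a0 /weight_coef /=.
- rewrite !if_same !mul0r !addr0; case: b => /=; rewrite ?mul0r ?mul1r.
    by rewrite leqn0; case: eqP => //= e; rewrite C2le // e.
  by case: eqP => //= e; rewrite C2le // e.
- rewrite a1 // !if_same !mul0r !addr0; case: b => /=; rewrite ?mul0r ?addr0 ?mul1r.
    case: (ltngtP C1 1) => h /=; rewrite ?mulN1r ?subrr ?mulr0 ?addr0 //.
    by rewrite C2le ?h // subr0.
  by case: eqP => //= e; rewrite C2le // e.
rewrite a1 // a2 // a3 //.
have h1 : (C1.+1 < k.+2)%N -> (C1 < k.+2)%N by lia.
have h2 : (C1.+1 < k.+2)%N -> (C1 == k.+2) = false by lia.
have h3 : (C1 <= k.+2)%N = (C1 == k.+2) || (C1 < k.+2)%N by lia.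
have h4 : (C1 == k.+2) -> (C1 < k.+2)%N = false by lia.
rewrite h3; move: h1 h2 h4.
case: (C1.+1 < k.+2)%N (C1 < k.+2)%N (C1 == k.+2) => -[] [] h1 h2 h4;
  try (by have := h1 isT); try (by have := h2 isT); try (by have := h4 isT);
  by case: b; case: C2 {a0 a1 a2 a3 C2le} => /=; ring.
Qed.

Definition state_value (s : nat * bool) : R :=
  2 ^ (- s.1%:Z) + (1 - s.2%:R) * 2 ^ (- s.1%:Z + 1).

Lemma state_valueE s : state_value s = (1 + 2 * (1 - s.2%:R)) / 2 ^+ s.1.
Proof.
by case: s => k b; rewrite /state_value /= expfzDr // expr1z -exprnN; ring.
Qed.

Lemma state_value_gt0 s : 0 < state_value s.
Proof.
rewrite state_valueE divr_gt0 ?exprn_gt0 //; case: s.2 => /=; lra.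
Qed.

Lemma ehll_YE m n w :
  ehll_Y cell rho R m n w = (\sum_(j < m) state_value (cell_state n j w))^-1.
Proof. by []. Qed.

(** If [C1] stays, [C2] can only become 1. If [C1] grows by one, the previous maximum sets [C2] to 1
    (an empty cell reaching 1 has it by convention). If it grows by two or more, even the weight 3
    is compensated: [3 / 2 ^ (C + 2) < 1 / 2 ^ C]. *)
Lemma cell_state_nonincreasing n j w :
  state_value (cell_state n.+1 j w) <= state_value (cell_state n j w).
Proof.
have p0 k : 0 < 2 ^+ k :> R by rewrite exprn_gt0.
set C := ehll_C1 cell rho n j w; set C' := ehll_C1 cell rho n.+1 j w.
have CC' : (C <= C')%N.
  by rewrite /C ehll_C1_leE; apply/cell_allP => i ni ci; apply: ehll_C1_ge => //; exact: ltnW.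
rewrite !state_valueE /cell_state /= -/C -/C'.
case: (ltngtP C C') CC' => // [CC' _|e _]; last first.
  have : ehll_C2 cell rho n j w ==> ehll_C2 cell rho n.+1 j w.
    apply/implyP => /ehll_C2P[h|[i [ni ci ri]]]; apply/ehll_C2P.
      by left; rewrite -/C' -e.
    by right; exists i; split => //; [exact: ltnW|rewrite ri -/C -/C' e].
  rewrite e ler_pM2r ?invr_gt0 //.
  by case: (ehll_C2 _ _ n j w); case: (ehll_C2 _ _ n.+1 j w) => //= _; lra.
have attn : (0 < C')%N by lia.
have [i [ni ci ri]] := ehll_C1_attained attn.
apply: (@le_trans _ _ (1 / 2 ^+ C)); last first.
  by rewrite ler_pM2r ?invr_gt0 //; case: (ehll_C2 _ _ n j w) => /=; lra.
rewrite ler_pdivrMr // mulrAC ler_pdivlMr //.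
have [CC2|CC2] := leqP C.+2 C'.
  have := ler_weXn2l (ler1n R 2) CC2; rewrite !exprS.
  by case: (ehll_C2 _ _ n.+1 j w) => /=; have := p0 C; lra.
have eC : C' = C.+1 by lia.
have -> : ehll_C2 cell rho n.+1 j w.
  apply/ehll_C2P; rewrite -/C' eC.
  have [C0|C0] := posnP C; first by left; rewrite C0.
  right; have [i' [ni' ci' ri']] := ehll_C1_attained C0.
  by exists i'; split => //; [exact: ltnW|rewrite ri' subn1].
by rewrite eC exprS /=; have := p0 C; lra.
Qed.

Lemma ehll_Y_nondecreasing m n w : (0 < m)%N ->
  ehll_Y cell rho R m n w <= ehll_Y cell rho R m n.+1 w.
Proof.
have sum_gt0 n' : (0 < m)%N -> 0 < \sum_(j < m) state_value (cell_state n' j w).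
  case: m => // m' _; rewrite big_ord_recl ltr_pwDl ?state_value_gt0 //.
  by apply: sumr_ge0 => j _; rewrite ltW // state_value_gt0.
move=> m0; rewrite !ehll_YE lef_pV2 ?posrE ?sum_gt0 //.
by apply: ler_sum => j _; exact: cell_state_nonincreasing.
Qed.

Lemma ehll_Y_gt0 m n w : (0 < m)%N -> 0 < ehll_Y cell rho R m n w.
Proof.
case: m => // m _; rewrite ehll_YE invr_gt0 big_ord_recl ltr_pwDl ?state_value_gt0 //.
by apply: sumr_ge0 => j _; rewrite ltW // state_value_gt0.
Qed.

End sketch_state.

(** * Measurability through finite prefixes *)

Section discrete.
Context d (Omega : measurableType d) (cell rho : nat -> Omega -> nat).
Hypothesis mcell : forall i, measurable_fun setT (cell i).
Hypothesis mrho : forall i, measurable_fun setT (rho i).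

(** A word in a countable set: any function of it is measurable, with no examination of maxima or
    existential conditions. *)
Definition stream_prefix n (w : Omega) : seq (nat * nat) := mkseq (fun i => (cell i w, rho i w)) n.

Lemma measurable_prefix_eq n (v : seq (nat * nat)) : measurable [set w | stream_prefix n w = v].
Proof.
have [sv|sv] := eqVneq (size v) n; last first.
  rewrite (_ : mkset _ = set0) //; apply/seteqP; split=> // w /= e.
  by move: sv; rewrite -e size_mkseq eqxx.
rewrite (_ : mkset _ = \bigcap_(i < n) ((cell i @^-1` [set (nth (0, 0)%N v i).1])
    `&` (rho i @^-1` [set (nth (0, 0)%N v i).2]))).
  apply: bigcap_measurableType => i _; apply: measurableI.
    by rewrite -[X in measurable X]setTI; exact: mcell.
  by rewrite -[X in measurable X]setTI; exact: mrho.
apply/seteqP; split => w /=.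
  by move=> <- i /= ni; rewrite nth_mkseq.
move=> h; apply: (@eq_from_nth _ (0, 0)%N); first by rewrite size_mkseq.
move=> i; rewrite size_mkseq => ni; rewrite nth_mkseq //.
by have [/= -> ->] := h i ni; case: (nth _ v i).
Qed.

Lemma measurable_prefix n (A : set (seq (nat * nat))) : measurable [set w | A (stream_prefix n w)].
Proof.
rewrite (_ : mkset _ = \bigcup_(v : seq (nat * nat))
    (if `[< A v >] then [set w | stream_prefix n w = v] else set0)).
  apply: countable_bigcupT_measurable; first exact: countableP.
  by move=> v; case: asboolP => _ //; exact: measurable_prefix_eq.
apply/seteqP; split => w /=.
  by move=> Aw; exists (stream_prefix n w) => //; rewrite asboolT.
by move=> [v _]; case: asboolP => // Av /= ->.
Qed.

Lemma measurable_fun_prefix d' (T : measurableType d') n (F : seq (nat * nat) -> T) :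
  measurable_fun setT (fun w => F (stream_prefix n w)).
Proof. by move=> _ B _; rewrite setTI; exact: (measurable_prefix n (F @^-1` B)). Qed.

End discrete.

(** * Law of one element and independence *)

Section element_law.
Context (R : realType) d (Omega : measurableType d) (P : probability Omega R).

Lemma integral_indic_combination (I : finType) (a : I -> R) (B : I -> set Omega) :
  (forall i, measurable (B i)) ->
  (\int[P]_w (\sum_i a i * \1_(B i) w)%:E = (\sum_i a i * fine (P (B i)))%:E)%E.
Proof.
move=> mB.
under eq_integral do rewrite -sumEFin.
rewrite integral_sum //; last first.
  move=> i; under eq_fun do rewrite EFinM.
  by apply: integrableZl => //; apply: integrable_indic => //; rewrite ltey_eq fin_num_measure.
rewrite -sumEFin; apply: eq_bigr => i _.
under eq_integral do rewrite EFinM.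
rewrite integralZl //; last by apply: integrable_indic => //; rewrite ltey_eq fin_num_measure.
by rewrite integral_indic // setIT EFinM fineK // fin_num_measure.
Qed.

Variables (m : nat) (cell rho : nat -> {RV P >-> nat}).
Hypothesis m0 : (0 < m)%N.
Hypothesis model : ehll_model m cell rho.

Lemma measurable_cell_eq i (A : set nat) : measurable (cell i @^-1` A).
Proof. by rewrite -[X in measurable X]setTI; exact: measurable_funP. Qed.

Lemma measurable_rho_in i (A : set nat) : measurable (rho i @^-1` A).
Proof. by rewrite -[X in measurable X]setTI; exact: measurable_funP. Qed.

Lemma elements_independent n (c : nat -> nat) (A : nat -> set nat) :
  P [set w | forall i, (i < n)%N -> cell i w = c i /\ A i (rho i w)] =
  (\prod_(i < n) (P (cell i @^-1` [set c i]) * P (rho i @^-1` A i)))%E.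
Proof.
have [_ _ indep] := model.
pose s : seq (nat + nat) := [seq inl i | i <- iota 0 n] ++ [seq inr i | i <- iota 0 n].
pose J : {fset (nat + nat)} := [fset x in s]%fset.
pose ev (x : nat + nat) := match x with
  | inl i => cell i @^-1` [set c i] | inr i => rho i @^-1` A i end.
have us : uniq s.
  rewrite cat_uniq !map_inj_uniq ?iota_uniq /= ?andbT; [|by move=> ? ? []..].
  by apply/hasPn => x /mapP[i _ ->]; apply/negP => /mapP[].
have := indep J ev; rewrite (_ : \bigcap_(i in _) _ =
    [set w | forall i, (i < n)%N -> cell i w = c i /\ A i (rho i w)]); last first.
  apply/seteqP; split => w /= h.
    move=> i ni; split.
      apply: (h (inl i)); rewrite /= in_fset mem_cat map_f // mem_iota //.
    by apply: (h (inr i)); rewrite /= in_fset mem_cat orbC map_f // mem_iota.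
  move=> x; rewrite /= in_fset mem_cat => /orP[] /mapP[i]; rewrite mem_iota /= add0n => ni ->.
    by have [] := h i ni.
  by have [] := h i ni.
move=> ->; last first.
  move=> [i|i] _ /=; rewrite /sigma_rv /preimage_set_system /=.
    by exists [set c i]; rewrite // setTI.
  by exists (A i); rewrite // setTI.
rewrite (perm_big s) /=; last first.
  by apply: uniq_perm => //; [exact: fset_uniq|move=> x; rewrite in_fset].
have i0 : iota 0 n = index_iota 0 n by rewrite /index_iota subn0.
rewrite big_cat /= !big_map big_split /= i0 !big_mkord //.
Qed.

Lemma cell_prob i j : (j < m)%N -> fine (P (cell i @^-1` [set j])) = m%:R^-1.
Proof. by move=> jm; have [h _ _] := model; rewrite h. Qed.

Lemma rho_prob_lt i N (A : pred nat) :
  P (rho i @^-1` [set r | (r < N)%N && A r]) =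
  (\sum_(r < N | A r) P (rho i @^-1` [set (r : nat)]))%E.
Proof.
elim: N => [|N IH].
  rewrite big_ord0 (_ : _ @^-1` _ = set0) ?measure0 //.
  by apply/seteqP; split.
rewrite big_mkcond big_ord_recr -big_mkcond /= -IH.
have [AN|AN] := boolP (A N); last first.
  rewrite adde0; congr (P _); apply/seteqP; split => w /= /andP[h1 h2]; rewrite h2 andbT.
    by move: h1; rewrite ltnS leq_eqVlt => /predU1P[e|//]; move: h2 AN; rewrite e => ->.
  exact: ltnW.
rewrite -measureU //; [|exact: measurable_rho_in|exact: measurable_rho_in|].
  congr (P _); apply/seteqP; split => w /=.
    by rewrite ltnS leq_eqVlt => /andP[/predU1P[e|h1] h2]; [right|left; rewrite h1].
  by move=> [/andP[h1 ->]|->]; rewrite ?AN ?leqnn // andbT ltnS ltnW.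
by apply/seteqP; split => w //= [/andP[h1 _] h2]; rewrite h2 ltnn in h1.
Qed.

Lemma rho_prob_eq i k : P (rho i @^-1` [set k.+1]) = (2 ^- k.+1)%:E.
Proof. by have [_ h _] := model; rewrite h. Qed.

Lemma rho_sum N : (\sum_(r < N) 2 ^- r.+1 = 1 - 2 ^- N :> R).
Proof.
elim: N => [|N IH]; first by rewrite big_ord0 expr0 invr1 subrr.
rewrite big_ord_recr /= IH exprS; have : (2 ^+ N : R) != 0 by rewrite expf_neq0.
by move: (2 ^+ N) => b b0; field.
Qed.

(** The masses [2 ^- k] of the values [k >= 1] already add up to 1. *)
Lemma rho_prob_zero i : P (rho i @^-1` [set 0%N]) = 0%E.
Proof.
apply/eqP; rewrite eq_le measure_ge0 andbT.
apply/lee_addgt0Pr => e e0; rewrite add0e.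
have [N hN] : exists N, 2 ^- N <= e.
  exists (Num.truncn e^-1).+1; rewrite -[leRHS]invrK lef_pV2 ?posrE ?exprn_gt0 ?invr_gt0 //.
  have ei : 0 <= e^-1 by rewrite invr_ge0 ltW.
  have /andP[_ h] := truncn_itv ei; apply: (le_trans (ltW h)).
  by rewrite -natrX ler_nat ltnW // ltn_expl.
have := probability_le1 P (measurable_rho_in i [set r | (r < N.+1)%N && xpredT r]).
rewrite rho_prob_lt big_ord_recl.
under eq_bigr do rewrite lift0 rho_prob_eq.
rewrite sumEFin rho_sum -(fineK (fin_num_measure P _ (measurable_rho_in i [set 0%N]))).
by rewrite -EFinD !lee_fin; lra.
Qed.

Lemma rho_prob_ltE i N (A : pred nat) :
  P (rho i @^-1` [set r | (r < N)%N && A r]) =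
  (\sum_(r < N | A r) (if r == 0%N :> nat then 0 else 2 ^- r))%:E.
Proof.
rewrite rho_prob_lt -sumEFin; apply: eq_bigr => -[[|r] rN] _ /=.
  exact: rho_prob_zero.
exact: rho_prob_eq.
Qed.

Lemma rho_total N : \sum_(r < N.+1) (if r == 0%N :> nat then 0 else 2 ^- r) = 1 - 2 ^- N :> R.
Proof. by rewrite big_ord_recl /= add0r -rho_sum; apply: eq_bigr. Qed.

(** A nonzero coefficient excludes the small values of [s.1] for which the formula fails, for
    instance test 3 at [s.1 = 1], where it would give -1. *)
Lemma weight_test_prob i (s : nat * bool) k : (k < 4)%N -> weight_coef s k != 0 :> R ->
  fine (P (rho i @^-1` [set r | weight_test s.1 k r])) = 1 - k.+1%:R / 2 ^+ s.1.
Proof.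
case: s => K b k4 wn0 /=.
have lt0 N : fine (P (rho i @^-1` [set r | (r < N.+1)%N])) = 1 - 2 ^- N.
  rewrite (_ : mkset _ = [set r | (r < N.+1)%N && xpredT r]); last first.
    by apply/seteqP; split => r /=; rewrite andbT.
  by rewrite rho_prob_ltE /= rho_total.
have p0 N : (2 ^+ N : R) != 0 by rewrite expf_neq0.
case: k k4 wn0 => [|[|[|[|k]]]] // _; rewrite /weight_test.
- by move=> _; rewrite (lt0 K) mul1r.
- case: K => [|K] wn0; first by move: wn0; rewrite /weight_coef /=; case: b; rewrite eqxx.
  by rewrite (lt0 K) exprS; move: (p0 K); move: (2 ^+ K) => u u0; field.
- case: K => [|[|K]] wn0; [by move: wn0; rewrite /weight_coef /=; case: b; rewrite eqxx..|].
  rewrite (_ : mkset _ = [set r | (r < K.+3)%N && (r != K.+1)]) //.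
  rewrite rho_prob_ltE /=.
  have := rho_total K.+2; rewrite (bigID (fun r : 'I_K.+3 => r != K.+1 :> nat)) /=.
  rewrite [X in _ + X](big_pred1 (Ordinal (leqnSn K.+2))) /=; last first.
    by move=> r; rewrite negbK.
  move=> h; move: h; rewrite !exprS; move: (p0 K); move: (2 ^+ K) (\sum_(_ < _ | _) _) => u S u0 h.
  have -> : S = 1 - (2 * (2 * u))^-1 - (2 * u)^-1 by lra.
  by field.
- case: K => [|[|K]] wn0; [by move: wn0; rewrite /weight_coef /=; case: b; rewrite eqxx..|].
  rewrite (_ : mkset _ = [set r | (r < K.+1)%N]) //.
  by rewrite (lt0 K) !exprS; move: (p0 K); move: (2 ^+ K) => u u0; field.
Qed.

End element_law.

(** * Exact mean of the truncated indicator *)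

Section truncated_expectation.
Context (R : realType) d (Omega : measurableType d) (P : probability Omega R).
Variables (m : nat) (cell rho : nat -> {RV P >-> nat}).
Hypothesis m0 : (0 < m)%N.
Hypothesis model : ehll_model m cell rho.

(** The condition [cell i w < m], true only almost surely, makes this event a finite disjoint union
    over the assignments of elements to cells. *)
Definition all_tests n (V : nat -> pred nat) : set Omega :=
  [set w | forall i, (i < n)%N -> (cell i w < m)%N /\ V (cell i w) (rho i w)].

Lemma measurable_forall_lt n (Q : nat -> set Omega) :
  (forall i, measurable (Q i)) -> measurable [set w | forall i, (i < n)%N -> Q i w].
Proof.
move=> mQ; rewrite (_ : mkset _ = \bigcap_(i in [set i | (i < n)%N]) Q i) //.
by apply: bigcap_measurableType => i _; exact: mQ.
Qed.

Lemma measurable_assignment n (c : nat -> nat) (A : nat -> set nat) :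
  measurable [set w | forall i, (i < n)%N -> cell i w = c i /\ A i (rho i w)].
Proof.
apply: (@measurable_forall_lt n (fun i => [set w | cell i w = c i /\ A i (rho i w)])) => i.
rewrite (_ : mkset _ = (cell i @^-1` [set c i]) `&` (rho i @^-1` A i)) //.
by apply: measurableI; [exact: measurable_cell_eq|exact: measurable_rho_in].
Qed.

Lemma measurable_all_tests n V : measurable (all_tests n V).
Proof.
apply: (@measurable_forall_lt n
  (fun i => [set w | (cell i w < m)%N /\ V (cell i w) (rho i w)])) => i.
rewrite (_ : mkset _ = \bigcup_j ((cell i @^-1` [set k | k = j /\ (j < m)%N])
    `&` (rho i @^-1` [set r | V j r]))).
  apply: bigcupT_measurable => j.
  by apply: measurableI; [exact: measurable_cell_eq|exact: measurable_rho_in].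
apply/seteqP; split => w /=.
  by move=> [h1 h2]; exists (cell i w).
by move=> [j _ [/= [-> h1] h2]].
Qed.

Definition ext_assignment n (c : {ffun 'I_n -> 'I_m}) (i : nat) : nat :=
  oapp (fun o => val (c o)) 0%N (insub i).

Lemma all_tests_indic n V w :
  \1_(all_tests n V) w = \sum_(c : {ffun 'I_n -> 'I_m})
    1 * \1_[set w | forall i, (i < n)%N ->
       cell i w = ext_assignment c i /\ V (ext_assignment c i) (rho i w)] w :> R.
Proof.
rewrite !indicE; have [h|h] := pselect (all_tests n V w); last first.
  rewrite memNset // big1 // => c _; rewrite indicE memNset ?mulr0 //.
  move=> /= hc; apply: h => i ni; have [h1 h2] := hc i ni.
  split; last by rewrite h1.
  by rewrite h1 /ext_assignment insubT /=.
rewrite mem_set //.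
pose c0 : {ffun 'I_n -> 'I_m} := [ffun i : 'I_n => Ordinal (proj1 (h (val i) (ltn_ord i)))].
rewrite (bigD1 c0) //= big1 ?addr0.
  rewrite indicE mem_set ?mul1r // => i ni.
  rewrite /ext_assignment insubT /= ffunE /=.
  by have [] := h i ni.
move=> c cc0; rewrite indicE memNset ?mulr0 //= => hc.
move/eqP: cc0; apply; apply/ffunP => i; rewrite ffunE; apply: val_inj => /=.
have [-> _] := hc i (ltn_ord i).
by rewrite /ext_assignment valK.
Qed.

(** Over all assignments, the sum of products of one-element probabilities is the [n]-th power of
    the probability for one element. *)
Lemma all_tests_prob n (V : nat -> pred nat) (q : 'I_m -> R) :
  (forall i (j : 'I_m), fine (P (rho i @^-1` [set r | V j r])) = q j) ->
  fine (P (all_tests n V)) = (\sum_(j < m) m%:R^-1 * q j) ^+ n.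
Proof.
move=> hq.
have : (\int[P]_w (\1_(all_tests n V) w)%:E = P (all_tests n V))%E.
  by rewrite integral_indic ?setIT //; exact: measurable_all_tests.
under eq_integral do rewrite all_tests_indic.
rewrite (@integral_indic_combination _ _ _ P {ffun 'I_n -> 'I_m} (fun=> 1)
  (fun c => [set w | forall i, (i < n)%N ->
       cell i w = ext_assignment c i /\ V (ext_assignment c i) (rho i w)])); last first.
  by move=> c; exact: (@measurable_assignment n _ (fun i => [set r | V (ext_assignment c i) r])).
move=> <- /=; rewrite -[n in RHS]card_ord -prodr_const bigA_distr_bigA /=.
apply: eq_bigr => c _; rewrite mul1r
  (elements_independent model n _ (fun i => [set r | V (ext_assignment c i) r])).
rewrite (eq_bigr (fun i : 'I_n => (m%:R^-1 * q (c i))%:E)) => [|i _].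
  by rewrite prodEFin.
rewrite /ext_assignment valK /= -(hq i) -(cell_prob model i (ltn_ord (c i))) EFinM !fineK //.
  by rewrite fin_num_measure //; exact: measurable_rho_in.
by rewrite fin_num_measure //; exact: measurable_cell_eq.
Qed.

Definition assigned n w := forall i, (i < n)%N -> (cell i w < m)%N.

Definition truncated_Y n K w : R :=
  if `[< assigned n w >] && [forall j : 'I_m, (ehll_C1 cell rho n j w <= K)%N]
  then ehll_Y cell rho R m n w else 0.

Definition cell_states K := {ffun 'I_m -> 'I_K.+1 * bool}.

Definition nat_state K (s : 'I_K.+1 * bool) : nat * bool := (val s.1, s.2).

Definition states_Y K (kap : cell_states K) : R :=
  (\sum_j state_value (nat_state (kap j)))^-1.

Definition states_test K (kap : cell_states K) (l : {ffun 'I_m -> 'I_4}) (c : nat) : pred nat :=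
  oapp (fun j => weight_test (nat_state (kap j)).1 (l j)) xpredT (insub c).

Definition states_coef K (kap : cell_states K) (l : {ffun 'I_m -> 'I_4}) : R :=
  \prod_j weight_coef (nat_state (kap j)) (l j).

Lemma all_tests_prodE n K (kap : cell_states K) l w :
  \1_(all_tests n (states_test kap l)) w = (`[< assigned n w >])%:R *
    \prod_(j < m) (cell_all cell rho n j (weight_test (nat_state (kap j)).1 (l j)) w)%:R :> R.
Proof.
rewrite indicE; case: asboolP => [aw|aw]; last first.
  by rewrite mul0r memNset // => h; apply: aw => i /h [].
rewrite mul1r; have [/forallP h|] := boolP [forall j : 'I_m,
    cell_all cell rho n j (weight_test (nat_state (kap j)).1 (l j)) w].
  rewrite big1 => [|j _]; last by rewrite h.
  rewrite mem_set // => i ni; split; first exact: aw.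
  have /cell_allP hi := h (Ordinal (aw i ni)).
  by rewrite /states_test (insubT (fun c => (c < m)%N) (aw i ni)) /=; exact: hi.
rewrite negb_forall => /existsP[j nj].
rewrite (bigD1 j) //= (negbTE nj) mul0r memNset // => h; move/negP: nj; apply.
apply/cell_allP => i ni ci; have [_] := h i ni.
by rewrite /states_test ci valK.
Qed.

(** First a sum over the joint final states [kap] of the cells, only one of which has a nonzero
    indicator; then the product over cells of [cell_state_indicator] is distributed into the choices
    [l] of one test per cell. *)
Lemma truncated_YE n K w : truncated_Y n K w =
  \sum_(t : cell_states K * {ffun 'I_m -> 'I_4})
    states_Y t.1 * states_coef t.1 t.2 * \1_(all_tests n (states_test t.1 t.2)) w.
Proof.
rewrite -(pair_bigA _ (fun kap l => states_Y kap * states_coef kap l *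
  \1_(all_tests n (states_test kap l)) w)) /=.
have -> : \sum_(kap : cell_states K) \sum_l states_Y kap * states_coef kap l *
     \1_(all_tests n (states_test kap l)) w =
   \sum_(kap : cell_states K) (`[< assigned n w >])%:R * (states_Y kap *
    \prod_(j < m) (cell_state cell rho n j w == nat_state (kap j))%:R).
  apply: eq_bigr => kap _.
  under [in RHS]eq_bigr do rewrite cell_state_indicator.
  rewrite bigA_distr_bigA !big_distrr /=; apply: eq_bigr => l _.
  by rewrite all_tests_prodE big_split /= /states_coef; ring.
rewrite /truncated_Y; case: asboolP => [aw|aw] /=; last first.
  by rewrite big1 // => kap _; rewrite mul0r.
have [/forallP h|] := boolP [forall j : 'I_m, (ehll_C1 cell rho n j w <= K)%N].
  pose k0 : cell_states K := [ffun j : 'I_m =>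
    (inord (ehll_C1 cell rho n j w), ehll_C2 cell rho n j w)].
  have k0E j : nat_state (k0 j) = cell_state cell rho n j w.
    by rewrite /nat_state ffunE /= inordK // ltnS.
  rewrite (bigD1 k0) //= [X in _ + X]big1 ?addr0 => [|kap kk].
    rewrite mul1r [X in _ * X]big1 ?mulr1 => [|j _]; last by rewrite k0E eqxx.
    by rewrite ehll_YE /states_Y; congr (_^-1); apply: eq_bigr => j _; rewrite k0E.
  have [j jn] : exists j, k0 j != kap j.
    apply/existsP; rewrite -negb_forall; apply: contra kk => /forallP kk.
    by apply/eqP/ffunP => j; rewrite (eqP (kk j)).
  rewrite mul1r (bigD1 j) //= -k0E.
  case: eqP => [|_]; last by rewrite mul0r mulr0.
  move=> e; move/negP: jn; case; apply/eqP; case: (k0 j) (kap j) e => [a b] [a' b'].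
  by rewrite /nat_state /= => -[/val_inj -> ->].
rewrite negb_forall => /existsP[j nj].
rewrite big1 // => kap _; rewrite mul1r (bigD1 j) //=.
case: eqP => [|_]; last by rewrite mul0r mulr0.
move=> e; move/negP: nj; case; move: e; rewrite /cell_state /nat_state => -[-> _].
by rewrite -ltnS.
Qed.

(** When [states_coef kap l] is nonzero, this is [m] times the probability that one element fails
    the test of its cell. *)
Definition states_miss K (kap : cell_states K) (l : {ffun 'I_m -> 'I_4}) : R :=
  \sum_j (l j).+1%:R / 2 ^+ (nat_state (kap j)).1.

Lemma integral_truncated_Y n K : (\int[P]_w (truncated_Y n K w)%:E =
  (\sum_(t : cell_states K * {ffun 'I_m -> 'I_4})
    states_Y t.1 * states_coef t.1 t.2 * (1 - states_miss t.1 t.2 / m%:R) ^+ n)%:E)%E.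
Proof.
under eq_integral do rewrite truncated_YE.
rewrite integral_indic_combination; last by move=> t; exact: measurable_all_tests.
congr (_%:E); apply: eq_bigr => -[kap l] _ /=.
have [c0|c0] := eqVneq (states_coef kap l) 0; first by rewrite c0 mulr0 !mul0r.
congr (_ * _).
rewrite (@all_tests_prob _ _ (fun j => 1 - (l j).+1%:R / 2 ^+ (nat_state (kap j)).1)).
  congr (_ ^+ _); rewrite -mulr_sumr sumrB sumr_const card_ord -/(states_miss _ _).
  by rewrite mulrBr mulVf ?pnatr_eq0 -?lt0n // mulrC.
move=> i j; rewrite -(weight_test_prob model i (s := nat_state (kap j))) //; last first.
  by move/prodf_neq0: c0; apply.
by congr (fine (P _)); apply/seteqP; split => w /=; rewrite /states_test valK.
Qed.

End truncated_expectation.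

(** * From the truncated mean to the mean *)

Section expectation_limit.
Context (R : realType) d (Omega : measurableType d) (P : probability Omega R).
Variables (m : nat) (cell rho : nat -> {RV P >-> nat}).
Hypothesis m0 : (0 < m)%N.
Hypothesis model : ehll_model m cell rho.

Lemma ehll_Y_prefix n w : ehll_Y cell rho R m n w =
  ehll_Y (fun i (v : seq (nat * nat)) => (nth (0, 0)%N v i).1)
    (fun i v => (nth (0, 0)%N v i).2) R m n (stream_prefix (fun i => cell i) (fun i => rho i) n w).
Proof.
rewrite /ehll_Y; congr (_^-1); apply: eq_bigr => j _.
set c' := (fun i (v : seq _) => (nth _ v i).1).
set r' := (fun i (v : seq _) => (nth _ v i).2).
have cE (i : 'I_n) : c' i (stream_prefix (fun i => cell i) (fun i => rho i) n w) = cell i w.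
  by rewrite /c' nth_mkseq.
have rE (i : 'I_n) : r' i (stream_prefix (fun i => cell i) (fun i => rho i) n w) = rho i w.
  by rewrite /r' nth_mkseq.
have C1 : ehll_C1 c' r' n j (stream_prefix (fun i => cell i) (fun i => rho i) n w) =
    ehll_C1 cell rho n j w.
  rewrite /ehll_C1; under eq_bigl do rewrite cE.
  by apply: eq_bigr => i _; rewrite rE.
have C2 : ehll_C2 c' r' n j (stream_prefix (fun i => cell i) (fun i => rho i) n w) =
    ehll_C2 cell rho n j w.
  by rewrite /ehll_C2 C1; congr (_ || _); apply: eq_existsb => i; rewrite cE rE.
by rewrite C1 C2.
Qed.

Lemma measurable_ehll_Y n : measurable_fun setT (ehll_Y cell rho R m n).
Proof.
rewrite (funext (ehll_Y_prefix n)).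
by apply: measurable_fun_prefix => i; exact: measurable_funP.
Qed.

Lemma measurable_truncated_Y n K : measurable_fun setT (truncated_Y m cell rho n K).
Proof.
rewrite (funext (truncated_YE m cell rho n K)).
apply: measurable_sum => t; apply: measurable_funM => //.
by apply: measurable_indic; exact: measurable_all_tests.
Qed.

Lemma truncated_Y_ge0 n K w : 0 <= truncated_Y m cell rho n K w.
Proof. by rewrite /truncated_Y; case: ifP => // _; rewrite ltW // ehll_Y_gt0. Qed.

Lemma truncated_Y_le n K w : truncated_Y m cell rho n K w <= ehll_Y cell rho R m n w.
Proof. by rewrite /truncated_Y; case: ifP => // _; rewrite ltW // ehll_Y_gt0. Qed.

Lemma truncated_Y_nondecreasing n w :
  {homo (fun K => truncated_Y m cell rho n K w) : K L / (K <= L)%N >-> K <= L}.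
Proof.
move=> K L KL; rewrite {1}/truncated_Y.
case: ifP => [/andP[h1 /forallP h2]|_]; last exact: truncated_Y_ge0.
rewrite /truncated_Y h1 /=; case: ifP => // /negP; case; apply/forallP => j.
exact: leq_trans (h2 j) KL.
Qed.

Lemma assigned_negligible n : P.-negligible (~` [set w | assigned m cell n w]).
Proof.
have aE : [set w | assigned m cell n w] = all_tests m cell rho n (fun=> xpredT).
  by apply/seteqP; split => w /= h i ni; [split; rewrite ?h|have [] := h i ni].
apply/negligibleP.
  by apply: measurableC; rewrite aE; exact: measurable_all_tests.
have mA := measurable_all_tests m cell rho n (fun=> xpredT).
rewrite aE; apply: etrans (probability_setC P mA) _.
rewrite -(fineK (fin_num_measure P _ mA)).
rewrite (all_tests_prob model n (q := fun=> 1)) => [|i j].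
  rewrite sumr_const card_ord mulr1 -[X in X ^+ _]mulr_natr mulVf ?expr1n ?subee //.
  by rewrite pnatr_eq0 -lt0n.
rewrite (_ : mkset _ = setT) ?preimage_setT ?probability_setT //.
by apply/seteqP; split.
Qed.

Lemma truncated_Y_cvg n w : assigned m cell n w ->
  (fun K => (truncated_Y m cell rho n K w)%:E) @ \oo --> (ehll_Y cell rho R m n w)%:E.
Proof.
move=> aw; apply: cvg_near_cst; near=> K.
rewrite /truncated_Y asboolT //=; case: ifP => // /negP; case.
apply/forallP => j; apply: (@leq_trans (\max_(j < m) ehll_C1 cell rho n j w)).
  exact: (leq_bigmax j).
by near: K; exact: nbhs_infty_ge.
Unshelve. all: by end_near.
Qed.

Lemma integral_truncated_Y_le n K :
  (\int[P]_w (truncated_Y m cell rho n K w)%:E <= \int[P]_w (ehll_Y cell rho R m n w)%:E)%E.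
Proof.
apply: ge0_le_integral => //.
- by move=> w _; rewrite lee_fin truncated_Y_ge0.
- by apply/measurable_EFinP; exact: measurable_truncated_Y.
- by apply/measurable_EFinP; exact: measurable_ehll_Y.
- by move=> w _; rewrite lee_fin truncated_Y_le.
Qed.

Lemma integral_ehll_Y_le n (A : R) :
  (forall K, (\int[P]_w (truncated_Y m cell rho n K w)%:E <= A%:E)%E) ->
  (\int[P]_w (ehll_Y cell rho R m n w)%:E <= A%:E)%E.
Proof.
move=> hA.
have mt K : measurable_fun setT (fun w => (truncated_Y m cell rho n K w)%:E).
  by apply/measurable_EFinP; exact: measurable_truncated_Y.
have nd w : {homo (fun K => (truncated_Y m cell rho n K w)%:E) : K L / (K <= L)%N >-> (K <= L)%E}.
  by move=> K L KL; rewrite lee_fin truncated_Y_nondecreasing.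
have cv w : cvgn (fun K => (truncated_Y m cell rho n K w)%:E).
  by apply: ereal_nondecreasing_is_cvgn; exact: nd.
rewrite (@ge0_ae_eq_integral _ _ _ P setT _
   (fun w => limn (fun K => (truncated_Y m cell rho n K w)%:E))) //.
- rewrite monotone_convergence //.
    apply: lime_le; last by near=> K; exact: hA.
    apply: ereal_nondecreasing_is_cvgn => K L KL.
    apply: ge0_le_integral => //; first by move=> w _; rewrite lee_fin truncated_Y_ge0.
    by move=> w _; exact: nd.
  by move=> K w _; rewrite lee_fin truncated_Y_ge0.
- by apply/measurable_EFinP; exact: measurable_ehll_Y.
- apply: (emeasurable_fun_cvg (fun K w => (truncated_Y m cell rho n K w)%:E)) => //.
- by move=> w _; rewrite lee_fin ltW // ehll_Y_gt0.
- move=> w _; apply: lime_ge => //; near=> K; by rewrite lee_fin truncated_Y_ge0.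
(* The truncations converge to [ehll_Y] only where every element has a cell below [m]; elsewhere
   they are all 0. *)
apply: negligibleS (assigned_negligible n) => w /= h aw; apply: h => _.
by apply/esym/cvg_lim => //; exact: truncated_Y_cvg.
Unshelve. all: by end_near.
Qed.

Lemma integral_ehll_Y_nondecreasing n :
  (\int[P]_w (ehll_Y cell rho R m n w)%:E <= \int[P]_w (ehll_Y cell rho R m n.+1 w)%:E)%E.
Proof.
apply: ge0_le_integral => //.
- by move=> w _; rewrite lee_fin ltW // ehll_Y_gt0.
- by apply/measurable_EFinP; exact: measurable_ehll_Y.
- by apply/measurable_EFinP; exact: measurable_ehll_Y.
- by move=> w _; rewrite lee_fin ehll_Y_nondecreasing.
Qed.

End expectation_limit.

(** * Depoissonization *)

Section depoissonization.
Context {R : realType}.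
Implicit Types (l q t e x : R) (i j n k N : nat).

Definition pois l k : R := expR (- l) * (l ^+ k / k`!%:R).

Lemma pois_ge0 l k : 0 <= l -> 0 <= pois l k.
Proof. by move=> l0; rewrite mulr_ge0 ?expR_ge0 // divr_ge0 ?exprn_ge0. Qed.

Lemma pois_sum_cvg l : \sum_(0 <= k < n) pois l k @[n --> \oo] --> (1 : R).
Proof.
have h : series (exp_coeff l) @ \oo --> expR l by exact: is_cvg_series_exp_coeff.
have -> : (1 : R) = expR (- l) * expR l by rewrite -expRD addNr expR0.
rewrite (_ : (fun n => _) = (fun n => expR (- l) * series (exp_coeff l) n)).
  by apply: cvgMr; exact: h.
by apply/funext => n; rewrite /series /= mulr_sumr.
Qed.

Lemma pois_sum_nondecreasing l : 0 <= l ->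
  nondecreasing_seq (fun n => \sum_(0 <= k < n) pois l k).
Proof.
move=> l0 i j ij; rewrite (big_cat_nat (leq0n i) ij) /= lerDl.
by apply: sumr_ge0 => k _; exact: pois_ge0.
Qed.

Lemma pois_sum_le1 l n : 0 <= l -> \sum_(0 <= k < n) pois l k <= 1.
Proof.
move=> l0; have cv := @pois_sum_cvg l; rewrite -[leRHS](cvg_lim _ cv) //.
apply: nondecreasing_cvgn_le; first exact: pois_sum_nondecreasing.
by apply/cvg_ex; exists 1; exact: pois_sum_cvg.
Qed.

Lemma exp_series_le l i j : 0 <= l -> \sum_(i <= k < j) l ^+ k / k`!%:R <= expR l.
Proof.
move=> l0; have [ij|ji] := leqP i j; last by rewrite big_geq ?expR_ge0 // ltnW.
have := pois_sum_le1 j l0.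
rewrite -mulr_sumr expRN mulrC ler_pdivrMr ?expR_gt0 // mul1r; apply: le_trans.
rewrite [leRHS](big_cat_nat (leq0n i) ij) /= lerDr.
by apply: sumr_ge0 => k _; rewrite divr_ge0 ?exprn_ge0.
Qed.

(* Chernoff bound: the terms beyond [n] are at most those of the Poisson law
   tilted to mean [n], times [(t * exp (1 - t)) ^+ n]. *)
Lemma pois_tail t n i j : 0 <= t ->
  (forall k, (i <= k < j)%N -> t ^+ k <= t ^+ n) ->
  \sum_(i <= k < j) pois (n%:R * t) k <= (t * expR (1 - t)) ^+ n.
Proof.
move=> t0 h.
have -> : (t * expR (1 - t)) ^+ n = t ^+ n * expR (- (n%:R * t)) * expR n%:R.
  by rewrite exprMn -expRM_natl -mulrA -expRD; congr (_ * expR _); ring.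
apply: le_trans (ler_wpM2l _ (@exp_series_le n%:R i j _)) => //; last first.
  by rewrite mulr_ge0 ?exprn_ge0 ?expR_ge0.
rewrite mulr_sumr; apply: ler_sum_nat => k kij.
have -> : pois (n%:R * t) k = t ^+ k * (expR (- (n%:R * t)) * (n%:R ^+ k / k`!%:R)).
  by rewrite /pois exprMn; ring.
rewrite -[leRHS]mulrA ler_wpM2r ?h // mulr_ge0 ?expR_ge0 //.
Qed.

(** This is the strict inequality [t < exp (t - 1)] for [t != 1]. *)
Lemma chernoff_base t : 0 < t -> t != 1 -> 0 <= t * expR (1 - t) < 1.
Proof.
move=> t0 t1; rewrite mulr_ge0 ?expR_ge0 ?(ltW t0) //=.
rewrite -(opprB t 1) expRN ltr_pdivrMr ?expR_gt0 // mul1r.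
have := @expR_gt1Dx R (t - 1); rewrite subr_eq0 => /(_ t1); lra.
Qed.

Lemma pois_succ l k : k.+1%:R * pois l k.+1 = l * pois l k.
Proof.
have f0 : k`!%:R != 0 :> R by rewrite pnatr_eq0 -lt0n fact_gt0.
have k0 : k.+1%:R != 0 :> R by rewrite pnatr_eq0.
rewrite /pois factS natrM exprS.
by move: (k.+1%:R) (k`!%:R) k0 f0 => a b a0 b0; field; rewrite a0 b0.
Qed.

Section sandwich.
Variables (m : nat) (al : nat -> R) (L kap C : R).
Hypothesis m0 : (0 < m)%N.
Hypothesis (L0 : 0 <= L) (kap0 : 0 <= kap) (C0 : 0 <= C).
Hypothesis al0 : forall n, 0 <= al n.
Hypothesis al_nd : nondecreasing_seq al.
Hypothesis upper : forall l N, 0 < l ->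
  \sum_(0 <= k < N) pois l k * al k <= l / m%:R * (L + kap + C / l).
(** The Poisson mean is not written as an infinite sum: it is reached from below through every upper
    bound [A] of its partial sums. *)
Hypothesis lower : forall l A, 128 * m%:R <= l ->
  (forall N, \sum_(0 <= k < N) pois l k * al k <= A) ->
  l / m%:R * (L - kap - C / l) <= A.

(* A Poisson variable of mean [n * t] is at least [n], up to a Chernoff tail, when
   [t > 1], and less than [n] when [t < 1]: as [al] is monotone, both bounds on
   its Poisson averages transfer to [al n]. *)
Lemma depois_upper t n : 1 < t -> (0 < n)%N ->
  al n * (1 - (t * expR (1 - t)) ^+ n) <= n%:R * t / m%:R * (L + kap + C / (n%:R * t)).
Proof.
move=> t1 n0; have t0 : 0 < t by lra.
have l0 : 0 < n%:R * t by rewrite mulr_gt0 // ltr0n.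
apply: (@le_trans _ _ (al n * (1 - \sum_(0 <= k < n) pois (n%:R * t) k))).
  rewrite ler_wpM2l // lerB // pois_tail ?(ltW t0) // => k /andP[_ kn].
  by apply: ler_weXn2l; [exact: ltW|exact: ltnW].
have cv : al n * (\sum_(0 <= k < N) pois (n%:R * t) k - \sum_(0 <= k < n) pois (n%:R * t) k)
    @[N --> \oo] --> al n * (1 - \sum_(0 <= k < n) pois (n%:R * t) k).
  by apply: cvgMr; apply: cvgB; [exact: pois_sum_cvg|exact: cvg_cst].
rewrite -(cvg_lim _ cv) //; apply: limr_le; first by apply/cvg_ex; eexists; exact: cv.
exists n => // N /= nN; apply: le_trans (upper N l0).
rewrite !(big_cat_nat (leq0n n) nN) /= addrAC subrr add0r.
apply: (@le_trans _ _ (\sum_(n <= k < N) pois (n%:R * t) k * al k)).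
  rewrite mulr_sumr; apply: ler_sum_nat => k /andP[nk _].
  by rewrite mulrC ler_wpM2l ?pois_ge0 ?(ltW l0) // al_nd.
rewrite lerDr; apply: sumr_ge0 => k _; rewrite mulr_ge0 ?pois_ge0 ?(ltW l0) //.
Qed.

(** A rough growth bound, needed to control the terms beyond [n] in [depois_lower]. It is
    [depois_upper] at [t = 2], where [1 - q ^+ n] stays above [1 - q]. *)
Lemma depois_linear : exists2 G, 0 <= G & forall n, (0 < n)%N -> al n <= G * n%:R.
Proof.
pose q : R := 2 * expR (1 - 2).
have /andP[q0 q1] : 0 <= q < 1 by apply: chernoff_base => //; rewrite gt_eqF //; lra.
have mp : 0 < m%:R :> R by rewrite ltr0n.
exists (2 / m%:R * (L + kap + C) / (1 - q)).
  have q10 : 0 <= 1 - q by lra.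
  by apply: divr_ge0 => //; apply: mulr_ge0; rewrite ?divr_ge0 ?addr_ge0.
move=> n n0; have np : 1 <= n%:R :> R by rewrite ler1n.
have qn : q ^+ n <= q by case: n n0 {np} => // n _; rewrite exprS ler_piMr // exprn_ile1 // ltW.
rewrite mulrAC ler_pdivlMr; last by lra.
apply: (@le_trans _ _ (al n * (1 - q ^+ n))); first by rewrite ler_wpM2l //; lra.
apply: (le_trans (@depois_upper 2 n _ n0)); first lra.
rewrite [leRHS](_ : _ = n%:R * 2 / m%:R * (L + kap + C)); last by ring.
rewrite ler_wpM2l ?divr_ge0 ?mulr_ge0 // lerD2l.
by rewrite ler_pdivrMr ?ler_peMr //; lra.
Qed.

(** Monotonicity bounds the terms up to [n] by [al n]. The later ones are at most [G * k] times
    their weight, and [pois_succ] absorbs the factor [k] by shifting the index, so that the same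
    Chernoff tail applies. *)
Lemma depois_lower t n G : 0 < t < 1 -> (0 < n)%N -> 128 * m%:R <= n%:R * t ->
  0 <= G -> (forall k, (0 < k)%N -> al k <= G * k%:R) ->
  n%:R * t / m%:R * (L - kap - C / (n%:R * t)) <=
  al n + G * (n%:R * t) * (t * expR (1 - t)) ^+ n.
Proof.
move=> /andP[t0 t1] n0 ln G0 alG.
have l0 : 0 < n%:R * t by rewrite mulr_gt0 // ltr0n.
apply: lower => // N.
apply: (@le_trans _ _ (\sum_(0 <= k < n.+1 + N) pois (n%:R * t) k * al k)).
  rewrite [leRHS](big_cat_nat (leq0n N) (leq_addl _ _)) /= lerDl.
  by apply: sumr_ge0 => k _; rewrite mulr_ge0 ?pois_ge0 ?(ltW l0).
rewrite (big_cat_nat (leq0n n.+1) (leq_addr _ _)) /=; apply: lerD.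
  apply: (@le_trans _ _ (al n * \sum_(0 <= k < n.+1) pois (n%:R * t) k)).
    rewrite mulr_sumr; apply: ler_sum_nat => k /andP[_ kn].
    by rewrite mulrC ler_wpM2r ?pois_ge0 ?(ltW l0) // al_nd.
  by rewrite ler_piMr // pois_sum_le1 // ltW.
rewrite addSn big_add1 /=.
apply: (@le_trans _ _ (G * (n%:R * t) * \sum_(n <= k < n + N) pois (n%:R * t) k)).
  rewrite mulr_sumr; apply: ler_sum_nat => k /andP[nk _].
  have -> : G * (n%:R * t) * pois (n%:R * t) k = pois (n%:R * t) k.+1 * (G * k.+1%:R).
    by rewrite -mulrA -pois_succ; ring.
  by rewrite ler_wpM2l ?pois_ge0 ?(ltW l0) // alG.
rewrite ler_wpM2l ?mulr_ge0 ?(ltW t0) // pois_tail ?(ltW t0) // => k /andP[nk _].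
by apply: ler_wiXn2l => //; exact: ltW.
Qed.

Lemma depois_cvg e : 0 < e ->
  \forall n \near \oo, `|al n * m%:R / n%:R - L| <= kap + e.
Proof.
move=> e0; have [G G0 alG] := depois_linear.
have mp : 0 < m%:R :> R by rewrite ltr0n.
set B := L + kap; have B0 : 0 <= B by rewrite addr_ge0.
have k1 : L - kap <= B by have := kap0; have := L0; rewrite /B; lra.
have k2 : - (L - kap) <= B by have := kap0; have := L0; rewrite /B; lra.
(* The factors [1 + d] and [1 - d] cost at most [e / 3]; the two other thirds are for the Chernoff
   tails and for [C / n]. The bound [1 / 2] keeps [n * (1 - d)] above [128 * m] once
   [n >= 256 * m]. *)
pose d := Num.min (1 / 2) (e / (3 * (B + 1))).
have d0 : 0 < d by rewrite lt_min; apply/andP; split; [lra|rewrite divr_gt0 // mulr_gt0 //; lra].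
have d2 : d <= 1 / 2 by rewrite ge_min lexx.
have dB : d * B <= e / 3.
  apply: (@le_trans _ _ (e / (3 * (B + 1)) * B)); first by rewrite ler_wpM2r // ge_min lexx orbT.
  rewrite mulrAC ler_pdivrMr ?mulr_gt0 //; first nra.
  by lra.
have /andP[q0 q1] : 0 <= (1 + d) * expR (1 - (1 + d)) < 1.
  by apply: chernoff_base; [lra|rewrite gt_eqF //; lra].
have /andP[r0 r1] : 0 <= (1 - d) * expR (1 - (1 - d)) < 1.
  by apply: chernoff_base; [lra|rewrite lt_eqF //; lra].
set q := (1 + d) * _ in q0 q1; set r := (1 - d) * _ in r0 r1.
have cq : q ^+ n @[n --> \oo] --> 0 by apply: cvg_expr; rewrite ger0_norm.
have cr : r ^+ n @[n --> \oo] --> 0 by apply: cvg_expr; rewrite ger0_norm.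
have ev (u : R^nat) c : u @ \oo --> 0 -> 0 < c -> \forall n \near \oo, `|u n| <= c.
  by move=> /cvgrPdist_le h /h; apply: filterS => n; rewrite sub0r normrN.
have e3 : 0 < e / 3 by lra.
have c1 : 0 < e / 3 / (B + e) by rewrite divr_gt0 //; lra.
have c2 : 0 < e / 3 / (G * m%:R + 1).
  by rewrite divr_gt0 // ltr_wpDl // mulr_ge0 // ltW.
pose M : R := 256 * m%:R.
near=> n.
have h1 : `|q ^+ n| <= e / 3 / (B + e) by near: n; exact: (ev (fun n => q ^+ n)).
have h2 : `|r ^+ n| <= e / 3 / (G * m%:R + 1) by near: n; exact: (ev (fun n => r ^+ n)).
have h3 : 3 * C / e <= n%:R by near: n; exact: nbhs_infty_ger.
have h4 : M <= n%:R by near: n; exact: nbhs_infty_ger.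
rewrite /M in h4.
have np : 0 < n%:R :> R by apply: lt_le_trans h4; lra.
have n0 : (0 < n)%N by rewrite ltr0n in np.
have Cn : C / n%:R <= e / 3 by rewrite ler_pdivrMr //; move: h3; rewrite ler_pdivrMr //; lra.
rewrite ger0_norm ?exprn_ge0 // in h1; rewrite ger0_norm ?exprn_ge0 // in h2.
have r'1 : 0 < 1 - d by lra.
have q'1 : 1 < 1 + d by lra.
have := @depois_upper (1 + d) n q'1 n0; rewrite -/q => hu.
have ln : 128 * m%:R <= n%:R * (1 - d) by nra.
have := @depois_lower (1 - d) n G ltac:(lra) n0 ln G0 alG; rewrite -/r => hl.
have cu : n%:R * (1 + d) / m%:R * (L + kap + C / (n%:R * (1 + d))) =
    ((1 + d) * B + C / n%:R) * n%:R / m%:R.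
  by rewrite /B; field; rewrite !gt_eqF //; lra.
have cl : n%:R * (1 - d) / m%:R * (L - kap - C / (n%:R * (1 - d))) =
    ((1 - d) * (L - kap) - C / n%:R) * n%:R / m%:R.
  by field; rewrite !gt_eqF //; lra.
rewrite cu ler_pdivlMr // in hu; rewrite cl ler_pdivrMr // in hl.
set c := al n * m%:R / n%:R.
have ac : al n * m%:R = c * n%:R by rewrite /c divfK // gt_eqF.
rewrite mulrAC ac mulrAC ler_pM2r // in hu.
rewrite [(al n + _) * _]mulrDl ac in hl.
have hl2 : (1 - d) * (L - kap) - C / n%:R <= c + G * (1 - d) * r ^+ n * m%:R.
  rewrite -(ler_pM2r np); apply: (le_trans hl); rewrite le_eqVlt; apply/orP; left; apply/eqP.
  by ring.
have rn0 : 0 <= r ^+ n by rewrite exprn_ge0.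
have qn0 : 0 <= q ^+ n by rewrite exprn_ge0.
have Gm : 0 <= G * m%:R by rewrite mulr_ge0 // ltW.
have h2' : r ^+ n * (G * m%:R + 1) <= e / 3 by rewrite -ler_pdivlMr //; lra.
have h1' : q ^+ n * (B + e) <= e / 3 by rewrite -ler_pdivlMr //; lra.
have h2'' : G * (1 - d) * r ^+ n * m%:R <= e / 3.
  apply: (@le_trans _ _ (r ^+ n * (G * m%:R))); last first.
    by apply: le_trans h2'; rewrite mulrDr lerDl mulr1.
  have -> : G * (1 - d) * r ^+ n * m%:R = r ^+ n * (G * m%:R) * (1 - d) by ring.
  by apply: ler_piMr; [exact: mulr_ge0|rewrite lerBlDr lerDl ltW].
have dLk : d * (L - kap) <= e / 3.
  by apply: (le_trans (ler_wpM2l (ltW d0) k1)).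
have dLk' : - (e / 3) <= d * (L - kap).
  by rewrite lerNl -mulrN; apply: (le_trans (ler_wpM2l (ltW d0) k2)).
rewrite ler_distl; apply/andP; split.
  lra.
(* The left side is at most [B + 2 * e / 3], and [q ^+ n * (B + e) <= e / 3]. *)
have cB : c * (1 - q ^+ n) <= (B + e) * (1 - q ^+ n) by lra.
have qn1 : 0 < 1 - q ^+ n.
  by rewrite subr_gt0 exprn_ilt1 // -lt0n.
by move: cB; rewrite ler_pM2r // /B; lra.
Unshelve. all: by end_near.
Qed.

End sandwich.

End depoissonization.

(** * Expectation for a Poisson number of elements *)

Section poisson_transform.
Context {R : realType}.
Variable m : nat.
Hypothesis m0 : (0 < m)%N.
Implicit Types (l x u q : R) (n N K k : nat).
Local Notation mu := (@lebesgue_measure R).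

Definition truncated_mean n K : R :=
  \sum_(t : cell_states m K * {ffun 'I_m -> 'I_4})
    states_Y R t.1 * states_coef R t.1 t.2 * (1 - states_miss R t.1 t.2 / m%:R) ^+ n.

(* The mean of [truncated_mean] over a Poisson number of elements of mean [x * m]. *)
Definition poisson_mean x K : R :=
  \sum_(t : cell_states m K * {ffun 'I_m -> 'I_4})
    states_Y R t.1 * states_coef R t.1 t.2 * expR (- (x * states_miss R t.1 t.2)).

Lemma pois_power_cvg l q :
  \sum_(0 <= k < N) pois l k * q ^+ k @[N --> \oo] --> expR (- (l * (1 - q))).
Proof.
have h : series (exp_coeff (l * q)) @ \oo --> expR (l * q) by exact: is_cvg_series_exp_coeff.
have -> : expR (- (l * (1 - q))) = expR (- l) * expR (l * q).
  by rewrite -expRD; congr expR; ring.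
rewrite (_ : (fun N => _) = (fun N => expR (- l) * series (exp_coeff (l * q)) N)).
  by apply: cvgMr; exact: h.
apply/funext => n; rewrite /series /= mulr_sumr; apply: eq_bigr => k _.
by rewrite /pois /exp_coeff /= exprMn; ring.
Qed.

Lemma pois_truncated_mean_cvg x K :
  \sum_(0 <= k < N) pois (x * m%:R) k * truncated_mean k K @[N --> \oo] --> poisson_mean x K.
Proof.
rewrite (_ : (fun N => _) = (fun N => \sum_(t : cell_states m K * {ffun 'I_m -> 'I_4})
    states_Y R t.1 * states_coef R t.1 t.2 * \sum_(0 <= k < N)
      pois (x * m%:R) k * (1 - states_miss R t.1 t.2 / m%:R) ^+ k)); last first.
  apply/funext => N; rewrite /truncated_mean.
  under eq_bigr do rewrite mulr_sumr.
  rewrite exchange_big /=; apply: eq_bigr => t _.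
  by rewrite mulr_sumr; apply: eq_bigr => k _; ring.
apply: cvg_big => [|t _]; first exact: add_continuous.
apply: cvgMr.
have -> : x * states_miss R t.1 t.2 =
    (x * m%:R) * (1 - (1 - states_miss R t.1 t.2 / m%:R)).
  by rewrite subKr mulrAC -mulrA divfK // pnatr_eq0 -lt0n.
exact: pois_power_cvg.
Qed.

(** The probability of the state [s] for a cell receiving a Poisson number of mean [x] of elements:
    a test failed with probability [p] is passed by all of them with probability [exp (- x * p)]. *)
Definition state_prob x (s : nat * bool) : R :=
  \sum_(i < 4) weight_coef s i * expR (- (x * (i.+1%:R / 2 ^+ s.1))).

(** The exponential of a sum over the cells splits into a product, which is the independence of
    cells under Poisson sampling; the inclusion-exclusion can then be refolded cell by cell into
    nonnegative probabilities. *)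
Lemma poisson_meanE x K : poisson_mean x K =
  \sum_(kap : cell_states m K) states_Y R kap * \prod_j state_prob x (nat_state (kap j)).
Proof.
rewrite /poisson_mean -(pair_bigA _ (fun kap (l : {ffun 'I_m -> 'I_4}) =>
  states_Y R kap * states_coef R kap l * expR (- (x * states_miss R kap l)))) /=.
apply: eq_bigr => kap _; rewrite bigA_distr_bigA mulr_sumr /=; apply: eq_bigr => l _.
rewrite big_split /= -mulrA; congr (_ * (_ * _)).
by rewrite -expR_sum /states_miss mulr_sumr sumrN.
Qed.

Lemma state_prob0 x b : state_prob x (0%N, b) = if b then expR (- x) else 0.
Proof.
rewrite /state_prob !big_ord_recr big_ord0 /weight_coef /= divr1 mulr1.
by case: b; ring.
Qed.

Lemma state_prob1 x b :
  state_prob x (1%N, b) = if b then expR (- (x / 2)) - expR (- x) else 0.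
Proof.
rewrite /state_prob !big_ord_recr big_ord0 /weight_coef /= expr1 mul1r divff // mulr1.
by case: b; ring.
Qed.

Lemma state_prob2 x k b (y : R) : y = x / 2 ^+ k.+2 -> state_prob x (k.+2, b) =
  if b then expR (- y) - expR (- (2 * y)) - expR (- (3 * y)) + expR (- (4 * y))
  else expR (- (3 * y)) - expR (- (4 * y)).
Proof.
rewrite /state_prob !big_ord_recr big_ord0 /weight_coef => -> /=.
by case: b; rewrite ?mul0r ?add0r ?addr0 !mul1r !mulN1r !(mulrCA x).
Qed.

Lemma state_prob_ge0 x s : 0 <= x -> 0 <= state_prob x s.
Proof.
case: s => -[|[|k]] b x0.
- by rewrite state_prob0; case: b; rewrite ?expR_ge0.
- rewrite state_prob1; case: b => //; rewrite subr_ge0 ler_expR; lra.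
rewrite (state_prob2 b (erefl _)); set y := x / _.
have y0 : 0 <= y by rewrite divr_ge0 ?exprn_ge0.
have y1 : expR (- y) <= 1 by rewrite -expR0 ler_expR; lra.
have e n : expR (- (n%:R * y)) = expR (- y) ^+ n by rewrite -expRM_natl; congr expR; ring.
rewrite (e 2%N) (e 3%N) (e 4%N).
have z0 := expR_ge0 (- y); move: (expR (- y)) z0 y1 => z z0 z1.
case: b; last by rewrite subr_ge0 ler_wiXn2l.
have -> : z - z ^+ 2 - z ^+ 3 + z ^+ 4 = z * (1 - z) ^+ 2 * (1 + z) by ring.
by rewrite mulr_ge0 ?addr_ge0 // mulr_ge0 // exprn_ge0 // subr_ge0.
Qed.

(** The states with [C1] equal to 0 or 1 form [boundary]; the value [i + 2] of [C1] gives the term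
    of index [i] of the dyadic sum started at [x / 4]. *)
Lemma state_prob_transform x K u :
  \sum_(s : 'I_K.+2 * bool)
    state_prob x (nat_state s) * expR (- (x * state_value (nat_state s) * u)) =
  transform x K u.
Proof.
rewrite -(pair_bigA _ (fun (k : 'I_K.+2) b => state_prob x (nat_state (k, b)) *
  expR (- (x * state_value (nat_state (k, b)) * u)))) /=.
under eq_bigr do rewrite big_bool /= !state_valueE /nat_state /=.
rewrite !big_ord_recl /transform /boundary addrA; congr (_ + _).
  rewrite /= !state_prob0 !state_prob1 !mul0r !addr0 expr0 expr1 subrr mulr0 addr0 divr1 mulr1.
  rewrite -expRD; congr (expR _ + _ * expR _); [ring|by field].
rewrite /wsum; apply: eq_bigr => i _; rewrite !lift0 /=.
have -> : 2 ^+ i.+2 = 4 * 2 ^+ i :> R by rewrite !exprS; ring.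
have p0 : (2 ^+ i : R) != 0 by rewrite expf_neq0.
set y := x / 4 / 2 ^+ i.
have yE : y = x / 2 ^+ i.+2 by rewrite /y !exprS; field.
rewrite !(state_prob2 _ yE) /hker.
have E (a b : R) : expR (- (a * y)) * expR (- (b * y * u)) = expR (- ((a + b * u) * y)).
  by rewrite -expRD; congr expR; ring.
have -> : x * ((1 + 2 * (1 - 1)) / (4 * 2 ^+ i)) * u = 1 * y * u by rewrite /y; field.
have -> : x * ((1 + 2 * (1 - 0)) / (4 * 2 ^+ i)) * u = 3 * y * u by rewrite /y; field.
have -> : expR (- y) = expR (- (1 * y)) by rewrite mul1r.
rewrite 4!(mulrDl _ _ (expR _)) !mulNr !E !mul1r addrA.
by [].
Qed.

Lemma poisson_mean_integral x K : 0 < x ->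
  ((poisson_mean x K.+1)%:E = x%:E * \int[mu]_(u in `[0%R, +oo[) ((transform x K u) ^+ m)%:E)%E.
Proof.
move=> x0.
have aff (c : R) : measurable_fun (`[0%R, +oo[%classic : set R) (fun u => expR (- (c * u))).
  rewrite (_ : (fun u => _) = (fun u => expR (- (0 + c * u)))).
    exact: measurable_expR_affine.
  by apply/funext => u; rewrite add0r.
pose Z (kap : cell_states m K.+1) : R := \sum_j state_value (nat_state (kap j)).
pose p (kap : cell_states m K.+1) : R := \prod_j state_prob x (nat_state (kap j)).
have Z0 kap : 0 < Z kap.
  rewrite /Z (bigD1 (Ordinal m0)) //= ltr_pwDl ?state_value_gt0 //.
  by apply: sumr_ge0 => j _; rewrite ltW // state_value_gt0.
have p0 kap : 0 <= p kap by apply: prodr_ge0 => j _; apply: state_prob_ge0; exact: ltW.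
under eq_integral => u _.
  rewrite -state_prob_transform -[m in X in X%:E]card_ord -prodr_const bigA_distr_bigA /=.
  under eq_bigr => kap _.
    rewrite big_split /= -expR_sum sumrN -mulr_suml -mulr_sumr -/(p kap) -/(Z kap).
    over.
  rewrite -sumEFin.
  over.
rewrite ge0_integral_sum //; last 2 first.
- move=> kap; apply/measurable_EFinP; apply: measurable_funM => //; exact: aff.
- by move=> kap u _; rewrite lee_fin mulr_ge0 ?expR_ge0.
have integral_term kap : (\int[mu]_(u in `[0%R, +oo[)
    (p kap * expR (- (x * Z kap * u)))%:E = (p kap * (x * Z kap)^-1)%:E)%E.
  under eq_integral do rewrite EFinM.
  rewrite ge0_integralZl //.
  - by rewrite integral_expRN ?mulr_gt0.
  - by apply/measurable_EFinP; exact: aff.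
  - by rewrite lee_fin.
under [in RHS]eq_bigr do rewrite integral_term.
rewrite poisson_meanE.
rewrite sumEFin -EFinM mulr_sumr; congr (_%:E); apply: eq_bigr => kap _.
rewrite /states_Y -/(Z kap) -/(p kap); field.
by rewrite !gt_eqF.
Qed.

End poisson_transform.

Lemma integral_ehll_f_fin_num (R : realType) m : (2 <= m)%N ->
  (\int[lebesgue_measure]_(u in `[0%R, +oo[) ((ehll_f u : R) ^+ m)%:E)%E \is a fin_num.
Proof.
case: m => [|[|m]] // _.
have Dge (u : R) : `[0, +oo[%classic u -> 0 <= u by rewrite /= in_itv /= andbT.
rewrite ge0_fin_numE; last first.
  apply: integral_ge0 => u /Dge u0; rewrite lee_fin exprn_ge0 //.
  by have /andP[] := ehll_f_ge0_le u0.
apply: (@le_lt_trans _ _ (\int[lebesgue_measure]_(u in `[0%R, +oo[) (decay u ^+ m.+2)%:E)%E).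
  apply: ge0_le_integral => //.
  - move=> u /Dge u0; rewrite lee_fin exprn_ge0 //.
    by have /andP[] := ehll_f_ge0_le u0.
  - apply/measurable_EFinP; apply: measurable_funX; exact: measurable_ehll_f.
  - apply/measurable_EFinP; apply: measurable_fun_derivable => u u0.
    exact: (@ex_derive _ _ _ _ _ _ _ (is_derive_decayX m.+1 u0)).
  - move=> u /Dge u0; rewrite lee_fin; have /andP[f0 _] := ehll_f_ge0_le u0.
    have fd : ehll_f u <= decay u.
      apply: le_trans (ehll_f_wbound_le u0); rewrite lerDl mulr_ge0 ?eta_ge0 //.
      exact: wbound_ge0.
    by apply: lerXn2r => //; rewrite ?nnegrE //; have /andP[] := decay_itv u0; lra.
by rewrite integral_decayX ltry.
Qed.

(** * Asymptotics of the mean for at least two cells *)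

Section asymptotics.
Context (R : realType) d (Omega : measurableType d) (P : probability Omega R).
Variables (m : nat) (cell rho : nat -> {RV P >-> nat}).
Hypothesis m2 : (2 <= m)%N.
Hypothesis model : ehll_model m cell rho.

Let m0 : (0 < m)%N. Proof. exact: ltnW. Qed.
Let mR0 : 0 < m%:R :> R. Proof. by rewrite ltr0n. Qed.

Let Lf : R := fine (\int[lebesgue_measure]_(u in `[0%R, +oo[) (ehll_f u ^+ m)%:E)%E.
Let kap : R := 84 / 10 ^+ 6 / m%:R.
(** With [x = l / m], [C / l] dominates the boundary errors of both [transform_upper] and
    [transform_lower]. *)
Let C : R := 24 * m%:R ^+ 2 * 3 ^+ m.

Let LfE : (\int[lebesgue_measure]_(u in `[0%R, +oo[) ((ehll_f u : R) ^+ m)%:E = Lf%:E)%E.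
Proof. by rewrite fineK // integral_ehll_f_fin_num. Qed.

Let truncated_meanE n K :
  (\int[P]_w (truncated_Y m cell rho n K w)%:E = (truncated_mean m n K : R)%:E)%E.
Proof. exact: integral_truncated_Y. Qed.

Lemma truncated_mean_ge0 n K : 0 <= truncated_mean m n K :> R.
Proof.
rewrite -lee_fin -truncated_meanE; apply: integral_ge0 => w _.
by rewrite lee_fin truncated_Y_ge0.
Qed.

Lemma truncated_mean_nondecreasing n : nondecreasing_seq (fun K => truncated_mean m n K : R).
Proof.
move=> K K' KK'; rewrite -lee_fin -!truncated_meanE; apply: ge0_le_integral => //.
- by move=> w _; rewrite lee_fin truncated_Y_ge0.
- by apply/measurable_EFinP; exact: measurable_truncated_Y.
- by apply/measurable_EFinP; exact: measurable_truncated_Y.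
- by move=> w _; rewrite lee_fin truncated_Y_nondecreasing.
Qed.

Lemma pois_truncated_mean_le (l : R) N K : 0 <= l ->
  \sum_(0 <= k < N) pois l k * truncated_mean m k K <= poisson_mean m (l / m%:R) K.
Proof.
move=> l0; have := @pois_truncated_mean_cvg R m m0 (l / m%:R) K.
rewrite divfK ?gt_eqF // => cv; rewrite -(cvg_lim _ cv) //.
apply: nondecreasing_cvgn_le; last by apply/cvg_ex; eexists; exact: cv.
move=> i j ij; rewrite (big_cat_nat (leq0n i) ij) /= lerDl.
by apply: sumr_ge0 => k _; rewrite mulr_ge0 ?pois_ge0 ?truncated_mean_ge0.
Qed.

Lemma poisson_mean_upper (l : R) K : 0 < l ->
  poisson_mean m (l / m%:R) K.+1 <= l / m%:R * (Lf + kap + C / l).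
Proof.
move=> l0; set x := l / m%:R; have x0 : 0 < x by rewrite divr_gt0.
rewrite -lee_fin (poisson_mean_integral m0) // (EFinM x) lee_pmul2l //.
apply: (le_trans (transform_upper K m2 x0)); rewrite LfE -EFinD lee_fin -addrA !lerD2l.
rewrite /C /x; have e1 : expR (- (l / m%:R / 2)) <= 1.
  by rewrite -expR0 ler_expR oppr_le0 !divr_ge0 // ltW.
have -> : 4 * m%:R * 3 ^+ m * expR (- (l / m%:R / 2)) / (l / m%:R) =
   4 * m%:R ^+ 2 * 3 ^+ m * expR (- (l / m%:R / 2)) / l.
  by field; rewrite !gt_eqF.
rewrite ler_pM2r ?invr_gt0 // -[leRHS]mulr1.
apply: ler_pM => //; rewrite ?expR_ge0 ?mulr_ge0 ?exprn_ge0 //.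
by rewrite !ler_wpM2r ?exprn_ge0 // ler_nat.
Qed.

(** In the Poisson mean at [l = m] the single term of index [n] is at most the whole sum, which is
    bounded independently of [K]; dividing by its positive weight bounds all the truncated means. *)
Lemma integral_ehll_Y_fin_num n : (\int[P]_w (ehll_Y cell rho R m n w)%:E)%E \is a fin_num.
Proof.
have Y0 : (0 <= \int[P]_w (ehll_Y cell rho R m n w)%:E)%E.
  by apply: integral_ge0 => w _; rewrite lee_fin ltW // ehll_Y_gt0.
rewrite ge0_fin_numE //.
pose A : R := m%:R / m%:R * (Lf + kap + C / m%:R) / pois m%:R n.
apply: (@le_lt_trans _ _ A%:E); last by rewrite ltry.
have pp : 0 < pois m%:R n :> R.
  by rewrite /pois mulr_gt0 ?expR_gt0 // divr_gt0 ?exprn_gt0 // ltr0n fact_gt0.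
apply: (integral_ehll_Y_le m0 model) => K; rewrite truncated_meanE lee_fin.
apply: (le_trans (truncated_mean_nondecreasing n (leqnSn K))).
rewrite /A ler_pdivlMr // mulrC.
apply: le_trans (poisson_mean_upper K mR0).
apply: le_trans (pois_truncated_mean_le n.+1 K.+1 (ltW mR0)).
rewrite big_nat_recr //= lerDr; apply: sumr_ge0 => k _.
by rewrite mulr_ge0 ?pois_ge0 ?truncated_mean_ge0 // ltW.
Qed.

Definition mean_Y n : R := fine (\int[P]_w (ehll_Y cell rho R m n w)%:E)%E.

Let mean_YE n : (\int[P]_w (ehll_Y cell rho R m n w)%:E = (mean_Y n)%:E)%E.
Proof. by rewrite fineK // integral_ehll_Y_fin_num. Qed.

Lemma truncated_mean_le n K : truncated_mean m n K <= mean_Y n.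
Proof. by rewrite -lee_fin -truncated_meanE -mean_YE integral_truncated_Y_le. Qed.

Lemma truncated_mean_cvg n : (fun K => truncated_mean m n K.+1 : R) @ \oo --> mean_Y n.
Proof.
have cv : cvgn (fun K => truncated_mean m n K : R).
  apply: nondecreasing_is_cvgn; first exact: truncated_mean_nondecreasing.
  by exists (mean_Y n) => _ [K _ <-]; exact: truncated_mean_le.
suff <- : limn (fun K => truncated_mean m n K : R) = mean_Y n by rewrite cvg_shiftS.
apply/eqP; rewrite eq_le; apply/andP; split.
  by apply: limr_le => //; near=> K; exact: truncated_mean_le.
rewrite -lee_fin -mean_YE; apply: (integral_ehll_Y_le m0 model) => K.
rewrite truncated_meanE lee_fin.
by apply: nondecreasing_cvgn_le => //; exact: truncated_mean_nondecreasing.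
Unshelve. all: by end_near.
Qed.

Lemma mean_Y_asymptotics e : 0 < e ->
  \forall n \near \oo, `|mean_Y n * m%:R / n%:R - Lf| <= kap + e.
Proof.
have kap0 : 0 <= kap by rewrite !divr_ge0.
have C0 : 0 <= C by rewrite !mulr_ge0 // exprn_ge0.
have L0 : 0 <= Lf.
  apply: fine_ge0; apply: integral_ge0 => u; rewrite /= in_itv /= andbT => u0.
  by rewrite lee_fin exprn_ge0 //; have /andP[] := ehll_f_ge0_le u0.
apply: (@depois_cvg R m mean_Y Lf kap C) => //.
- move=> n; rewrite -lee_fin -mean_YE; apply: integral_ge0 => w _.
  by rewrite lee_fin ltW // ehll_Y_gt0.
- by apply/nondecreasing_seqP => n; rewrite -lee_fin -!mean_YE integral_ehll_Y_nondecreasing.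
- move=> l N l0.
  have cv : \sum_(0 <= k < N) pois l k * truncated_mean m k K.+1 @[K --> \oo] -->
      \sum_(0 <= k < N) pois l k * mean_Y k.
    by apply: cvg_big => [|k _]; [exact: add_continuous|apply: cvgMr; exact: truncated_mean_cvg].
  rewrite -(cvg_lim _ cv) //; apply: limr_le; first by apply/cvg_ex; eexists; exact: cv.
  near=> K; apply: le_trans (poisson_mean_upper K l0).
  by apply: pois_truncated_mean_le; exact: ltW.
move=> l A l128 hA; set x := l / m%:R.
have x128 : 128 <= x by rewrite ler_pdivlMr.
have x0 : 0 < x by lra.
have l0 : 0 < l by have : 0 < x * m%:R; [exact: mulr_gt0|rewrite divfK // gt_eqF].
have tA K : (\int[lebesgue_measure]_(u in `[0%R, +oo[) ((transform x K u) ^+ m)%:E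
    <= (A / x)%:E)%E.
  rewrite -(@lee_pmul2l _ x%:E) // -(poisson_mean_integral m0) // -EFinM lee_fin.
  rewrite mulrC divfK ?gt_eqF //.
  have := @pois_truncated_mean_cvg R m m0 x K.+1; rewrite divfK ?gt_eqF // => cv.
  rewrite -(cvg_lim _ cv) //; apply: limr_le; first by apply/cvg_ex; eexists; exact: cv.
  near=> N; apply: le_trans (hA N); apply: ler_sum => k _.
  by rewrite ler_wpM2l ?pois_ge0 ?truncated_mean_le // ltW.
have := transform_lower m2 x128 tA; rewrite LfE -EFinD lee_fin -/kap => h.
suff : 24 * m%:R * expR (- (x / 2)) / x <= C / l.
  by move=> hC; rewrite mulrC -ler_pdivlMr //; lra.
have -> : C / l = 24 * m%:R * 3 ^+ m / x.
  by rewrite /C /x; field; rewrite !gt_eqF.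
rewrite ler_pM2r ?invr_gt0 //; apply: ler_wpM2l; first by rewrite mulr_ge0.
apply: (@le_trans _ _ 1); last by rewrite exprn_ege1 // ler1n.
by rewrite -expR0 ler_expR oppr_le0 divr_ge0 // ltW.
Unshelve. all: by end_near.
Qed.

End asymptotics.

(** * The case of one cell *)

Lemma ereal_eq_pinfty (R : realType) (c : R) (x : \bar R) : 0 < c ->
  (forall N : nat, ((c * N%:R)%:E <= x)%E) -> x = +oo%E.
Proof.
move=> c0; case: x => [r|//|] h; last by have := h 0%N.
have := h (Num.truncn (r / c)).+1; rewrite lee_fin leNgt => /negP; case.
rewrite mulrC -ltr_pdivrMr //; have [rc|rc] := leP 0 (r / c).
  by have /andP[_] := truncn_itv rc.
by rewrite (lt_le_trans rc).
Qed.

Section one_cell.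
Context (R : realType) d (Omega : measurableType d) (P : probability Omega R).
Variables (cell rho : nat -> {RV P >-> nat}).
Hypothesis model : ehll_model 1 cell rho.

Lemma ehll_Y_one_cell_ge n w k : (0 < n)%N -> cell 0%N w = 0%N -> rho 0%N w = k ->
  2 ^+ k / 3 <= ehll_Y cell rho R 1 n w.
Proof.
move=> n0 c0 r0; rewrite ehll_YE big_ord1 /=.
set s := cell_state _ _ _ _ _; have s0 := state_value_gt0 s : 0 < state_value s :> R.
rewrite -[leLHS]invrK lef_pV2 ?posrE ?invr_gt0 ?divr_gt0 ?exprn_gt0 // invf_div.
have ks : (k <= s.1)%N by rewrite -r0; apply: ehll_C1_ge.
have k2 : 2 ^+ k <= 2 ^+ s.1 :> R by rewrite ler_eXn2l // ltr1n.
rewrite state_valueE; apply: ler_pM.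
- by case: (s.2) => /=; lra.
- by rewrite invr_ge0 exprn_ge0.
- by case: (s.2) => /=; lra.
- by rewrite lef_pV2 ?posrE ?exprn_gt0.
Qed.

(** As in the St. Petersburg game: if the first element has value [k], an event of probability
    [2 ^- k], then [Y] is at least [2 ^ k / 3], so each [k] contributes at least [1 / 3]. *)
Lemma integral_ehll_Y_one_cell n : (0 < n)%N ->
  (\int[P]_w (ehll_Y cell rho R 1 n w)%:E = +oo)%E.
Proof.
move=> n0; apply: (@ereal_eq_pinfty R 3^-1) => // N.
pose B (k : 'I_N) := [set w | forall i, (i < 1)%N -> cell i w = 0%N /\ [set k.+1] (rho i w)].
have mB k : measurable (B k).
  exact: (measurable_assignment cell rho 1 (fun=> 0%N) (fun=> [set k.+1])).
have PB k : fine (P (B k)) = 2 ^- k.+1.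
  rewrite (elements_independent model 1 (fun=> 0%N) (fun=> [set k.+1])) big_ord1.
  have [-> //] := model => hr _.
  by rewrite hr // invr1 mul1e.
have <- : (\int[P]_w (\sum_(k < N) 2 ^+ k.+1 / 3 * \1_(B k) w)%:E = (3^-1 * N%:R)%:E)%E.
  rewrite integral_indic_combination //; congr (_%:E).
  rewrite (eq_bigr (fun=> 3^-1)) => [|k _]; first by rewrite sumr_const card_ord mulr_natr.
  by rewrite PB mulrAC divff ?mul1r // expf_neq0.
apply: ge0_le_integral => //.
- move=> w _; rewrite lee_fin; apply: sumr_ge0 => k _.
  by rewrite mulr_ge0 // divr_ge0 // exprn_ge0.
- apply/measurable_EFinP; apply: measurable_sum => k; apply: measurable_funM => //.
- by apply/measurable_EFinP; exact: measurable_ehll_Y.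
move=> w _; rewrite lee_fin.
have [[k Bk]|nB] := pselect (exists k, B k w).
  have [c0 r0] := Bk 0%N isT.
  rewrite (bigD1 k) //= [X in _ + X]big1 ?addr0 => [|j jk].
    by rewrite indicE mem_set // mulr1 (ehll_Y_one_cell_ge n0 c0 r0).
  rewrite indicE memNset ?mulr0 // => Bj; move/eqP: jk; apply; apply: val_inj.
  by have [_] := Bj 0%N isT; rewrite /= r0 => -[].
rewrite big1; first by rewrite ltW // ehll_Y_gt0.
by move=> k _; rewrite indicE memNset ?mulr0 // => Bk; apply: nB; exists k.
Qed.

End one_cell.

Section integral_ehll_f.
Context {R : realType}.
Implicit Types (c u : R).

(** From [ln (1 + N / D) >= N / (D + N)] and [ln 2 <= 1]; such a decrease like [1 / u] is what makes
    the integral diverge for one cell. *)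
Lemma ehll_f_ge u : 0 <= u -> 3^-1 * (1 + u)^-1 <= ehll_f u.
Proof.
move=> u0; rewrite ehll_f_log //.
set D := 12 + 27 * u + _ + _; set N := 12 + 11 * u + _.
have u2 := exprn_ge0 2 u0; have u3 := exprn_ge0 3 u0.
have D0 : 0 < D by rewrite /D; lra.
have N0 : 0 < N by rewrite /N; lra.
have l0 : 0 < ln 2 :> R by rewrite ln_gt0 // ltr1n.
have l1 : ln 2 <= 1 :> R by have := @le_ln1Dx R 1; apply; lra.
have ln_ge : N / (D + N) <= ln (1 + N / D).
  have h : 0 < 1 + N / D by rewrite addr_gt0 // divr_gt0.
  have := @le_ln1Dx R (- (N / (D + N))).
  have -> : 1 + - (N / (D + N)) = (1 + N / D)^-1.
    by field; rewrite !gt_eqF //; lra.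
  rewrite lnV ?posrE // lerN2; apply.
  rewrite ltrN2 ltr_pdivrMr; lra.
have ND0 : 0 <= N / (D + N) by rewrite divr_ge0 //; lra.
apply: (@le_trans _ _ (N / (D + N))).
  rewrite ler_pdivlMr; last by lra.
  rewrite -mulrA -ler_pdivlMl ?invr_gt0 // invrK -ler_pdivlMl ?invr_gt0 ?invrK; last by lra.
  rewrite /N /D; have := mulr_ge0 u0 u2; lra.
rewrite ler_pdivlMr //; apply: le_trans ln_ge.
by rewrite ler_piMr.
Qed.

Lemma is_derive_addl (a : R) u : is_derive u 1 (fun x : R => a + x) 1.
Proof. by apply: is_derive_eq; rewrite add0r mulr1. Qed.

Lemma derivable_inv_addl (a : R) u : 0 < a + u -> derivable (fun x : R => (a + x)^-1) u 1.
Proof.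
move=> au; have d := @is_deriveV R _ u _ _ (lt0r_neq0 au) (is_derive_addl a u).
exact: (@ex_derive _ _ _ _ _ _ _ d).
Qed.

(** Integrable minorants of [1 / (1 + u)] with unbounded integrals; [c = exp N] gives the integral
    [N]. *)
Lemma integral_inv_diff c : 1 <= c ->
  (\int[lebesgue_measure]_(u in `[0%R, +oo[) ((1 + u)^-1 - (c + u)^-1)%:E = (ln c)%:E)%E.
Proof.
move=> c1; pose F u := ln (1 + u) - ln (c + u).
have F0 : ln c = 0 - F 0 by rewrite /F !addr0 ln1 !sub0r opprK.
have dl a u : 0 < a + u -> is_derive u 1 (fun x : R => ln (a + x)) (a + u)^-1.
  move=> au; have d1 := is_derive_addl a u.
  have d2 := @is_derive1_comp R (@ln R) (fun x : R => a + x) u _ _ (is_derive1_ln au) d1.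
  by apply: (is_derive_eq d2); rewrite mulr1.
rewrite F0.
apply: (@integral_0y_FTC R F (fun u => (1 + u)^-1 - (c + u)^-1) 0 (c - 1)).
- by move=> u u0; rewrite subr_ge0 lef_pV2 ?posrE; lra.
- by move=> u u0; apply: derivableB; apply: derivable_inv_addl; lra.
- move=> u u0; have d1 : is_derive u 1 (fun x : R => ln (1 + x)) (1 + u)^-1 by apply: dl; lra.
  have d2 : is_derive u 1 (fun x : R => ln (c + x)) (c + u)^-1 by apply: dl; lra.
  exact: is_deriveB.
move=> u u0; have u1 : 0 < 1 + u by lra.
have uc : 0 < c + u by lra.
rewrite /F subr0 distrC ger0_norm; last by rewrite subr_ge0 ler_ln ?posrE; lra.
rewrite -ln_div ?posrE //.
have -> : (c + u) / (1 + u) = 1 + (c - 1) / (1 + u) by field; rewrite gt_eqF.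
have q0 : 0 <= (c - 1) / (1 + u) by rewrite divr_ge0 ?subr_ge0 // ltW.
apply: (@le_trans _ _ ((c - 1) / (1 + u))); first by apply: le_ln1Dx; lra.
by rewrite ler_wpM2l ?subr_ge0 // lef_pV2 ?posrE //; lra.
Qed.

Lemma integral_ehll_f :
  (\int[lebesgue_measure]_(u in `[0%R, +oo[) (ehll_f u : R)%:E = +oo)%E.
Proof.
apply: (@ereal_eq_pinfty R 3^-1) => // N.
have c1 : 1 <= expR N%:R :> R by have := expR_ge1Dx (N%:R : R); have : 0 <= N%:R :> R by []; lra.
have := integral_inv_diff c1; rewrite expRK => IE.
have Dge (u : R) : `[0, +oo[%classic u -> 0 <= u by rewrite /= in_itv /= andbT.
have mV (a : R) : 0 < a -> measurable_fun (`[0, +oo[%classic : set R) (fun u : R => (a + u)^-1).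
  by move=> a0; apply: measurable_fun_derivable => u u0; apply: derivable_inv_addl; lra.
have c0 : 0 < expR N%:R :> R by lra.
have mG : measurable_fun (`[0, +oo[%classic : set R)
    (fun u => ((1 + u)^-1 - (expR N%:R + u)^-1)%:E).
  by apply/measurable_EFinP; apply: measurable_funB; exact: mV.
have G0 u : `[0, +oo[%classic u -> (0 <= ((1 + u)^-1 - (expR N%:R + u)^-1)%:E)%E.
  by move=> /Dge u0; rewrite lee_fin subr_ge0 lef_pV2 ?posrE; lra.
rewrite EFinM -IE -ge0_integralZl ?lee_fin //.
apply: ge0_le_integral => //.
- by move=> u Du; rewrite mule_ge0 ?G0 // lee_fin.
- exact: measurable_funeM.
- by apply/measurable_EFinP; exact: measurable_ehll_f.
move=> u Du; have u0 := Dge u Du; rewrite -EFinM lee_fin; apply: le_trans (ehll_f_ge u0).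
rewrite ler_pM2l ?invr_gt0 // gerBl invr_ge0; lra.
Qed.

End integral_ehll_f.

(** * Splitting the error into a bounded part and a vanishing part *)

Definition clamp (R : realType) (b x : R) : R := Num.max (- b) (Num.min b x).

Lemma norm_clamp_le (R : realType) (b x : R) : 0 <= b -> `|clamp b x| <= b.
Proof.
move=> b0; rewrite ler_norml /clamp le_max lexx /= ge_max ge_min lexx andbT /=; lra.
Qed.

Lemma clamp_dist_le (R : realType) (b e x : R) : 0 <= b -> 0 <= e -> `|x| <= b + e ->
  `|x - clamp b x| <= e.
Proof.
move=> b0 e0; rewrite !ler_norml => /andP[h1 h2]; rewrite /clamp.
have [bx|xb] := leP b x.
  have -> : Num.max (- b) b = b by apply/max_idPr; lra.
  by apply/andP; split; lra.
have [xb'|bx'] := leP (- b) x; apply/andP; split; lra.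
Qed.

Theorem theorem4p1 (R : realType) (d : measure_display)
    (Omega : measurableType d) (P : probability Omega R)
    (m : nat) (m_ge1 : (1 <= m)%N)
    (cell rho : nat -> {RV P >-> nat}) (model : ehll_model m cell rho) :
  exists eps o : nat -> R,
    [/\ forall n, `|eps n| <= 84 / 10 ^+ 6,
        o @ \oo --> (0 : R)
      & \forall n \near \oo,
          'E_P[ehll_Y cell rho R m n]%E =
            ((n%:R / m%:R)%:E *
             (\int[lebesgue_measure]_(u in `[0%R, +oo[) (ehll_f u ^+ m)%:E
              + (eps n / m%:R)%:E + (o n)%:E))%E ].
Proof.
have b0 : 0 <= 84 / 10 ^+ 6 :> R by rewrite divr_ge0 // exprn_ge0.
have [m1|m2] := leqP m 1.
  have {m_ge1 m1} em : m = 1%N by apply/eqP; rewrite eqn_leq m1.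
  rewrite em in model *.
  (* Both sides are infinite. *)
  exists (fun=> 0), (fun=> 0); split => [n||]; [by rewrite normr0|exact: cvg_cst|].
  near=> n; have n0 : (0 < n)%N by near: n; exact: nbhs_infty_gt.
  rewrite unlock (integral_ehll_Y_one_cell model n0).
  under eq_integral do rewrite expr1.
  by rewrite integral_ehll_f mul0r !adde0 gt0_muley // lte_fin divr_gt0 // ltr0n n0.
have mR0 : 0 < m%:R :> R by rewrite ltr0n ltnW.
pose L : R := fine (\int[lebesgue_measure]_(u in `[0%R, +oo[) (ehll_f u ^+ m)%:E)%E.
pose c n : R := mean_Y m cell rho n * m%:R / n%:R.
(* Since [|D n| <= 84 / 10 ^ 6 + m * e] eventually for every [e > 0], its clamped value serves as
   [eps], bounded for all [n], and the excess divided by [m] tends to 0. *)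
pose D n := m%:R * (c n - L).
exists (fun n => clamp (84 / 10 ^+ 6) (D n)).
exists (fun n => (D n - clamp (84 / 10 ^+ 6) (D n)) / m%:R).
split => [n||]; first exact: norm_clamp_le.
  apply/cvgrPdist_le => e e0.
  apply: filterS (mean_Y_asymptotics m2 model e0) => n.
  rewrite -/(c n) -/L sub0r normrN normrM normfV (ger0_norm (ltW mR0)) ler_pdivrMr // => h.
  apply: clamp_dist_le => //; first by rewrite mulr_ge0 // ltW.
  rewrite /D normrM (ger0_norm (ltW mR0)) mulrC -ler_pdivlMr //.
  by rewrite mulrDl mulfK // gt_eqF.
near=> n; have n0 : (0 < n)%N by near: n; exact: nbhs_infty_gt.
rewrite unlock -(fineK (integral_ehll_Y_fin_num m2 model n)) -/(mean_Y m cell rho n).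
rewrite -(fineK (integral_ehll_f_fin_num R m2)) -/L -!EFinD -EFinM; congr (_%:E).
rewrite -addrA -mulrDl subrKC /D /c; field.
by rewrite gt_eqF // pnatr_eq0 -lt0n n0.
Unshelve. all: by end_near.
Qed.
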